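(* Let $p>0$, $k=\lceil p\rceil$, $\omega=p+1-k$, and let $(X^{(n)}_i)_{i\in T_n}$ be a sequence of mean-zero random fields as in the context, with $\liminf_{n\to\infty}\sigma_n^2/|T_n|>0$ and $\alpha$-mixing coefficients $(\alpha_{\ell,n})$ (of order $k+1$). If $\sup_{n,i\in T_n}\|X_i^{(n)}\|_r<\infty$ for some $r\in(k+1+\omega,\infty]$, then for any $f\in\mathcal C^{k,\omega}(\mathbb R)$ and $m\in\mathbb N_+$, $$\mathbb E[W_nf(W_n)]=\sum_{j=1}^k\frac{\kappa_{j+1}(W_n)}{j!}\,\mathbb E[\partial^jf(W_n)]+\mathcal O\Bigl(|f|_{k,\omega}|T_n|^{-(k+\omega-1)/2}\Bigl(m^{d(k+\omega)}+\sum_{\ell=m+1}^{m+1+\lfloor|T_n|^{1/d}/2\rfloor}\ell^{d(k+\omega)-\omega}\alpha_{\ell,n}^{(r-k-1-\omega)/r}\Bigr)\Bigr).$$ If (without the preceding strict-moment assumption) $\sup_{n,i\in T_n}\|X_i^{(n)}\|_r<\infty$ with $r=k+1+\omega$, then for any $f\in\mathcal C^{k,\omega}(\mathbb R)$ and $m\in\mathbb N_+$ such that $\alpha_{m+1,n}=0$, $$\mathbb E[W_nf(W_n)]=\sum_{j=1}^k\frac{\kappa_{j+1}(W_n)}{j!}\,\mathbb E[\partial^jf(W_n)]+\mathcal O\bigl(|f|_{k,\omega}|T_n|^{-(k+\omega-1)/2}m^{d(k+\omega)}\bigr).$$ The implied constants do not depend on $n$, $f$ or $m$.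
   Context: Setting. Fix $d\in\mathbb N_+$. $T_1\subseteq T_2\subseteq\cdots$ are finite nonempty subsets of $\mathbb Z^d$ with $|T_n|\to\infty$. For each $n$, $(X^{(n)}_i)_{i\in T_n}$ is a family of real random variables with mean zero and finite second moments (no stationarity is assumed). Put $\sigma_n^2:=\operatorname{Var}(\sum_{i\in T_n}X^{(n)}_i)$ and $W_n:=\sigma_n^{-1}\sum_{i\in T_n}X^{(n)}_i$ (defined when $\sigma_n>0$; the estimates are for all sufficiently large $n$). $\|X\|_r:=(\mathbb E|X|^r)^{1/r}$ for $r<\infty$, and $\|X\|_\infty$ is the essential supremum norm. When $r=\infty$, ratios $(r-a)/r$ with finite $a$ are read as $1$. $\kappa_j(W_n)$ is the $j$-th cumulant of $W_n$; $\partial$ is differentiation. Mixing coefficients. For sub-$\sigma$-algebras $\mathcal A,\mathcal B$, $\alpha(\mathcal A,\mathcal B):=\sup_{A\in\mathcal A,B\in\mathcal B}|\mathbb P(A\cap B)-\mathbb P(A)\mathbb P(B)|$. For positive integers $\ell,q$, $\alpha^{[q]}_{\ell,n}:=0\vee\sup\{\alpha(\sigma(X^{(n)}_i:i\in U_1),\sigma(X^{(n)}_i:i\in U_2)):U_1,U_2\subseteq T_n,\ |U_1|\le q,\ d(U_1,U_2)\ge\ell\}$, where $d(U_1,U_2)=\min\{\|i_1-i_2\|:i_1\in U_1,i_2\in U_2\}$ and $\|\cdot\|$ is the maximum norm. Throughout, $\alpha_{\ell,n}:=\alpha_{\ell,n}^{[k+1]}$ with $k=\lceil p\rceil$. Hölder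 spaces. $f\in\mathcal C^{k,\omega}(\mathbb R)$ means $f\in\mathcal C^k(\mathbb R)$ and $|f|_{k,\omega}:=\sup_{x\ne y}|f^{(k)}(x)-f^{(k)}(y)|/|x-y|^\omega<\infty$. *)

(* Defs.v *)
From HB Require Import structures.
From mathcomp Require Import all_boot all_order all_algebra.
From mathcomp Require Import finmap.
From mathcomp Require Import all_classical all_reals all_analysis.

Set Implicit Arguments.
Unset Strict Implicit.
Unset Printing Implicit Defensive.

Import Order.TTheory GRing.Theory Num.Theory.
Import numFieldNormedType.Exports.

Local Open Scope classical_set_scope.
Local Open Scope ring_scope.

(* Points of Z^d are row vectors of integers. *)
Definition maxdist (d : nat) (i j : 'rV[int]_d) : nat :=
  \max_(c < d) `|i ord0 c - j ord0 c|%N.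

Section mixing.
Context {disp : measure_display} {Omega : measurableType disp} {R : realType}.
Variable P : probability Omega R.

Definition alpha (A B : set_system Omega) : R :=
  sup [set `|fine (P (a `&` b)) - fine (P a) * fine (P b)|
      | a in A & b in B].

Context {d : nat} {D : {fset 'rV[int]_d}}.
Variable X : D -> {RV P >-> R}.

Definition sigma_of (U : {set D}) : set_system Omega :=
  <<s \bigcup_(i in [set` U]) preimage_set_system setT (X i) measurable >>.

(* It is +oo when one of the two sets is empty. *)
Definition setdist (U1 U2 : {set D}) : \bar R :=
  ereal_inf [set ((maxdist (val i) (val j))%:R : R)%:E
            | i in [set` U1] & j in [set` U2]].

Definition alpha_mixing (q l : nat) : R :=
  Num.max 0 (sup [set x | exists U1 U2 : {set D},
    [/\ (#|U1| <= q)%N, ((l%:R : R)%:E <= setdist U1 U2)%E &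
        x = alpha (sigma_of U1) (sigma_of U2)]]).

Definition field_sum : Omega -> R := fun t => \sum_(i : D) X i t.

Definition sigma2 : R := fine 'V_P[field_sum]%E.

(* The value at sigma2 = 0 is a convention: there W is the zero function. *)
Definition normalized_sum : Omega -> R :=
  fun t => (Num.sqrt sigma2)^-1 * field_sum t.

End mixing.

Section cumulants.
Context {disp : measure_display} {Omega : measurableType disp} {R : realType}.
Variables (P : probability Omega R) (W : Omega -> R).

Definition moment (j : nat) : R := fine ('E_P[fun t => (W t ^+ j)%R])%E.

(* The series sum_i E[W^i] s^i / i! of E[exp(s W)], truncated after s^j. *)
Definition moment_poly (j : nat) : {poly R} :=
  \poly_(i < j.+1) (moment i / (i`!)%:R).

(* The j-th cumulant is j! times the coefficient of s^j in the cumulant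
   generating series log E[exp(s W)].  The logarithm is that of formal power
   series, log(1 + u) = sum_(q >= 1) (-1)^(q+1) u^q / q; here u has no constant
   term, so s^j gets no contribution from q > j nor from moments of order > j.
   This definition only needs W to have a finite moment of order j. *)
Definition cumulant (j : nat) : R :=
  (j`!)%:R *
  (\sum_(1 <= q < j.+1) ((-1) ^+ q.+1 / q%:R) *: (moment_poly j - 1) ^+ q)`_j.

End cumulants.

Section holder.
Context {R : realType}.

Definition continuously_differentiable (k : nat) (f : R -> R) : Prop :=
  (forall j x, (j < k)%N -> derivable (derive1n j f) x 1) /\
  continuous (derive1n k f).

Definition holder_seminorm (k : nat) (w : R) (f : R -> R) : \bar R :=
  ereal_sup [set
    (`|derive1n k f z.1 - derive1n k f z.2| / `|z.1 - z.2| `^ w)%:E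
    | z in [set z : R * R | z.1 != z.2]].

Definition holder_space (k : nat) (w : R) : set (R -> R) :=
  [set f | continuously_differentiable k f /\
           (holder_seminorm k w f < +oo)%E].

(* The limit of (r - a) / r is used at r = +oo; r = -oo never occurs. *)
Definition exponent_ratio (r : \bar R) (a : R) : R :=
  if r is s%:E then (s - a) / s else 1.

End holder.

Definition expansion_error {disp : measure_display}
    {Omega : measurableType disp} {R : realType} (P : probability Omega R)
    (W : Omega -> R) (k : nat) (f : R -> R) : \bar R :=
  ('E_P[fun t => (W t * f (W t))%R] -
   \sum_(1 <= j < k.+1)
      (cumulant P W j.+1 / (j`!)%:R)%R%:E * 'E_P[fun t => derive1n j f (W t)])%E.

Definition sup_Lnorm {disp : nat -> measure_display}
    {Omega : forall n, measurableType (disp n)} {R : realType}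
    {P : forall n, probability (Omega n) R} {d : nat}
    {T : nat -> {fset 'rV[int]_d}} (X : forall n, T n -> {RV (P n) >-> R})
    (r : \bar R) : \bar R :=
  ereal_sup [set x | exists n (i : T n), x = 'N[P n]_r[EFin \o X n i]%E].

(* Main.v *)
Require Import Defs.
From HB Require Import structures.
From mathcomp Require Import all_boot all_order all_algebra.
From mathcomp Require Import finmap.
From mathcomp Require Import all_classical all_reals all_analysis.
From mathcomp Require Import measurable_realfun ess_sup_inf ring lra zify.

Set Implicit Arguments.
Unset Strict Implicit.
Unset Printing Implicit Defensive.

Import Order.TTheory GRing.Theory Num.Theory.
Import numFieldNormedType.Exports.

Local Open Scope classical_set_scope.
Local Open Scope ring_scope.

(** Write S for the sum of the field. For a single point i, E[X_i g(S)] is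
    expanded by removing from S, one dyadic scale 2^v at a time, the points at
    distance less than 2^v from the points met so far. Each removal is a Taylor
    expansion of g; its terms bring in new points, and the argument is repeated
    with one derivative less. What is left after crossing a gap 2^v is centred,
    hence of the size of the mixing coefficient at distance 2^v, while 2^(vd)
    counts the points added at that scale; the geometric growth of these counts
    in v makes the whole error a single sum over the largest scale. The
    expansion is thus sum_j c_j E[g^(j)(S)] with coefficients c_j that do not
    depend on g. Applied to the monomials of degree at most k, whose k-th
    derivative is constant, it is exact, and this forces c_j = kappa_(j+1) / j!.
    The moments enter through a covariance inequality for products of the X_i,
    proved by truncation at the level 1/alpha. *)

(** * Covariance under strong mixing *)

(** The moments are just enough: the points extracted from the sum and the degree of what remains
    share the budget [k + 1 + w], so no inequality may waste an exponent. Hence the class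
    [of_degree]: each factor is dominated pointwise by a power of a variable of mean at most 1, and
    averaging such witnesses does the work of Hoelder's inequality, with constants free of [r]. This
    freedom also settles [r = +oo], where a finite exponent depending on [n] is used. Centring is
    what gives the decay. A function is split into its centred part, telescoped down to the empty
    sum where it vanishes, and its mean, which splits off as a factor and in which the full sum is
    restored. Both moves lead to functionals of one kind, the [state], so a single induction on the
    number of derivatives covers all nested terms without writing them out. If a mixing coefficient
    vanishes and only the critical moment is available, the exponent is 0 but the bound must still
    be 0; this comes from letting the truncation level tend to infinity, and dictates the convention
    in [rho]. *)

Section mean.
Context {disp : measure_display} {Omega : measurableType disp} {R : realType}.
Variable P : probability Omega R.
Implicit Types Y Z V : Omega -> R.

Definition mean Z : R := fine ('E_P[Z])%E.
Definition intg Z : Prop := P.-integrable setT (EFin \o Z).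

Lemma meanE Z : mean Z = \int[P]_t Z t.
Proof. by rewrite /mean unlock. Qed.

Lemma EFin_mean Z : intg Z -> ('E_P[Z] = (mean Z)%:E)%E.
Proof. by move=> iZ; rewrite /mean fineK// unlock integrable_fin_num. Qed.

Lemma intg_measurable Z : intg Z -> measurable_fun setT Z.
Proof. by move=> /measurable_int/measurable_EFinP. Qed.

Lemma intgD Y Z : intg Y -> intg Z -> intg (fun t => Y t + Z t).
Proof.
move=> iY iZ; have := integrableD measurableT iY iZ.
by apply: eq_integrable => // t _; rewrite /= EFinD.
Qed.

Lemma intgZ c Z : intg Z -> intg (fun t => c * Z t).
Proof.
move=> iZ; have := integrableZl measurableT c iZ.
by apply: eq_integrable => // t _; rewrite /= EFinM.
Qed.

Lemma intg_cst c : intg (fun=> c).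
Proof. exact: finite_measure_integrable_cst. Qed.

Lemma eq_intg Y Z : (forall t, Y t = Z t) -> intg Z -> intg Y.
Proof. by move=> YZ; rewrite (_ : Y = Z)//; exact/funext. Qed.

Lemma eq_mean Y Z : (forall t, Y t = Z t) -> mean Y = mean Z.
Proof. by move=> YZ; rewrite (_ : Y = Z)//; exact/funext. Qed.

Lemma intg_sum (I : Type) (s : seq I) (Q : pred I) (F : I -> Omega -> R) :
  (forall i, Q i -> intg (F i)) -> intg (fun t => \sum_(i <- s | Q i) F i t).
Proof.
move=> iF; elim: s => [|i s ih].
  by apply: eq_intg (intg_cst 0) => t; rewrite big_nil.
have [Qi|nQi] := boolP (Q i).
  by apply: eq_intg (intgD (iF _ Qi) ih) => t; rewrite big_cons Qi.
by apply: eq_intg ih => t; rewrite big_cons (negbTE nQi).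
Qed.

Lemma intg_le V Z : measurable_fun setT Z -> (forall t, `|Z t| <= V t) ->
  intg V -> intg Z.
Proof.
move=> mZ ZV iV; apply: le_integrable iV => //; first exact/measurable_EFinP.
by move=> t _; rewrite /= lee_fin (le_trans (ZV t))// ler_norm.
Qed.

Lemma intg_norm Z : intg Z -> intg (fun t => `|Z t|).
Proof. exact: integrable_norm. Qed.

Lemma meanD Y Z : intg Y -> intg Z ->
  mean (fun t => Y t + Z t) = mean Y + mean Z.
Proof. by move=> iY iZ; rewrite !meanE RintegralD. Qed.

Lemma meanB Y Z : intg Y -> intg Z ->
  mean (fun t => Y t - Z t) = mean Y - mean Z.
Proof. by move=> iY iZ; rewrite !meanE RintegralB. Qed.

Lemma meanZ c Z : intg Z -> mean (fun t => c * Z t) = c * mean Z.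
Proof. by move=> iZ; rewrite !meanE RintegralZl. Qed.

Lemma mean_cst c : mean (fun=> c) = c.
Proof. by rewrite /mean (expectation_cst P c). Qed.

Lemma mean_sum (I : Type) (s : seq I) (Q : pred I) (F : I -> Omega -> R) :
  (forall i, Q i -> intg (F i)) ->
  mean (fun t => \sum_(i <- s | Q i) F i t) = \sum_(i <- s | Q i) mean (F i).
Proof.
move=> iF; elim: s => [|i s ih].
  by rewrite big_nil -[RHS]mean_cst; apply: eq_mean => t; rewrite big_nil.
rewrite big_cons; case: ifPn => [Qi|nQi].
  rewrite -ih -meanD; [|exact: iF|exact: intg_sum].
  by apply: eq_mean => t; rewrite big_cons Qi.
by rewrite -ih; apply: eq_mean => t; rewrite big_cons (negbTE nQi).
Qed.

Lemma le_mean Y Z : intg Y -> intg Z -> (forall t, Y t <= Z t) ->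
  mean Y <= mean Z.
Proof. by move=> iY iZ YZ; rewrite !meanE le_Rintegral. Qed.

Lemma mean_ge0 Z : (forall t, 0 <= Z t) -> 0 <= mean Z.
Proof. by move=> Z0; rewrite meanE Rintegral_ge0. Qed.

Lemma norm_mean_le Z V : intg V -> measurable_fun setT Z ->
  (forall t, `|Z t| <= V t) -> `|mean Z| <= mean V.
Proof.
move=> iV mZ ZV; have iZ := intg_le mZ ZV iV.
rewrite !meanE; apply: le_trans (le_normr_Rintegral measurableT iZ) _.
by apply: le_Rintegral => //; exact: intg_norm.
Qed.

Lemma mean_indic (a : set Omega) : measurable a -> mean \1_a = fine (P a).
Proof. by move=> ma; rewrite /mean expectation_indic. Qed.

Lemma intg_indic (a : set Omega) : measurable a -> intg \1_a.
Proof. by move=> ma; exact: integrable_indic. Qed.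

Definition cov Y Z : R := mean (fun t => Y t * Z t) - mean Y * mean Z.

Lemma covC Y Z : cov Y Z = cov Z Y.
Proof.
rewrite /cov (mulrC (mean Y)); congr (_ - _).
by apply: eq_mean => t; rewrite mulrC.
Qed.

Lemma cov_sum (n : nat) (F : 'I_n -> Omega -> R) Z :
  (forall i, intg (F i)) -> (forall i, intg (fun t => F i t * Z t)) ->
  cov (fun t => \sum_i F i t) Z = \sum_i cov (F i) Z.
Proof.
move=> iF iFZ; rewrite /cov sumrB -mulr_suml mean_sum//; congr (_ - _).
by rewrite -mean_sum//; apply: eq_mean => t; rewrite mulr_suml.
Qed.

Lemma covZ c Y Z : intg Y -> intg (fun t => Y t * Z t) ->
  cov (fun t => c * Y t) Z = c * cov Y Z.
Proof.
move=> iY iYZ; rewrite /cov mulrBr mulrA -(meanZ c iY) -(meanZ c iYZ); congr (_ - _).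
by apply: eq_mean => t; rewrite mulrA.
Qed.

Lemma cov_shift c Y Z : intg Y -> intg Z -> intg (fun t => Y t * Z t) ->
  cov (fun t => Y t + c) Z = cov Y Z.
Proof.
move=> iY iZ iYZ; rewrite /cov meanD//; last exact: intg_cst.
rewrite mean_cst (eq_mean (Z := fun t => Y t * Z t + c * Z t)); last first.
  by move=> t; rewrite mulrDl.
by rewrite meanD ?meanZ//; [ring|exact: intgZ].
Qed.

End mean.

Section covariance_inequality.
Context {disp : measure_display} {Omega : measurableType disp} {R : realType}.
Variable P : probability Omega R.
Implicit Types Y Z V : Omega -> R.

(** The sum counts the positive integers not exceeding (n + 1) y, so it is the integer part of that
    number. *)
Lemma sum_levels (n : nat) (y : R) : 0 <= y <= 1 ->
  `|n.+1%:R * y - \sum_(i < n.+1) ((i.+1%:R <= n.+1%:R * y)%R)%:R| <= 1.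
Proof.
move=> /andP[y0 y1]; set x := n.+1%:R * y.
have x0 : 0 <= x by rewrite mulr_ge0.
have tn : (Num.truncn x <= n.+1)%N.
  by rewrite -(ler_nat R) (le_trans (_ : _ <= x)) ?truncn_le// ler_piMr.
have -> : \sum_(i < n.+1) ((i.+1%:R <= x)%R)%:R = (Num.truncn x)%:R :> R.
  under eq_bigr do rewrite -truncn_gt_nat.
  rewrite -natr_sum; congr (_%:R).
  rewrite -(big_mkord xpredT (fun i => nat_of_bool (i < Num.truncn x)%N)).
  rewrite (big_cat_nat (n := Num.truncn x))//= -[RHS]addn0; congr (_ + _)%N.
    rewrite big_nat_cond (eq_bigr (fun=> 1%N)) => [|i].
      by rewrite -big_nat_cond sum_nat_const_nat subn0 muln1.
    by rewrite andbT => /andP[_ ->].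
  by rewrite big_nat big1// => i /andP[ti _]; rewrite ltnNge ti.
have /andP[h1 h2] := truncn_itv x0.
rewrite ger0_norm ?subr_ge0// lerBlDr addrC; move: h2.
by rewrite -natr1 => /ltW.
Qed.

Section events.
Variables (A B : set_system Omega) (al : R).
Hypotheses (mA : forall a, A a -> measurable a)
  (mB : forall b, B b -> measurable b)
  (al_bound : forall a b, A a -> B b ->
    `|fine (P (a `&` b)) - fine (P a) * fine (P b)| <= al).

Lemma indic_mul (a b : set Omega) t : \1_a t * \1_b t = \1_(a `&` b) t :> R.
Proof. by rewrite !indicE in_setI -natrM mulnb. Qed.

Lemma cov_indic a b : A a -> B b -> `|cov P \1_a \1_b| <= al.
Proof.
move=> Aa Bb; rewrite /cov (eq_mean P (Z := \1_(a `&` b))); last exact: indic_mul.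
rewrite !mean_indic; [exact: al_bound|exact: mB|exact: mA|].
by apply: measurableI; [exact: mA|exact: mB].
Qed.

(** Discrete layer-cake formula: an average of indicators of superlevel sets, within 1 / (n + 1) of
    a [Y] with values in [0, 1]. *)
Let level (n : nat) Y t : R :=
  n.+1%:R^-1 * \sum_(i < n.+1) \1_[set s | i.+1%:R / n.+1%:R <= Y s] t.

Let level_approx n Y t : 0 <= Y t <= 1 -> `|Y t - level n Y t| <= n.+1%:R^-1.
Proof.
move=> Yt; have := sum_levels n Yt; rewrite -(@ler_pM2l _ n.+1%:R^-1) ?invr_gt0//.
rewrite mulr1; apply: le_trans; rewrite -[X in X * _]ger0_norm; last first.
  by rewrite invr_ge0.
rewrite -normrM mulrBr mulrA mulVf// mul1r le_eqVlt; apply/orP; left.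
apply/eqP; congr (`| _ - _ * _|); apply: eq_bigr => i _.
rewrite indicE; congr (nat_of_bool _)%:R.
have E : (i.+1%:R / n.+1%:R <= Y t) = (i.+1%:R <= n.+1%:R * Y t).
  by rewrite ler_pdivrMr// mulrC.
by apply/idP/idP => [/set_mem/=|]; rewrite -E// => ?; apply/mem_set.
Qed.

Let level01 n Y t : 0 <= level n Y t <= 1.
Proof.
rewrite mulr_ge0 ?invr_ge0//=; last first.
  by apply: sumr_ge0 => i _; rewrite indicE.
rewrite ler_pdivrMl// mulr1.
apply: (@le_trans _ _ (\sum_(i < n.+1) 1)); last by rewrite sumr_const card_ord.
by apply: ler_sum => i _; rewrite indicE; case: (_ \in _).
Qed.

Let level_sum n Y t : level n Y t =
  \sum_(i < n.+1) n.+1%:R^-1 * \1_[set s | i.+1%:R / n.+1%:R <= Y s] t.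
Proof. by rewrite /level mulr_sumr. Qed.

Lemma bounded_intg Y c : measurable_fun setT Y -> (forall t, `|Y t| <= c) ->
  intg P Y.
Proof. by move=> mY Yc; apply: (intg_le mY Yc); exact: intg_cst. Qed.

Lemma norm01 (x : R) : 0 <= x <= 1 -> `|x| <= 1.
Proof. by move=> /andP[x0 x1]; rewrite ger0_norm. Qed.

(** Covariance is bilinear, so between two [level] approximations it is an average of covariances of
    events, each at most [al]; the constant is 1 because the weights sum to 1. *)
Lemma cov01 Y Z : measurable_fun setT Y -> measurable_fun setT Z ->
  (forall t, 0 <= Y t <= 1) -> (forall t, 0 <= Z t <= 1) ->
  (forall x, A [set t | x <= Y t]) -> (forall x, B [set t | x <= Z t]) ->
  `|cov P Y Z| <= al.
Proof.
move=> mY mZ Y01 Z01 AY BZ.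
have mlevel (E : set_system Omega) V n : (forall a, E a -> measurable a) ->
    (forall x, E [set t | x <= V t]) -> measurable_fun setT (level n V).
  move=> mE EV; apply: measurable_funM => //; apply: measurable_sum => i.
  by apply: measurable_indic; apply: mE.
have iY := bounded_intg mY (fun t => norm01 (Y01 t)).
have iZ := bounded_intg mZ (fun t => norm01 (Z01 t)).
have iYZ : intg P (fun t => Y t * Z t).
  apply: (@bounded_intg _ 1) => [|t]; first exact: measurable_funM.
  by rewrite normrM mulr_ile1// norm01.
(* Discretization costs 2 / (n + 1) in the mean of the product and 1 / (n + 1) in each of the two
   single means, hence the 4. *)
apply/ler_addgt0Pr => e e0; pose n := Num.truncn (4 / e).
have ne : 4 / n.+1%:R <= e.
  rewrite ler_pdivrMr// mulrC -ler_pdivrMr//; apply: ltW.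
  by have /andP[] := truncn_itv (divr_ge0 (ler0n _ 4) (ltW e0)).
pose Yn := level n Y; pose Zn := level n Z.
have mYn : measurable_fun setT Yn by exact: mlevel AY.
have mZn : measurable_fun setT Zn by exact: mlevel BZ.
have iYn := bounded_intg mYn (fun t => norm01 (level01 n Y t)).
have iZn := bounded_intg mZn (fun t => norm01 (level01 n Z t)).
have iYZn : intg P (fun t => Yn t * Zn t).
  apply: (@bounded_intg _ 1) => [|t]; first exact: measurable_funM.
  by rewrite normrM mulr_ile1// norm01//; exact: level01.
have covn : `|cov P Yn Zn| <= al.
  have -> : cov P Yn Zn = \sum_(i < n.+1) \sum_(j < n.+1)
      n.+1%:R^-1 * (n.+1%:R^-1 *
      cov P \1_[set s | i.+1%:R / n.+1%:R <= Y s]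
            \1_[set s | j.+1%:R / n.+1%:R <= Z s]).
    rewrite (_ : Yn = (fun t => \sum_(i < n.+1) n.+1%:R^-1 *
        \1_[set s | i.+1%:R / n.+1%:R <= Y s] t)); last first.
      by apply/funext => t; rewrite /Yn level_sum.
    have ia i : intg P \1_[set s | i.+1%:R / n.+1%:R <= Y s].
      by apply: intg_indic; apply: mA.
    have ib i : intg P \1_[set s | i.+1%:R / n.+1%:R <= Z s].
      by apply: intg_indic; apply: mB.
    have iaZ i : intg P (fun t => \1_[set s | i.+1%:R / n.+1%:R <= Y s] t * Zn t).
      apply: (@bounded_intg _ 1) => [|t].
        by apply: measurable_funM => //; exact: (intg_measurable (ia i)).
      rewrite normrM mulr_ile1// norm01//; last exact: level01.
      by rewrite indicE ler0n lern1; case: (_ \in _).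
    rewrite cov_sum => [|i|i]; last 2 first.
    - exact: intgZ.
    - by apply: eq_intg (intgZ n.+1%:R^-1 (iaZ i)) => t; rewrite -mulrA.
    apply: eq_bigr => i _; rewrite covZ// -mulr_sumr; congr (_ * _).
    have iab j : intg P (fun t => \1_[set s | j.+1%:R / n.+1%:R <= Z s] t *
        \1_[set s | i.+1%:R / n.+1%:R <= Y s] t).
      apply: eq_intg (indic_mul _ _) _; apply: intg_indic.
      by apply: measurableI; [exact: mB|exact: mA].
    rewrite covC (_ : Zn = (fun t => \sum_(i < n.+1) n.+1%:R^-1 *
        \1_[set s | i.+1%:R / n.+1%:R <= Z s] t)); last first.
      by apply/funext => t; rewrite /Zn level_sum.
    rewrite cov_sum => [|j|j]; last 2 first.
    - exact: intgZ.
    - by apply: eq_intg (intgZ n.+1%:R^-1 (iab j)) => t; rewrite -mulrA.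
    by apply: eq_bigr => j _; rewrite covZ// covC.
  apply: le_trans (ler_norm_sum _ _ _) _.
  have -> : al = \sum_(i < n.+1) n.+1%:R^-1 * al.
    by rewrite -mulr_suml sumr_const card_ord -[n.+1%:R^-1 *+ n.+1]mulr_natl
      mulfV ?pnatr_eq0// mul1r.
  apply: ler_sum => i _.
  rewrite -mulr_sumr normrM ger0_norm ?invr_ge0// ler_wpM2l ?invr_ge0//.
  apply: le_trans (ler_norm_sum _ _ _) _.
  have -> : al = \sum_(i < n.+1) n.+1%:R^-1 * al.
    by rewrite -mulr_suml sumr_const card_ord -[n.+1%:R^-1 *+ n.+1]mulr_natl
      mulfV ?pnatr_eq0// mul1r.
  apply: ler_sum => j _; rewrite normrM ger0_norm ?invr_ge0//.
  by rewrite ler_wpM2l ?invr_ge0// cov_indic.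
have aY t : `|Y t - Yn t| <= n.+1%:R^-1 by exact: level_approx.
have aZ t : `|Z t - Zn t| <= n.+1%:R^-1 by exact: level_approx.
have Yn01 t : 0 <= Yn t <= 1 by exact: level01.
have Zn01 t : 0 <= Zn t <= 1 by exact: level01.
clearbody Yn Zn.
have -> : cov P Y Z = cov P Yn Zn + (cov P Y Z - cov P Yn Zn) by ring.
apply: le_trans (ler_normD _ _) _; apply: lerD => //; apply: le_trans ne.
have mm : `|mean P (fun t => Y t * Z t) - mean P (fun t => Yn t * Zn t)| <=
    2 * n.+1%:R^-1.
  rewrite -meanB// -[leRHS](mean_cst P); apply: norm_mean_le.
  - exact: intg_cst.
  - by apply: measurable_funB; apply: measurable_funM.
  - move=> t; rewrite (_ : _ - _ = (Y t - Yn t) * Z t + Yn t * (Z t - Zn t)); last by ring.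
    apply: le_trans (ler_normD _ _) _; rewrite !normrM.
    have a := norm01 (Yn01 t); have b := norm01 (Z01 t).
    rewrite mulr_natl mulr2n; apply: lerD.
      by rewrite -[leRHS]mulr1 ler_pM.
    by rewrite -[leRHS]mul1r ler_pM.
have m1 V Vn : intg P V -> intg P Vn ->
    (forall t, `|V t - Vn t| <= n.+1%:R^-1) ->
    `|mean P V - mean P Vn| <= n.+1%:R^-1.
  move=> iV iVn VVn.
  rewrite -meanB// -[leRHS](mean_cst P); apply: norm_mean_le => //.
  - exact: intg_cst.
  - by apply: measurable_funB; [exact: intg_measurable iV|exact: intg_measurable iVn].
have m0 V : measurable_fun setT V -> (forall t, 0 <= V t <= 1) ->
    `|mean P V| <= 1.
  move=> mV V01; rewrite -[leRHS](mean_cst P); apply: norm_mean_le => //.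
  - exact: intg_cst.
  - by move=> t; exact: norm01.
rewrite /cov (_ : _ - _ = (mean P (fun t => Y t * Z t) - mean P (fun t => Yn t * Zn t))
   - ((mean P Y - mean P Yn) * mean P Z + mean P Yn * (mean P Z - mean P Zn))); last by ring.
apply: le_trans (ler_normB _ _) _.
rewrite (_ : 4 / _ = 2 * n.+1%:R^-1 + (n.+1%:R^-1 * 1 + 1 * n.+1%:R^-1)); last by ring.
apply: lerD => //; apply: le_trans (ler_normD _ _) _; rewrite !normrM.
by apply: lerD; apply: ler_pM => //; [exact: m1|exact: m0|exact: m0|exact: m1].
Qed.

(** The affine map [nrm] takes [-c, c] onto [0, 1] and superlevel sets to superlevel sets.
    Covariance ignores the shift and gains a factor 2c from each argument, whence the 4. *)
Lemma cov_bounded Y Z cY cZ : 0 < cY -> 0 < cZ ->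
  measurable_fun setT Y -> measurable_fun setT Z ->
  (forall t, `|Y t| <= cY) -> (forall t, `|Z t| <= cZ) ->
  (forall x, A [set t | x <= Y t]) -> (forall x, B [set t | x <= Z t]) ->
  `|cov P Y Z| <= 4 * al * cY * cZ.
Proof.
move=> cY0 cZ0 mY mZ Yc Zc AY BZ.
pose nrm c V t : R := (2 * c)^-1 * V t + 2^-1.
have nrm01 c V t : 0 < c -> `|V t| <= c -> 0 <= nrm c V t <= 1.
  move=> c0; rewrite ler_norml => /andP[h1 h2].
  have c2 : 0 < 2 * c by rewrite mulr_gt0.
  rewrite /nrm; apply/andP; split.
    rewrite -(@ler_pM2l _ (2 * c))// mulr0 mulrDr mulrA mulfV ?gt_eqF// mul1r.
    by rewrite (_ : 2 * c / 2 = c); [lra|field].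
  rewrite -(@ler_pM2l _ (2 * c))// mulr1 mulrDr mulrA mulfV ?gt_eqF// mul1r.
  by rewrite (_ : 2 * c / 2 = c); [lra|field].
have nrmK c V t : 0 < c -> V t = 2 * c * nrm c V t + - c.
  by move=> c0; rewrite /nrm; field; rewrite gt_eqF.
have lev (E : set_system Omega) c V x : 0 < c -> (forall x, E [set t | x <= V t]) ->
    E [set t | x <= nrm c V t].
  move=> c0 EV; rewrite (_ : [set t | _] = [set t | (x - 2^-1) * (2 * c) <= V t])//.
  have h t : (x <= nrm c V t) = ((x - 2^-1) * (2 * c) <= V t).
    by rewrite /nrm -lerBlDr [_ * V t]mulrC ler_pdivlMr ?mulr_gt0.
  by apply/seteqP; split => t /=; rewrite h.
have mnrm c V : measurable_fun setT V -> measurable_fun setT (nrm c V).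
  by move=> mV; apply: measurable_funD => //; apply: measurable_funM.
pose Y' := nrm cY Y; pose Z' := nrm cZ Z.
have Y01 t : 0 <= Y' t <= 1 by exact: nrm01.
have Z01 t : 0 <= Z' t <= 1 by exact: nrm01.
have iY' : intg P Y' by apply: (@bounded_intg _ 1) => [|t]; [exact: mnrm|exact: norm01].
have iZ' : intg P Z' by apply: (@bounded_intg _ 1) => [|t]; [exact: mnrm|exact: norm01].
have iY'Z' : intg P (fun t => Y' t * Z' t).
  apply: (@bounded_intg _ 1) => [|t]; first by apply: measurable_funM; exact: mnrm.
  by rewrite normrM mulr_ile1// norm01.
have iZ : intg P Z by exact: bounded_intg Zc.
have iY'Z : intg P (fun t => Y' t * Z t).
  apply: (@bounded_intg _ cZ) => [|t]; first by apply: measurable_funM => //; exact: mnrm.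
  by rewrite normrM -[leRHS]mul1r ler_pM// norm01.
have iZY : intg P (fun t => Z' t * Y' t) by apply: eq_intg iY'Z' => t; rewrite mulrC.
have c1 : cov P Y Z = 2 * cY * cov P Y' Z.
  rewrite (_ : Y = (fun t => 2 * cY * Y' t + - cY)); last first.
    by apply/funext => t; exact: nrmK.
  rewrite cov_shift ?covZ//; first exact: intgZ.
  by apply: eq_intg (intgZ (2 * cY) iY'Z) => t; rewrite -(mulrA (2 * cY)).
have c2 : cov P Y' Z = 2 * cZ * cov P Y' Z'.
  rewrite covC (_ : Z = (fun t => 2 * cZ * Z' t + - cZ)); last first.
    by apply/funext => t; exact: nrmK.
  rewrite cov_shift ?covZ//; first by rewrite covC.
  - exact: intgZ.
  - by apply: eq_intg (intgZ (2 * cZ) iZY) => t; rewrite -(mulrA (2 * cZ)).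
rewrite c1 c2 !normrM (@ger0_norm _ 2)// (gtr0_norm cY0) (gtr0_norm cZ0).
rewrite (_ : 4 * al * cY * cZ = 2 * cY * (2 * cZ * al)); last by ring.
rewrite !ler_pM2l ?mulr_gt0//; apply: cov01 => //.
- exact: mnrm.
- exact: mnrm.
- by move=> x; exact: lev.
- by move=> x; exact: lev.
Qed.

End events.
End covariance_inequality.

(* A power with 0 at a = 0 even for q = 0, where powR would give 1. *)
Definition rho {R : realType} (a q : R) : R := if a == 0 then 0 else a `^ q.

Section rho_theory.
Context {R : realType}.
Implicit Types a q s x : R.

Lemma rho_ge0 a q : 0 <= rho a q.
Proof. by rewrite /rho; case: ifP => // _; exact: powR_ge0. Qed.

Lemma rho_le1 a q : 0 <= a <= 1 -> 0 <= q -> rho a q <= 1.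
Proof.
move=> /andP[a0 a1] q0; rewrite /rho; case: ifPn => // an0.
rewrite -(powRr0 a); apply: ger_powR => //; rewrite lt0r an0 a0 a1//.
Qed.

Lemma le_rho a q s : 0 <= a <= 1 -> s <= q -> rho a q <= rho a s.
Proof.
move=> /andP[a0 a1] sq; rewrite /rho; case: ifPn => // an0.
by apply: ger_powR => //; rewrite lt0r an0 a0 a1.
Qed.

Lemma powR_le1D x s : 0 <= x -> 0 <= s <= 1 -> x `^ s <= 1 + x.
Proof.
move=> x0 /andP[s0 s1]; have [x1|x1] := leP 1 x.
  by rewrite -[leLHS]add0r lerD// -[leRHS](powRr1 x0) ler_powR.
rewrite -[leLHS]addr0 lerD//; apply: le_trans (_ : 1 `^ s <= _).
  by apply: ge0_ler_powR => //; rewrite ?nnegrE// ltW.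
by rewrite powR1.
Qed.

Definition clip (c x : R) : R := Num.max (- c) (Num.min x c).

Lemma clip_id c x : `|x| <= c -> clip c x = x.
Proof. by rewrite ler_norml => /andP[h1 h2]; rewrite /clip min_l// max_r. Qed.

Lemma norm_clip_le c x : 0 <= c -> `|clip c x| <= c.
Proof.
move=> c0; rewrite ler_norml /clip le_max lexx/= ge_max ge_min lexx orbT andbT.
by rewrite (le_trans _ c0)// oppr_le0.
Qed.

Lemma norm_clip_le_norm c x : 0 <= c -> `|clip c x| <= `|x|.
Proof.
move=> c0; have [xc|cx] := leP `|x| c; first by rewrite clip_id.
by rewrite (le_trans (norm_clip_le _ c0))// ltW.
Qed.

Lemma sub_clip_le c x : 0 <= c -> `|x - clip c x| <= `|x|.
Proof.
move=> c0; have [xc|cx] := leP `|x| c; first by rewrite clip_id// subrr normr0.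
move: cx; rewrite /clip; have [x0|x0] := leP 0 x.
  rewrite ger0_norm// => cx; rewrite min_r ?(ltW cx)// max_r.
    by rewrite ger0_norm ?subr_ge0 ?gerBl// ltW.
  by rewrite (le_trans _ c0)// oppr_le0.
rewrite ltr0_norm// => cx; have xc : x < - c by rewrite ltrNr.
rewrite min_l; last by rewrite (le_trans (ltW x0)).
by rewrite max_l ?(ltW xc)// opprK ltr0_norm; lra.
Qed.

Lemma measurable_clip d (T : measurableType d) (c : R) (Y : T -> R) :
  measurable_fun setT Y -> measurable_fun setT (clip c \o Y).
Proof.
move=> mY; apply: measurable_maxr => //; apply: measurable_minr => //.
Qed.

End rho_theory.

(** * Covariance of unbounded variables, by truncation *)

Section mixing_covariance.
Context {disp : measure_display} {Omega : measurableType disp} {R : realType}.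
Variable P : probability Omega R.
Implicit Types Y Z V xi : Omega -> R.
Variables (A B : set_system Omega) (al : R).
Hypotheses (mA : forall a, A a -> measurable a)
  (mB : forall b, B b -> measurable b)
  (A0 : A set0) (AT : A setT) (B0 : B set0) (BT : B setT)
  (al_bound : forall a b, A a -> B b ->
    `|fine (P (a `&` b)) - fine (P a) * fine (P b)| <= al).

Lemma clip_levels (E : set_system Omega) c Y : 0 <= c -> E set0 -> E setT ->
  (forall x, E [set t | x <= Y t]) ->
  forall x, E [set t | x <= clip c (Y t)].
Proof.
move=> c0 E0 ET EY x; have [xc|cx] := leP x (- c).
  rewrite (_ : [set t | _] = setT)//; apply/seteqP; split => // t _ /=.
  by rewrite /clip le_max xc.
have [xc|xc] := leP x c.
  rewrite (_ : [set t | _] = [set t | x <= Y t])//.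
  have h t : (x <= clip c (Y t)) = (x <= Y t).
    by rewrite /clip le_max leNgt cx/= le_min xc andbT.
  by apply/seteqP; split => t /=; rewrite h.
rewrite (_ : [set t | _] = set0)//; apply/seteqP; split => // t /=.
move=> xt; have := norm_clip_le (Y t) c0; rewrite ler_norml => /andP[_ h].
by move: xt; rewrite leNgt (le_lt_trans h xc).
Qed.

Definition tail xi (t : R) : R := mean P (fun w => if t < xi w then xi w else 0).

Lemma measurable_tail xi t : measurable_fun setT xi ->
  measurable_fun setT (fun w => if t < xi w then xi w else 0).
Proof.
move=> mxi; apply: measurable_fun_ifT => //.
exact: measurable_fun_ltr.
Qed.

Lemma intg_tail xi t : intg P xi -> (forall w, 0 <= xi w) ->
  intg P (fun w => if t < xi w then xi w else 0).
Proof.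
move=> ixi xi0; apply: (intg_le _ _ ixi).
  exact: measurable_tail (intg_measurable ixi).
by move=> w; case: ifP => _; rewrite ?normr0// ger0_norm.
Qed.

(** Dominated convergence. It matters when [al = 0] and [s1 + s2 = 1]: the power of [t] in front of
    the tail in [cov_trunc] is then constant, and only the tail can make the bound vanish. *)
Lemma tail_cvg0 xi : intg P xi -> (forall w, 0 <= xi w) ->
  forall e, 0 < e -> exists2 t, 1 <= t & tail xi t <= e.
Proof.
move=> ixi xi0 e e0.
pose f_ (n : nat) (w : Omega) : \bar R :=
  (if n.+1%:R < xi w then xi w else 0)%:E.
have mf n : measurable_fun setT (f_ n).
  by apply/measurable_EFinP; exact: measurable_tail (intg_measurable ixi).
have cf (w : Omega) : setT w -> f_ ^~ w @ \oo --> (0 : \bar R)%E.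
  move=> _; apply: cvg_near_cst; near=> n; rewrite /f_ ifF//.
  apply/negbTE; rewrite -leNgt; apply: ltW.
  have /andP[_ h] := truncn_itv (xi0 w); apply: lt_le_trans h _.
  rewrite ler_nat ltnS; near: n; exact: nbhs_infty_ge.
have bf (n : nat) (w : Omega) : setT w -> (`|f_ n w| <= (EFin \o xi) w)%E.
  move=> _; rewrite /f_ /= lee_fin; case: ifP => _; rewrite ?normr0//.
  by rewrite ger0_norm.
have fg (w : Omega) : setT w -> (EFin \o xi) w \is a fin_num by [].
have := dominated_cvg measurableT mf cf fg ixi bf.
rewrite integral0 => h.
have {}h : (fun n => tail xi n.+1%:R) @ \oo --> (0 : R).
  move/fine_cvg : h; rewrite /= => h; apply: cvg_trans h.
  apply: near_eq_cvg; near=> n; rewrite /tail /mean unlock//.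
have : \forall n \near \oo, `|tail xi n.+1%:R| <= e.
  by move/cvgr0Pnorm_le : h => /(_ e e0).
case=> n _ /(_ n (leqnn n)) /= hn.
exists n.+1%:R; first by rewrite ler1n.
by rewrite (le_trans (ler_norm _)).
Unshelve. all: by end_near. Qed.

(** One variable [xi] dominates both factors, and [Y] is clipped at the level k1 t^s1, so that
    clipping changes nothing where [xi <= t]: every error lives on [xi > t] and is measured by the
    same tail. The 8 is 2 for the product plus 3 for each single mean, 3 being a bound on the mean
    of 1 + xi. *)
Lemma cov_trunc xi Y Z (k1 k2 s1 s2 t : R) :
  intg P xi -> (forall w, 0 <= xi w) -> mean P xi <= 2 ->
  measurable_fun setT Y -> measurable_fun setT Z ->
  (forall x, A [set t | x <= Y t]) -> (forall x, B [set t | x <= Z t]) ->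
  0 < k1 -> 0 < k2 -> 0 <= s1 -> 0 <= s2 -> s1 + s2 <= 1 -> 1 <= t ->
  (forall w, `|Y w| <= k1 * xi w `^ s1) ->
  (forall w, `|Z w| <= k2 * xi w `^ s2) ->
  `|cov P Y Z| <=
  k1 * k2 * (4 * al * t `^ (s1 + s2) + 8 * (t `^ (s1 + s2 - 1) * tail xi t)).
Proof.
move=> ixi xi0 xi2 mY mZ AY BZ k10 k20 s10 s20 s1s t1 Yk Zk.
have t0 : 0 < t by exact: lt_le_trans t1.
have s11 : s1 <= 1 by lra.
have s21 : s2 <= 1 by lra.
pose c1 := k1 * t `^ s1; pose c2 := k2 * t `^ s2.
have c10 : 0 < c1 by rewrite mulr_gt0// powR_gt0.
have c20 : 0 < c2 by rewrite mulr_gt0// powR_gt0.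
pose Yc w := clip c1 (Y w); pose Zc w := clip c2 (Z w).
have mYc : measurable_fun setT Yc by exact: measurable_clip.
have mZc : measurable_fun setT Zc by exact: measurable_clip.
have i1xi : intg P (fun w => 1 + xi w) by apply: intgD => //; exact: intg_cst.
have dom k s V : 0 < k -> 0 <= s -> s <= 1 ->
    (forall w, `|V w| <= k * xi w `^ s) -> forall w, `|V w| <= k * (1 + xi w).
  move=> k0 s0 s1' Vk w; rewrite (le_trans (Vk w))// ler_pM2l//.
  by rewrite powR_le1D// s0.
have intgV k s V : 0 < k -> 0 <= s -> s <= 1 -> measurable_fun setT V ->
    (forall w, `|V w| <= k * xi w `^ s) -> intg P V.
  move=> k0 s0 s1' mV Vk.
  exact: (intg_le mV (dom _ _ _ k0 s0 s1' Vk) (intgZ k i1xi)).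
have meanV k s V : 0 < k -> 0 <= s -> s <= 1 -> measurable_fun setT V ->
    (forall w, `|V w| <= k * xi w `^ s) -> `|mean P V| <= 3 * k.
  move=> k0 s0 s1' mV Vk.
  apply: le_trans (norm_mean_le (intgZ k i1xi) mV (dom _ _ _ k0 s0 s1' Vk)) _.
  rewrite meanZ// meanD//; last exact: intg_cst.
  rewrite mean_cst [leLHS]mulrC; apply: ler_wpM2r; [exact: ltW|lra].
have Yck w : `|Yc w| <= k1 * xi w `^ s1.
  by rewrite (le_trans _ (Yk w))// norm_clip_le_norm// ltW.
have Zck w : `|Zc w| <= k2 * xi w `^ s2.
  by rewrite (le_trans _ (Zk w))// norm_clip_le_norm// ltW.
have mulk V W : (forall w, `|V w| <= k1 * xi w `^ s1) ->
    (forall w, `|W w| <= k2 * xi w `^ s2) ->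
    forall w, `|V w * W w| <= (k1 * k2) * xi w `^ (s1 + s2).
  move=> Vk Wk w; rewrite normrM.
  apply: le_trans (_ : (k1 * xi w `^ s1) * (k2 * xi w `^ s2) <= _).
    exact: ler_pM.
  have [s120|s12] := eqVneq (s1 + s2) 0.
    have [-> ->] : s1 = 0 /\ s2 = 0 by lra.
    by rewrite addr0 !powRr0 !mulr1.
  by rewrite powRD ?(negbTE s12)// mulrACA.
have iY := intgV _ _ _ k10 s10 s11 mY Yk.
have iZ := intgV _ _ _ k20 s20 s21 mZ Zk.
have iYc := intgV _ _ _ k10 s10 s11 mYc Yck.
have iZc := intgV _ _ _ k20 s20 s21 mZc Zck.
have k12 : 0 < k1 * k2 by rewrite mulr_gt0.
have s12 : 0 <= s1 + s2 by lra.
have mYZ := measurable_funM mY mZ.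
have mYcZc := measurable_funM mYc mZc.
have iYZ := intgV _ _ _ k12 s12 s1s mYZ (mulk _ _ Yk Zk).
have iYcZc := intgV _ _ _ k12 s12 s1s mYcZc (mulk _ _ Yck Zck).
pose T w := if t < xi w then xi w else 0.
have iT : intg P T by exact: intg_tail.
have T0 w : 0 <= T w by rewrite /T; case: ifP.
set th := t `^ (s1 + s2 - 1).
have th0 : 0 <= th by exact: powR_ge0.
(* Two monotonicities: xi^(s-1) <= t^(s-1) because s <= 1, and t^(s-1) <= t^(s1+s2-1) because t >=
   1. *)
have big s w : 0 <= s -> s <= s1 + s2 -> t < xi w -> xi w `^ s <= th * xi w.
  move=> s0 ss tw; have xw : 0 < xi w by exact: lt_trans tw.
  have -> : xi w `^ s = xi w `^ (s - 1) * xi w.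
    rewrite -[X in _ * X](powRr1 (ltW xw)) -powRD ?subrK//.
    by rewrite (gt_eqF xw) implybT.
  rewrite ler_pM2r//.
  apply: le_trans (_ : t `^ (s - 1) <= _); last by rewrite /th ler_powR// lerB.
  rewrite -(opprB 1 s) !powRN lef_pV2 ?posrE ?powR_gt0//.
  apply: ge0_ler_powR; rewrite ?nnegrE ?(ltW t0) ?(ltW xw) ?(ltW tw)//; lra.
have small c k s V w : 0 < k -> 0 <= s -> c = k * t `^ s ->
    `|V w| <= k * xi w `^ s -> xi w <= t -> clip c (V w) = V w.
  move=> k0 s0 -> Vk xt; apply: clip_id; rewrite (le_trans Vk)// ler_pM2l//.
  by apply: ge0_ler_powR; rewrite ?nnegrE// ltW.
have dif k s V c : 0 < k -> 0 <= s -> s <= s1 + s2 -> c = k * t `^ s ->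
    measurable_fun setT V -> intg P V ->
    intg P (fun w => clip c (V w)) ->
    (forall w, `|V w| <= k * xi w `^ s) ->
    `|mean P V - mean P (fun w => clip c (V w))| <= k * th * tail xi t.
  move=> k0 s0 ss cE mV iV iVc Vk.
  rewrite -meanB// /tail -(meanZ (k * th) iT).
  apply: norm_mean_le; first exact: intgZ.
    by apply: measurable_funB => //; exact: intg_measurable iVc.
  move=> w; rewrite /T; case: ifPn => [tw|]; last first.
    by rewrite -leNgt => wt; rewrite (small _ _ _ _ _ k0 s0 cE (Vk w) wt) subrr normr0 mulr0.
  have c0 : 0 <= c by rewrite cE mulr_ge0 ?powR_ge0// ltW.
  rewrite (le_trans (sub_clip_le _ c0))// (le_trans (Vk w))//.
  by rewrite -mulrA ler_pM2l// big.
have e1 : `|mean P (fun w => Y w * Z w) - mean P (fun w => Yc w * Zc w)| <=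
    k1 * k2 * (2 * th) * tail xi t.
  rewrite -meanB// /tail -(meanZ _ iT).
  apply: norm_mean_le; first exact: intgZ.
    exact: measurable_funB.
  move=> w; rewrite /T; case: ifPn => [tw|]; last first.
    rewrite -leNgt => wt; rewrite /Yc /Zc.
    rewrite (small _ _ _ _ _ k10 s10 erefl (Yk w) wt).
    by rewrite (small _ _ _ _ _ k20 s20 erefl (Zk w) wt) subrr normr0 mulr0.
  apply: le_trans (ler_normB _ _) _.
  rewrite (_ : _ * xi w = k1 * k2 * (th * xi w) + k1 * k2 * (th * xi w)); last by ring.
  apply: lerD; [apply: le_trans (mulk _ _ Yk Zk w) _|apply: le_trans (mulk _ _ Yck Zck w) _];
    by rewrite ler_pM2l// big.
have e2 : `|cov P Yc Zc| <= k1 * k2 * (4 * al * t `^ (s1 + s2)).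
  rewrite (_ : _ * (_ * _) = 4 * al * c1 * c2); last first.
    rewrite /c1 /c2 powRD; first by ring.
    by rewrite (gt_eqF t0) implybT.
  apply: (cov_bounded mA mB al_bound c10 c20 mYc mZc).
  - by move=> w; apply: norm_clip_le; exact: ltW.
  - by move=> w; apply: norm_clip_le; exact: ltW.
  - by apply: clip_levels => //; exact: ltW.
  - by apply: clip_levels => //; exact: ltW.
have tl0 : 0 <= tail xi t by apply: mean_ge0.
have d1 : `|mean P Y - mean P Yc| <= k1 * th * tail xi t.
  by apply: (dif k1 s1) => //; lra.
have d2 : `|mean P Z - mean P Zc| <= k2 * th * tail xi t.
  by apply: (dif k2 s2) => //; lra.
have m1 := meanV _ _ _ k10 s10 s11 mYc Yck.
have m2 := meanV _ _ _ k20 s20 s21 mZ Zk.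
have -> : cov P Y Z = cov P Yc Zc +
    ((mean P (fun w => Y w * Z w) - mean P (fun w => Yc w * Zc w)) -
    ((mean P Y - mean P Yc) * mean P Z + mean P Yc * (mean P Z - mean P Zc))).
  by rewrite /cov; ring.
rewrite [leRHS]mulrDr; apply: le_trans (ler_normD _ _) _; apply: lerD => //.
apply: le_trans (ler_normB _ _) _.
rewrite (_ : k1 * k2 * (8 * _) = k1 * k2 * (2 * th) * tail xi t +
  ((k1 * th * tail xi t) * (3 * k2) + (3 * k1) * (k2 * th * tail xi t))); last by ring.
apply: lerD => //; apply: le_trans (ler_normD _ _) _; rewrite !normrM.
by apply: lerD; exact: ler_pM.
Qed.

(** The level t = 1 / al balances the two terms of [cov_trunc]: both become multiples of
    al^(1-s1-s2), with total constant 4 + 8 * 2 = 20, the tail being at most the mean of [xi]. *)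
Lemma cov_mixing xi Y Z (k1 k2 s1 s2 : R) :
  0 <= al <= 1 ->
  intg P xi -> (forall w, 0 <= xi w) -> mean P xi <= 2 ->
  measurable_fun setT Y -> measurable_fun setT Z ->
  (forall x, A [set t | x <= Y t]) -> (forall x, B [set t | x <= Z t]) ->
  0 <= k1 -> 0 <= k2 -> 0 <= s1 -> 0 <= s2 -> s1 + s2 <= 1 ->
  (forall w, `|Y w| <= k1 * xi w `^ s1) ->
  (forall w, `|Z w| <= k2 * xi w `^ s2) ->
  `|cov P Y Z| <= 20 * (k1 * k2) * rho al (1 - (s1 + s2)).
Proof.
move=> /andP[al0 al1] ixi xi0 xi2 mY mZ AY BZ k10 k20 s10 s20 s1s Yk Zk.
have := k10; rewrite le_eqVlt => /orP[/eqP k1E|{}k10].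
  have Y0 w : Y w = 0 by apply/eqP; rewrite -normr_le0 (le_trans (Yk w))// -k1E mul0r.
  rewrite /cov (eq_mean P (Z := fun=> 0)) => [|w]; last by rewrite Y0 mul0r.
  rewrite (eq_mean P (Y := Y) (Z := fun=> 0))// mean_cst mul0r subr0 normr0.
  by rewrite -k1E mul0r mulr0 mul0r.
have := k20; rewrite le_eqVlt => /orP[/eqP k2E|{}k20].
  have Z0 w : Z w = 0 by apply/eqP; rewrite -normr_le0 (le_trans (Zk w))// -k2E mul0r.
  rewrite /cov (eq_mean P (Z := fun=> 0)) => [|w]; last by rewrite Z0 mulr0.
  rewrite (eq_mean P (Y := Z) (Z := fun=> 0))// mean_cst mulr0 subr0 normr0.
  by rewrite -k2E !mulr0 mul0r.
have k12 : 0 < k1 * k2 by rewrite mulr_gt0.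
have H t : 1 <= t -> _ := fun t1 => cov_trunc ixi xi0 xi2 mY mZ AY BZ k10 k20
  s10 s20 s1s t1 Yk Zk.
(* For [al = 0] there is no finite balancing level; [t] is taken so large that the tail is as small
   as wished. *)
rewrite /rho; case: ifPn => [/eqP alE|aln0].
  rewrite mulr0; apply/ler_addgt0Pr => e e0; rewrite add0r.
  have d0 : 0 < e / (k1 * k2 * 8) by rewrite divr_gt0// mulr_gt0.
  have [t t1 tt] := tail_cvg0 ixi xi0 d0.
  apply: le_trans (H t t1) _; rewrite alE mulr0 mul0r add0r mulrA.
  apply: le_trans (_ : k1 * k2 * 8 * (e / (k1 * k2 * 8)) <= _); last first.
    by rewrite mulrC divfK// gt_eqF// mulr_gt0.
  rewrite ler_pM2l ?mulr_gt0//; apply: le_trans tt.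
  rewrite ler_piMl//; first by apply: mean_ge0 => w; case: ifP.
  rewrite -[leRHS](powRr0 t); apply: ler_powR => //; lra.
have al00 : 0 < al by rewrite lt0r aln0.
have t1 : 1 <= al^-1 by rewrite invf_ge1.
apply: le_trans (H _ t1) _.
rewrite [20 * _]mulrC -[leRHS]mulrA ler_pM2l//.
have E : al^-1 `^ (s1 + s2 - 1) = al `^ (1 - (s1 + s2)).
  by rewrite -powR_inv1// -powRrM mulN1r opprB.
have H1 : al * al^-1 `^ (s1 + s2) = al `^ (1 - (s1 + s2)).
  rewrite -E powRB; last by rewrite invr_eq0 aln0 implybT.
  by rewrite powRr1 ?invr_ge0// invrK mulrC.
have tl : tail xi al^-1 <= 2.
  apply: le_trans xi2; apply: le_mean => //; first exact: intg_tail.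
  by move=> w; case: ifP.
have q0 : 0 <= al `^ (1 - (s1 + s2)) by exact: powR_ge0.
rewrite E -(mulrA 4) H1.
apply: le_trans (_ : 4 * al `^ (1 - (s1 + s2)) +
  8 * (al `^ (1 - (s1 + s2)) * 2) <= _); last by lra.
by rewrite lerD2l ler_pM2l// ler_wpM2l.
Qed.

End mixing_covariance.

(** * Functions of the field and their size *)

Section power_mean.
Context {R : realType}.

(** Young's inequality for the product of [x] and 1 with conjugate exponents [r] and [q], multiplied
    by [r]. *)
Lemma powR_bernoulli (x r : R) : 0 <= x -> 1 <= r -> 1 + r * (x - 1) <= x `^ r.
Proof.
move=> x0; rewrite le_eqVlt => /orP[/eqP <-|r1].
  by rewrite powRr1//; lra.
have r0 : 0 < r by lra.
have rn0 : r != 0 by rewrite gt_eqF.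
pose q := (1 - r^-1)^-1.
have q0 : 0 < 1 - r^-1 by rewrite subr_gt0 invf_lt1.
have := @conjugate_powR _ x 1 r q x0 ler01 r0.
have E : r^-1 + (1 - r^-1) = 1 by ring.
rewrite invr_gt0 invrK q0 => /(_ isT E); rewrite powR1 mulr1 mul1r.
rewrite -(@ler_pM2l _ r)// mulrDr mulrBr mulr1 mulfV// mulrCA mulfV// mulr1.
lra.
Qed.

(** Jensen's inequality: [powR_bernoulli] is applied to each y_i / a, with a the mean, and the
    linear terms cancel on summation. *)
Lemma power_mean (I : finType) (J : {set I}) (y : I -> R) (r : R) :
  1 <= r -> (forall i, 0 <= y i) -> (0 < #|J|)%N ->
  ((\sum_(i in J) y i) / #|J|%:R) `^ r <= (\sum_(i in J) y i `^ r) / #|J|%:R.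
Proof.
move=> r1 y0 J0; set n : R := #|J|%:R; have n0 : 0 < n by rewrite ltr0n.
set a := _ / n; have a0 : 0 <= a by rewrite divr_ge0 ?sumr_ge0 ?(ltW n0).
have [aE|an0] := eqVneq a 0.
  rewrite aE powR0 ?gt_eqF ?(lt_le_trans _ r1)//.
  by rewrite divr_ge0 ?(ltW n0)// sumr_ge0// => i _; exact: powR_ge0.
have ag0 : 0 < a by rewrite lt0r an0.
rewrite ler_pdivlMr//.
have : n <= \sum_(i in J) (y i / a) `^ r.
  apply: (@le_trans _ _ (\sum_(i in J) (1 + r * (y i / a - 1)))); last first.
    by apply: ler_sum => i _; apply: powR_bernoulli => //; rewrite divr_ge0.
  rewrite big_split/= sumr_const -mulr_sumr sumrB sumr_const -mulr_suml.
  rewrite -/n (_ : \sum_(i in J) y i = a * n); last by rewrite /a divfK ?gt_eqF.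
  by rewrite mulrAC mulfV// mul1r subrr mulr0 addr0.
rewrite -(@ler_pM2l _ (a `^ r)) ?powR_gt0// mulr_sumr.
congr (_ <= _); apply: eq_bigr => i _.
by rewrite -powRM//; [rewrite mulrC divfK|exact: divr_ge0].
Qed.

End power_mean.

Section field.
Context {disp : measure_display} {Omega : measurableType disp} {R : realType}.
Variable P : probability Omega R.
Context {d : nat} {D : {fset 'rV[int]_d}}.
Variable X : D -> {RV P >-> R}.
Implicit Types (J : {set D}) (Z V : Omega -> R) (A B : seq D).

(** Stated through preimages, so that the sigma-algebras of different [J] are compared on one and
    the same [Omega]; [measP] is the bridge to measurable functions. *)
Definition meas J Z : Prop :=
  forall E : set R, measurable E -> sigma_of X J (Z @^-1` E).

Local Notation sub J := (g_sigma_algebraType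
  (\bigcup_(i in [set` J]) preimage_set_system setT (X i) measurable)).

Lemma measP J Z : meas J Z <-> measurable_fun setT (Z : sub J -> R).
Proof.
split=> [mZ _ E mE|mZ E mE]; first by rewrite setTI; exact: mZ.
by have := mZ measurableT E mE; rewrite setTI.
Qed.

Lemma sigma_of_sub J J' : J \subset J' -> sigma_of X J `<=` sigma_of X J'.
Proof.
move=> JJ'; apply: sub_sigma_algebra2; apply: bigcup_subset => i /=.
exact: (fintype.subsetP JJ').
Qed.

Lemma sigma_of_measurable J E : sigma_of X J E -> measurable E.
Proof.
suff h : sigma_of X J `<=` measurable by exact: h.
apply: smallest_sub; first exact: sigma_algebra_measurable.
move=> F [i _ [G mG <-]]; exact: measurable_funP.
Qed.

Lemma sigma_of0 J : sigma_of X J set0.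
Proof. exact: (@measurable0 _ (sub J)). Qed.

Lemma sigma_ofT J : sigma_of X J setT.
Proof. exact: (@measurableT _ (sub J)). Qed.

Lemma meas_sub J J' Z : J \subset J' -> meas J Z -> meas J' Z.
Proof. by move=> JJ' mZ E mE; apply: sigma_of_sub JJ' _ _; exact: mZ. Qed.

Lemma meas_measurable J Z : meas J Z -> measurable_fun setT Z.
Proof.
by move=> mZ _ E mE; rewrite setTI; exact: sigma_of_measurable (mZ E mE).
Qed.

Lemma meas_levels J Z x : meas J Z -> sigma_of X J [set t | x <= Z t].
Proof.
move=> mZ; have := mZ `[x, +oo[%classic (measurable_itv _).
by congr (sigma_of _ _ _); apply/seteqP; split => t /=; rewrite in_itv/= andbT.
Qed.

Lemma meas_X J i : i \in J -> meas J (X i).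
Proof.
by move=> iJ E mE; apply: sub_sigma_algebra; exists i => //; exists E; rewrite ?setTI.
Qed.

Lemma meas_cst J c : meas J (fun=> c).
Proof. by apply/measP; exact: measurable_cst. Qed.

Lemma meas_comp J (g : R -> R) Z : measurable_fun setT g -> meas J Z ->
  meas J (fun t => g (Z t)).
Proof. by move=> mg /measP mZ; apply/measP; exact: measurableT_comp. Qed.

Lemma measD J Z V : meas J Z -> meas J V -> meas J (fun t => Z t + V t).
Proof. by move=> /measP mZ /measP mV; apply/measP; exact: measurable_funD. Qed.

Lemma measM J Z V : meas J Z -> meas J V -> meas J (fun t => Z t * V t).
Proof. by move=> /measP mZ /measP mV; apply/measP; exact: measurable_funM. Qed.

Lemma meas_sum J (I : Type) (s : seq I) (Q : pred I) (F : I -> Omega -> R) :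
  (forall i, Q i -> meas J (F i)) -> meas J (fun t => \sum_(i <- s | Q i) F i t).
Proof.
move=> mF; elim: s => [|i s ih].
  rewrite (_ : (fun t => _) = fun=> 0); first exact: meas_cst.
  by apply/funext => t; rewrite big_nil.
have [Qi|nQi] := boolP (Q i).
  rewrite (_ : (fun t => _) = fun t => F i t + \sum_(i <- s | Q i) F i t).
    by apply: measD => //; exact: mF.
  by apply/funext => t; rewrite big_cons Qi.
rewrite (_ : (fun t => _) = fun t => \sum_(i <- s | Q i) F i t)//.
by apply/funext => t; rewrite big_cons (negbTE nQi).
Qed.

Variables (c r : R).
Hypothesis r1 : 1 <= r.

(** [c] will be the inverse of a common bound on the norms, which brings all moments of order [r]
    below 1. *)
Definition cX (i : D) (t : Omega) : R := c * X i t.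

Hypothesis cX_intg : forall i, intg P (fun t => `|cX i t| `^ r).
Hypothesis cX_mean : forall i, mean P (fun t => `|cX i t| `^ r) <= 1.

Lemma meas_cX J i : i \in J -> meas J (cX i).
Proof. by move=> iJ; apply: measM; [exact: meas_cst|exact: meas_X]. Qed.

(* [of_degree J e kappa Z]: Z is a function of the field on J of size at most
   kappa in the norm of exponent r / e (the supremum norm when e = 0); the
   witness zeta stands for (|Z| / kappa)^(r / e). *)
Definition of_degree J (e kappa : R) Z : Prop :=
  [/\ meas J Z, 0 <= kappa & exists zeta : Omega -> R,
    [/\ intg P zeta, forall t, 0 <= zeta t, mean P zeta <= 1 &
        forall t, `|Z t| <= kappa * zeta t `^ (e / r)]].

Let r0 : 0 < r. Proof. exact: lt_le_trans r1. Qed.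
Let rn0 : r != 0. Proof. by rewrite gt_eqF. Qed.

Lemma of_degree_sub J J' e k Z : J \subset J' ->
  of_degree J e k Z -> of_degree J' e k Z.
Proof. by move=> JJ' [mZ k0 h]; split => //; exact: meas_sub mZ. Qed.

Lemma of_degree_ge0 J e k Z : of_degree J e k Z -> 0 <= k.
Proof. by case. Qed.

Lemma of_degree_meas J e k Z : of_degree J e k Z -> meas J Z.
Proof. by case. Qed.

Lemma of_degree_mean J e k Z : 0 <= e <= r -> of_degree J e k Z ->
  intg P Z /\ `|mean P Z| <= 2 * k.
Proof.
move=> /andP[e0 er] [mZ k0 [z [iz z0 z1 Zk]]].
have i1 : intg P (fun w => 1 + z w) by apply: intgD => //; exact: intg_cst.
have Zd t : `|Z t| <= k * (1 + z t).
  apply: le_trans (Zk t) _; rewrite ler_wpM2l// powR_le1D//.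
  by rewrite divr_ge0 ?(ltW r0)//= ler_pdivrMr// mul1r.
split; first exact: intg_le (meas_measurable mZ) Zd (intgZ k i1).
apply: le_trans (norm_mean_le (intgZ k i1) (meas_measurable mZ) Zd) _.
rewrite meanZ// meanD ?mean_cst//; last exact: intg_cst.
by rewrite mulrC ler_wpM2r//; lra.
Qed.

Lemma mean_half V W : intg P V -> intg P W -> mean P V <= 1 -> mean P W <= 1 ->
  intg P (fun t => 2^-1 * (V t + W t)) /\ mean P (fun t => 2^-1 * (V t + W t)) <= 1.
Proof.
move=> iV iW V1 W1; have iVW := intgD iV iW; split; first exact: intgZ.
by rewrite meanZ// meanD//; lra.
Qed.

Let two_powR s : s <= 1 -> 2 `^ s <= 2 :> R.
Proof. by move=> s1; rewrite -[leRHS]powRr1// ler_powR// ler1n. Qed.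

Let le_half (x y s : R) : 0 <= x -> 0 <= y -> 0 <= s ->
  x `^ s <= 2 `^ s * (2^-1 * (x + y)) `^ s.
Proof.
move=> x0 y0 s0; have h : 0 <= 2^-1 * (x + y) by rewrite mulr_ge0 ?addr_ge0.
rewrite -powRM//; apply: ge0_ler_powR => //; rewrite ?nnegrE//.
  by rewrite mulr_ge0.
by rewrite mulrA mulfV// mul1r lerDl.
Qed.

(** The substitute for Hoelder's inequality. Both witnesses are at most twice their average [h], so
    the product is dominated by a power of [h] in which the exponents add up; the factor 2^((1+e)/r)
    is at most 2 since [1 + e <= r]. *)
Lemma of_degreeM J e k Z i : i \in J -> 0 <= e -> 1 + e <= r ->
  of_degree J e k Z -> of_degree J (1 + e) (2 * k) (fun t => cX i t * Z t).
Proof.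
move=> iJ e0 er [mZ k0 [z [iz z0 z1 Zk]]].
have [ih h1] := mean_half (cX_intg i) iz (cX_mean i) z1.
split; [by apply: measM => //; exact: meas_cX|by rewrite mulr_ge0|].
exists (fun t => 2^-1 * (`|cX i t| `^ r + z t)); split => // t.
  by rewrite mulr_ge0// addr_ge0// powR_ge0.
have s0 : 0 <= e / r by rewrite divr_ge0// ltW.
have ri0 : 0 <= r^-1 by rewrite invr_ge0 ltW.
have s1 : (1 + e) / r <= 1 by rewrite ler_pdivrMr// mul1r.
set h := 2^-1 * _; have h0 : 0 <= h by rewrite mulr_ge0// addr_ge0// powR_ge0.
have hY : `|cX i t| <= 2 `^ r^-1 * h `^ r^-1.
  rewrite (_ : `|cX i t| = (`|cX i t| `^ r) `^ r^-1); last first.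
    by rewrite -powRrM mulfV// powRr1.
  by apply: le_half => //; exact: powR_ge0.
have hz : z t `^ (e / r) <= 2 `^ (e / r) * h `^ (e / r).
  by rewrite /h (addrC (_ `^ r)); apply: le_half => //; exact: powR_ge0.
rewrite normrM; apply: le_trans (_ : (2 `^ r^-1 * h `^ r^-1) *
    (k * (2 `^ (e / r) * h `^ (e / r))) <= _).
  by rewrite ler_pM// (le_trans (Zk t))// ler_wpM2l.
have E x : 0 <= x -> x `^ ((1 + e) / r) = x `^ r^-1 * x `^ (e / r).
  move=> x0; rewrite mulrDl mul1r powRD//; apply/implyP => /eqP h1'.
  exfalso; have : 0 < r^-1 + e / r by rewrite ltr_pwDl ?invr_gt0.
  by rewrite h1' ltxx.
rewrite (_ : _ * _ = (2 `^ r^-1 * 2 `^ (e / r)) * k * (h `^ r^-1 * h `^ (e / r))); last by ring.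
rewrite -!E// ler_wpM2r ?powR_ge0// ler_wpM2r//; exact: two_powR.
Qed.

Definition prod_cX A (t : Omega) : R := \prod_(i <- A) cX i t.

Lemma prod_cX_cons i A t : prod_cX (i :: A) t = cX i t * prod_cX A t.
Proof. by rewrite /prod_cX big_cons. Qed.

Lemma prod_cX_nil t : prod_cX [::] t = 1.
Proof. by rewrite /prod_cX big_nil. Qed.

Lemma prod_cX_cat A B t : prod_cX (A ++ B) t = prod_cX A t * prod_cX B t.
Proof. by rewrite /prod_cX big_cat. Qed.

Lemma eq_of_degree J e k Z V : (forall t, V t = Z t) ->
  of_degree J e k Z -> of_degree J e k V.
Proof. by move=> VZ; rewrite (_ : V = Z)//; exact/funext. Qed.

Lemma of_degree_prod_cX J e k Z A : {subset A <= J} -> 0 <= e ->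
  (size A)%:R + e <= r -> of_degree J e k Z ->
  of_degree J ((size A)%:R + e) (2 ^+ size A * k) (fun t => prod_cX A t * Z t).
Proof.
move=> AJ e0 + dZ; elim: A AJ => [|i A ih] AJ Ar /=.
  by rewrite add0r mul1r; apply: eq_of_degree dZ => t; rewrite prod_cX_nil mul1r.
have sA : (size A)%:R + e <= r.
  by rewrite (le_trans _ Ar)// lerD2r ler_nat.
rewrite exprS -mulrA -natr1 -addrA addrCA.
apply: (@eq_of_degree _ _ _ (fun t => cX i t * (prod_cX A t * Z t))).
  by move=> t; rewrite prod_cX_cons mulrA.
apply: of_degreeM.
- by apply: AJ; rewrite mem_head.
- by rewrite addr_ge0.
- by rewrite addrCA addrA natr1.
- by apply: ih => // j jA; apply: AJ; rewrite in_cons jA orbT.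
Qed.

Lemma of_degree_cst J x : of_degree J 0 `|x| (fun=> x).
Proof.
split=> //; first exact: meas_cst.
exists (fun=> 1); split => //; first exact: intg_cst.
  by rewrite mean_cst.
by move=> t; rewrite powR1 mulr1.
Qed.

(** The witness is the average over [I] of the powers of order [r], which by convexity dominates the
    power [r] of the average. A sum over [I] thus costs its cardinality, whatever the dependence
    between its terms. *)
Lemma of_degree_pow (J I : {set D}) e k Z : 0 < e -> I \subset J -> meas J Z -> 0 <= k ->
  (forall t, `|Z t| <= k * `|\sum_(i in I) cX i t| `^ e) ->
  of_degree J e (k * #|I|%:R `^ e) Z.
Proof.
move=> e0 IJ mZ k0 Zk; split => //; first by rewrite mulr_ge0// powR_ge0.
have [I0|I0] := posnP #|I|.
  exists (fun=> 1); split => //; [exact: intg_cst|by rewrite mean_cst|move=> t].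
  rewrite I0 powR0 ?gt_eqF// mulr0 mul0r (le_trans (Zk t))//.
  by rewrite (cards0_eq I0) big_set0 normr0 powR0 ?gt_eqF// mulr0.
have n0 : 0 < #|I|%:R :> R by rewrite ltr0n.
have ni0 : 0 <= #|I|%:R^-1 :> R by rewrite invr_ge0 ltW.
pose z t : R := #|I|%:R^-1 * \sum_(i in I) `|cX i t| `^ r.
have iz : intg P (fun t => \sum_(i in I) `|cX i t| `^ r) by exact: intg_sum.
exists z; split.
- exact: intgZ.
- by move=> t; rewrite mulr_ge0// sumr_ge0// => i _; exact: powR_ge0.
- rewrite /z meanZ// mean_sum// ler_pdivrMl// mulr1.
  by rewrite -sum1_card natr_sum; apply: ler_sum => i _; exact: cX_mean.
- move=> t; apply: le_trans (Zk t) _; rewrite -mulrA ler_wpM2l//.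
  set s := \sum_(i in I) `|cX i t|.
  have s0 : 0 <= s by exact: sumr_ge0.
  apply: le_trans (_ : s `^ e <= _).
    apply: ge0_ler_powR; rewrite ?nnegrE ?(ltW e0)//.
    exact: ler_norm_sum.
  have sE : s = #|I|%:R * (s / #|I|%:R) by rewrite mulrC divfK// gt_eqF.
  have sn0 : 0 <= s / #|I|%:R by rewrite mulr_ge0.
  rewrite sE powRM//.
  rewrite ler_wpM2l ?powR_ge0//.
  rewrite (_ : (s / _) `^ e = ((s / #|I|%:R) `^ r) `^ (e / r)); last first.
    by rewrite -powRrM [r * _]mulrC (divfK rn0).
  apply: ge0_ler_powR; rewrite ?nnegrE ?powR_ge0//.
  - by rewrite divr_ge0 ?(ltW e0) ?(ltW r0).
  - by rewrite /z mulr_ge0// sumr_ge0// => i _; exact: powR_ge0.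
  - have := power_mean r1 (fun i : D => normr_ge0 (cX i t)) I0.
    by rewrite [X in _ <= X]mulrC.
Qed.

Lemma of_degreeD J e k1 k2 Z V : 0 <= e <= r ->
  of_degree J e k1 Z -> of_degree J e k2 V ->
  of_degree J e (2 * (k1 + k2)) (fun t => Z t + V t).
Proof.
move=> /andP[e0 er] [mZ k10 [z1 [i1 z10 m1 Z1]]] [mV k20 [z2 [i2 z20 m2 V2]]].
have [ih h1] := mean_half i1 i2 m1 m2.
split; [exact: measD|by rewrite mulr_ge0// addr_ge0|].
exists (fun t => 2^-1 * (z1 t + z2 t)); split => // t.
  by rewrite mulr_ge0// addr_ge0.
have s0 : 0 <= e / r by rewrite divr_ge0// ltW.
have s1 : e / r <= 1 by rewrite ler_pdivrMr// mul1r.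
set h := 2^-1 * _.
have a1 : z1 t `^ (e / r) <= 2 * h `^ (e / r).
  apply: le_trans (le_half (z10 t) (z20 t) s0) _.
  by rewrite ler_wpM2r ?powR_ge0//; exact: two_powR.
have a2 : z2 t `^ (e / r) <= 2 * h `^ (e / r).
  rewrite /h (addrC (z1 t)); apply: le_trans (le_half (z20 t) (z10 t) s0) _.
  by rewrite ler_wpM2r ?powR_ge0//; exact: two_powR.
apply: le_trans (ler_normD _ _) _.
rewrite (_ : _ * h `^ _ = k1 * (2 * h `^ (e / r)) + k2 * (2 * h `^ (e / r))); last by ring.
apply: lerD; first by rewrite (le_trans (Z1 t))// ler_wpM2l.
by rewrite (le_trans (V2 t))// ler_wpM2l.
Qed.

Lemma of_degreeZ J e k x Z : of_degree J e k Z ->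
  of_degree J e (`|x| * k) (fun t => x * Z t).
Proof.
move=> [mZ k0 [z [iz z0 z1 Zk]]]; split; last exists z.
- by apply: measM => //; exact: meas_cst.
- by rewrite mulr_ge0.
- by split => // t; rewrite normrM -mulrA ler_wpM2l.
Qed.

(** Averaging the witness with the constant 1 gives an [h] with 2h >= 1, and for such a base a
    larger exponent gives a larger power. *)
Lemma of_degree_raise J e e' k Z : 0 <= e -> e <= e' -> e' <= r ->
  of_degree J e k Z -> of_degree J e' (2 * k) Z.
Proof.
move=> e0 ee' er [mZ k0 [z [iz z0 z1 Zk]]]; split => //; first exact: mulr_ge0.
have [ih h1] := mean_half (intg_cst P 1) iz (eq_ind_r (fun x => x <= 1) (lexx 1) (mean_cst P 1)) z1.
exists (fun t => 2^-1 * (1 + z t)); split => // t.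
  by rewrite mulr_ge0// addr_ge0.
have s1 : e' / r <= 1 by rewrite ler_pdivrMr// mul1r.
have s0 : 0 <= e' / r by rewrite divr_ge0 ?(ltW r0)// (le_trans e0).
have es : 0 <= e / r by rewrite divr_ge0// ltW.
have ss : e / r <= e' / r by rewrite ler_pM2r ?invr_gt0.
apply: le_trans (Zk t) _; rewrite (mulrC 2) -mulrA ler_wpM2l//.
set h := 2^-1 * _; have h0 : 0 <= h by rewrite mulr_ge0// addr_ge0.
have E : 2 * h = 1 + z t by rewrite /h mulrA mulfV// mul1r.
apply: le_trans (_ : (2 * h) `^ (e / r) <= _).
  by rewrite E; apply: ge0_ler_powR; rewrite ?nnegrE ?addr_ge0 ?lerDr.
apply: le_trans (_ : (2 * h) `^ (e' / r) <= _).
  by apply: ler_powR => //; rewrite E lerDl.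
by rewrite powRM// ler_wpM2r ?powR_ge0//; exact: two_powR.
Qed.

(** Forgetting the size leaves what integrability and linearity arguments use. *)
Definition admissible J e Z : Prop := exists k, of_degree J e k Z.

Lemma admissible_sub J J' e Z : J \subset J' -> admissible J e Z -> admissible J' e Z.
Proof. by move=> JJ' [k dZ]; exists k; exact: of_degree_sub dZ. Qed.

Lemma admissible_raise J e e' Z : 0 <= e -> e <= e' -> e' <= r ->
  admissible J e Z -> admissible J e' Z.
Proof. by move=> e0 ee' er [k dZ]; exists (2 * k); exact: of_degree_raise dZ. Qed.

Lemma admissible_cst J e x : 0 <= e <= r -> admissible J e (fun=> x).
Proof.
move=> /andP[e0 er]; exists (2 * `|x|).
by apply: of_degree_raise (of_degree_cst J x).
Qed.

Lemma admissibleD J e Z V : 0 <= e <= r -> admissible J e Z -> admissible J e V ->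
  admissible J e (fun t => Z t + V t).
Proof. by move=> er [k1 d1] [k2 d2]; eexists; exact: of_degreeD d1 d2. Qed.

Lemma admissibleZ J e x Z : admissible J e Z -> admissible J e (fun t => x * Z t).
Proof. by move=> [k dZ]; eexists; exact: of_degreeZ dZ. Qed.

Lemma eq_admissible J e Z V : (forall t, V t = Z t) ->
  admissible J e Z -> admissible J e V.
Proof. by move=> VZ [k dZ]; exists k; exact: eq_of_degree dZ. Qed.

Lemma admissibleB J e Z V : 0 <= e <= r -> admissible J e Z -> admissible J e V ->
  admissible J e (fun t => Z t - V t).
Proof.
move=> er aZ aV; apply: eq_admissible (admissibleD er aZ (admissibleZ (-1) aV)) => t.
by rewrite mulN1r.
Qed.

Lemma admissible_sum J e (I : Type) (s : seq I) (Q : pred I) (F : I -> Omega -> R) :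
  0 <= e <= r -> (forall i, Q i -> admissible J e (F i)) ->
  admissible J e (fun t => \sum_(i <- s | Q i) F i t).
Proof.
move=> er aF; elim: s => [|i s ih].
  by apply: eq_admissible (admissible_cst J 0 er) => t; rewrite big_nil.
have [Qi|nQi] := boolP (Q i).
  by apply: eq_admissible (admissibleD er (aF _ Qi) ih) => t; rewrite big_cons Qi.
by apply: eq_admissible ih => t; rewrite big_cons (negbTE nQi).
Qed.

Lemma admissible_intg J e Z : 0 <= e <= r -> admissible J e Z -> intg P Z.
Proof. by move=> er [k dZ]; case: (of_degree_mean er dZ). Qed.

Lemma admissibleM J e Z A : {subset A <= J} -> 0 <= e -> (size A)%:R + e <= r ->
  admissible J e Z -> admissible J ((size A)%:R + e) (fun t => prod_cX A t * Z t).
Proof. by move=> AJ e0 er [k dZ]; eexists; exact: of_degree_prod_cX dZ. Qed.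

Lemma alpha_set_ub (U V : {set D}) : ubound [set `|fine (P (a `&` b)) - fine (P a) * fine (P b)|
      | a in sigma_of X U & b in sigma_of X V] 1.
Proof.
have p01 E : measurable E -> 0 <= fine (P E) <= 1.
  move=> mE; rewrite fine_ge0//= -[leRHS]/(fine 1%:E) fine_le ?probability_le1//.
  exact: fin_num_measure.
move=> _ [a /sigma_of_measurable ma] [b /sigma_of_measurable mb <-].
have /andP[a0 a1] := p01 _ ma; have /andP[b0 b1] := p01 _ mb.
have /andP[c0 c1] := p01 _ (measurableI _ _ ma mb).
have ab0 := mulr_ge0 a0 b0; have ab1 := mulr_ile1 a0 b0 a1 b1.
by rewrite ler_norml; lra.
Qed.

Lemma le_alpha (U V : {set D}) a b : sigma_of X U a -> sigma_of X V b ->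
  `|fine (P (a `&` b)) - fine (P a) * fine (P b)| <=
  alpha P (sigma_of X U) (sigma_of X V).
Proof.
move=> Ua Vb; apply: ub_le_sup; first by exists 1; exact: alpha_set_ub.
by exists a => //; exists b.
Qed.

Lemma alpha_le1 (U V : {set D}) : alpha P (sigma_of X U) (sigma_of X V) <= 1.
Proof.
apply: ge_sup; last exact: alpha_set_ub.
exists `|fine (P (set0 `&` set0)) - fine (P set0) * fine (P set0)|.
by exists set0; [exact: sigma_of0|exists set0 => //; exact: sigma_of0].
Qed.

Lemma alpha_mixing_ge0 q l : 0 <= alpha_mixing X q l.
Proof. by rewrite /alpha_mixing le_max lexx. Qed.

Lemma alpha_mixing_le1 q l : alpha_mixing X q l <= 1.
Proof.
rewrite /alpha_mixing ge_max ler01/=.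
set S := [set _ | _]; have [->|/set0P S0] := eqVneq S set0; first by rewrite sup0.
by apply: ge_sup => // _ [U [V [_ _ ->]]]; exact: alpha_le1.
Qed.

Lemma alpha_mixing_le q l (U V : {set D}) : (#|U| <= q)%N ->
  (forall i j, i \in U -> j \in V -> (l <= maxdist (val i) (val j))%N) ->
  alpha P (sigma_of X U) (sigma_of X V) <= alpha_mixing X q l.
Proof.
move=> Uq UV; rewrite /alpha_mixing le_max; apply/orP; right.
apply: ub_le_sup.
  by exists 1 => _ [U' [V' [_ _ ->]]]; exact: alpha_le1.
exists U, V; split => //; apply: le_ereal_inf_tmp => _ [i Ui] [j Vj <-].
by rewrite lee_fin ler_nat; exact: UV.
Qed.

Lemma alpha_mixing_anti q l l' : (l <= l')%N -> alpha_mixing X q l' <= alpha_mixing X q l.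
Proof.
move=> ll'; rewrite [leLHS]/alpha_mixing ge_max alpha_mixing_ge0/=.
set S := [set _ | _]; have [->|/set0P S0] := eqVneq S set0.
  by rewrite sup0 alpha_mixing_ge0.
apply: ge_sup => // _ [U [V [Uq UV ->]]]; apply: alpha_mixing_le => // i j iU jV.
have : (((maxdist (val i) (val j))%:R)%:E >= (l'%:R : R)%:E)%E.
  by apply: le_trans UV _; apply: ereal_inf_lbound; exists i => //; exists j.
by rewrite lee_fin ler_nat; exact: leq_trans.
Qed.

(** [A] may repeat points, but it has at most [q] distinct ones, and this fixes the order of the
    mixing coefficient. The sum of the two witnesses plays the role of [xi] in [cov_mixing]; passing
    to the smaller exponent [1 - q0 / r] only enlarges the bound, as the coefficient is at most
    1. *)
Lemma cov_prod_cX (q l : nat) (q0 e k : R) A J Z :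
  (size A <= q)%N -> 0 <= e -> (size A)%:R + e <= q0 -> q0 <= r ->
  (forall i j, i \in A -> j \in J -> (l <= maxdist (val i) (val j))%N) ->
  of_degree J e k Z ->
  `|cov P (prod_cX A) Z| <=
  20 * 2 ^+ q * k * rho (alpha_mixing X q l) (1 - q0 / r).
Proof.
move=> Aq e0 Ae q0r AJ [mZ k0 [z2 [i2 z20 m2 Z2]]].
pose U : {set D} := [set i in A].
have AU : {subset A <= U} by move=> i iA; rewrite inE.
have d1 := of_degree_prod_cX AU (lexx 0) _ (of_degree_cst U 1).
case: d1; first by rewrite addr0; lra.
rewrite normr1 mulr1 addr0 => mA' kA [z1 [i1 z10 m1 Z1]].
have {}Z1 t : `|prod_cX A t| <= 2 ^+ size A * z1 t `^ ((size A)%:R / r).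
  by rewrite -[prod_cX A t]mulr1; exact: Z1.
have mA : meas U (prod_cX A).
  by rewrite (_ : prod_cX A = fun t => prod_cX A t * 1)//; apply/funext => t; rewrite mulr1.
pose xi t := z1 t + z2 t.
have mxi : mean P xi <= 2.
  have -> : mean P xi = mean P z1 + mean P z2 by exact: meanD.
  by rewrite -[2]/(1 + 1); exact: lerD.
have s1 : 0 <= (size A)%:R / r by rewrite divr_ge0// ltW.
have s2 : 0 <= e / r by rewrite divr_ge0// ltW.
have Uq : (#|U| <= q)%N.
  by rewrite cardsE; apply: leq_trans (card_size _) _.
have ab (a b : set Omega) : sigma_of X U a -> sigma_of X J b ->
    `|fine (P (a `&` b)) - fine (P a) * fine (P b)| <= alpha_mixing X q l.
  move=> Ua Jb; apply: le_trans (le_alpha Ua Jb) _; apply: alpha_mixing_le => // i j.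
  by rewrite inE; exact: AJ.
have al01 : 0 <= alpha_mixing X q l <= 1 by rewrite alpha_mixing_ge0 alpha_mixing_le1.
have ss : (size A)%:R / r + e / r <= q0 / r.
  by rewrite -mulrDl ler_pM2r ?invr_gt0.
have q0r1 : q0 / r <= 1 by rewrite ler_pdivrMr// mul1r.
have h := @cov_mixing _ _ _ P (sigma_of X U) (sigma_of X J) _
  (@sigma_of_measurable U) (@sigma_of_measurable J) (@sigma_of0 U) (@sigma_ofT U)
  (@sigma_of0 J) (@sigma_ofT J) ab xi (prod_cX A) Z (2 ^+ size A) k _ _ al01 (intgD i1 i2)
  (fun w => addr_ge0 (z10 w) (z20 w)) _ (meas_measurable mA) (meas_measurable mZ)
  (fun x => meas_levels x mA) (fun x => meas_levels x mZ) (exprn_ge0 _ (ler0n _ 2)) k0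
  s1 s2 (le_trans ss q0r1).
apply: le_trans (h _ _ _) _.
- exact: mxi.
- move=> t; apply: le_trans (Z1 t) _; rewrite ler_wpM2l//.
  by apply: ge0_ler_powR; rewrite ?nnegrE ?addr_ge0// lerDl.
- move=> t; apply: le_trans (Z2 t) _; rewrite ler_wpM2l//.
  by apply: ge0_ler_powR; rewrite ?nnegrE ?addr_ge0// lerDr.
rewrite -!mulrA ler_pM2l// mulrA [in leRHS]mulrA; apply: ler_pM.
- by rewrite mulr_ge0.
- exact: rho_ge0.
- by rewrite ler_wpM2r// ler_weXn2l// ler1n.
- by apply: le_rho => //; rewrite lerD2l lerN2.
Qed.

(** * Taylor expansions of functions of the sum *)

Variable w : R.
Hypothesis w0 : 0 < w.

(* [g 0, ..., g h] behaves like a function and its first h derivatives, the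
   last one being w-Hoelder with constant H. *)
Definition jet (h : nat) (H : R) (g : nat -> R -> R) : Prop :=
  [/\ 0 <= H, forall j, (j <= h)%N -> measurable_fun setT (g j) &
      forall j x y, (j <= h)%N ->
        `|g j y - \sum_(q < (h - j).+1) (y - x) ^+ q / q`!%:R * g (j + q)%N x| <=
        H * `|y - x| `^ ((h - j)%:R + w)].

Definition shift (q : nat) (g : nat -> R -> R) : nat -> R -> R :=
  fun j => g (j + q)%N.

Lemma jet_shift h q H g : (q <= h)%N -> jet h H g -> jet (h - q) H (shift q g).
Proof.
move=> qh [H0 mg gT]; split => // [j jh|j x y jh].
  by apply: mg; rewrite -(subnK qh) leq_add2r.
have jqh : (j + q <= h)%N by rewrite -(subnK qh) leq_add2r.
have := gT (j + q)%N x y jqh; rewrite /shift -subnDA (addnC q).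
by under eq_bigr do rewrite addnAC.
Qed.

Definition total J (t : Omega) : R := \sum_(i in J) cX i t.

Lemma meas_total J : meas J (total J).
Proof. by apply: meas_sum => i iJ; exact: meas_cX. Qed.

Lemma measX J Z q : meas J Z -> meas J (fun t => Z t ^+ q).
Proof. by move=> /measP mZ; apply/measP; exact: measurable_funX. Qed.

Lemma measN J Z : meas J Z -> meas J (fun t => - Z t).
Proof. by move=> /measP mZ; apply/measP; exact: measurableT_comp. Qed.

Lemma admissible_total_exp J q : q%:R <= r ->
  admissible J q%:R (fun t => total J t ^+ q).
Proof.
move=> qr; case: q qr => [|q] qr.
  by apply: eq_admissible (admissible_cst J 1 _) => [t|]; rewrite ?expr0 ?lexx.
exists (1 * #|J|%:R `^ q.+1%:R); apply: of_degree_pow => //.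
- by apply: measX; exact: meas_total.
- by move=> t; rewrite mul1r normrX powR_mulrn.
Qed.

(** Taylor expansion at 0: a polynomial of degree at most [h] in the sum, plus a remainder of degree
    [h + w]. *)
Lemma admissible_jet J h H g : h%:R + w <= r -> jet h H g ->
  admissible J (h%:R + w) (fun t => g 0%N (total J t)).
Proof.
move=> hr [H0 mg gT].
have hw0 : 0 < h%:R + w by rewrite ltr_wpDl.
have hwr : 0 <= h%:R + w <= r by rewrite ltW.
pose T t := \sum_(q < h.+1) (total J t - 0) ^+ q / q`!%:R * g q 0.
have aT : admissible J (h%:R + w) T.
  apply: admissible_sum => // q _.
  apply: (@eq_admissible _ _ (fun t => (g q 0 / q`!%:R) * total J t ^+ q)).
    by move=> t; rewrite subr0 mulrAC -mulrA mulrC mulrAC.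
  apply: admissibleZ; apply: (@admissible_raise _ q%:R) => //.
    apply: le_trans (_ : h%:R <= _); last by rewrite lerDl ltW.
    by rewrite ler_nat -ltnS.
  apply: admissible_total_exp; apply: le_trans hr; rewrite -[leLHS]addr0.
  by apply: lerD; [rewrite ler_nat -ltnS|exact: ltW].
have mgT : meas J (fun t => g 0%N (total J t)).
  by apply: (@meas_comp _ (g 0%N)); [exact: mg|exact: meas_total].
have aR : admissible J (h%:R + w) (fun t => g 0%N (total J t) - T t).
  exists (H * #|J|%:R `^ (h%:R + w)); apply: of_degree_pow => //.
    by apply: measD => //; apply: measN; case: aT => k' /of_degree_meas.
  move=> t; have := gT 0%N 0 (total J t) (leq0n h).
  by rewrite subn0 (_ : `|\sum_(i in J) cX i t| = `|total J t - 0|)// subr0.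
by apply: eq_admissible (admissibleD hwr aR aT) => t; rewrite subrK.
Qed.

(** Ordered lists with repetitions, so that a power of a sum is a plain sum of products, without
    multinomial coefficients. *)
Fixpoint tup (s : seq D) q : seq (seq D) :=
  if q is q'.+1 then [seq i :: B | i <- s, B <- tup s q'] else [:: [::]].

Lemma size_tup s q : size (tup s q) = (size s ^ q)%N.
Proof. by elim: q => //= q ih; rewrite size_allpairs ih expnS. Qed.

Lemma tupP s q B : B \in tup s q -> size B = q /\ {subset B <= s}.
Proof.
elim: q B => [|q ih] B /=; first by rewrite inE => /eqP ->.
move=> /allpairsP[[i B'] /= [iS /ih[sB B's] ->]]; split; first by rewrite /= sB.
by move=> j; rewrite inE => /orP[/eqP ->|/B's].
Qed.

Lemma exp_sum_tup s q t : (\sum_(i <- s) cX i t) ^+ q = \sum_(B <- tup s q) prod_cX B t.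
Proof.
elim: q => [|q ih]; first by rewrite expr0 big_seq1 prod_cX_nil.
rewrite exprS ih /= big_allpairs_dep mulr_suml; apply: eq_bigr => i _.
by rewrite mulr_sumr; apply: eq_bigr => B _; rewrite prod_cX_cons.
Qed.

(** The Taylor terms are multiplied out over tuples because each product is to be treated as an
    extraction of its points. *)
Definition taylor_rest h g (J1 J' : {set D}) t : R :=
  g 0%N (total J1 t) - g 0%N (total J' t) -
  \sum_(1 <= q < h.+1) \sum_(B <- tup (enum (J1 :\: J')) q)
     q`!%:R^-1 * (prod_cX B t * shift q g 0%N (total J' t)).

Lemma total_setD (J1 J' : {set D}) t : J' \subset J1 ->
  total J1 t = total J' t + total (J1 :\: J') t.
Proof.
move=> JJ; rewrite /total (big_setID J')/= (finset.setIidPr JJ); congr (_ + _).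
Qed.

Lemma taylor_restP h H g (J1 J' : {set D}) : J' \subset J1 -> h%:R + w <= r ->
  jet h H g ->
  of_degree J1 (h%:R + w) (H * #|J1 :\: J'|%:R `^ (h%:R + w)) (taylor_rest h g J1 J').
Proof.
move=> JJ hr jg; have [H0 mg gT] := jg.
have hw0 : 0 < h%:R + w by rewrite ltr_wpDl.
have restE t : taylor_rest h g J1 J' t = g 0%N (total J1 t) -
    \sum_(q < h.+1) (total J1 t - total J' t) ^+ q / q`!%:R * g q (total J' t).
  rewrite /taylor_rest -addrA -opprD; congr (_ - _).
  rewrite -(big_mkord xpredT (fun q => (total J1 t - total J' t) ^+ q / q`!%:R *
    g q (total J' t))) big_ltn// expr0 invr1 !mul1r; congr (_ + _).
  apply: eq_bigr => q _; rewrite (total_setD t JJ) addrC addKr.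
  rewrite (_ : total (J1 :\: J') t ^+ q = \sum_(B <- tup (enum (J1 :\: J')) q) prod_cX B t).
    2: by rewrite -exp_sum_tup big_enum.
  rewrite !mulr_suml; apply: eq_bigr => B _.
  by rewrite /shift add0n mulrA [_^-1 * _]mulrC.
apply: of_degree_pow => //; first exact: finset.subsetDl.
  rewrite (_ : taylor_rest h g J1 J' = fun t => g 0%N (total J1 t) +
    \sum_(q < h.+1) (-1) * ((total J1 t - total J' t) ^+ q / q`!%:R * g q (total J' t))); last first.
    by apply/funext => t; rewrite restE -mulr_sumr mulN1r.
  have mt' : meas J1 (total J') by apply: meas_sub JJ _; exact: meas_total.
  apply: measD.
    by apply: (@meas_comp _ (g 0%N)); [exact: mg|exact: meas_total].
  apply: meas_sum => q _; apply: measM; first exact: meas_cst.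
  apply: measM; last by apply: (@meas_comp _ (g q)) mt'; apply: mg; rewrite -ltnS.
  apply: measM; last exact: meas_cst.
  by apply: measX; apply: measD; [exact: meas_total|exact: measN].
move=> t; rewrite restE; have := gT 0%N (total J' t) (total J1 t) (leq0n h).
rewrite subn0; set s := (X in _ <= _ * `|X| `^ _ -> _).
by rewrite (_ : s = total (J1 :\: J') t)// /s (total_setD t JJ) addrC addKr.
Qed.

(** The coefficients come before [g] and [H]: this uniformity is what allows them to be read off
    later from polynomials, for which [H = 0]. *)
Definition approx (h : nat) (Phi : (nat -> R -> R) -> R) (eps : R) : Prop :=
  exists c' : nat -> R, forall g H, jet h H g ->
    `|Phi g - \sum_(j < h.+1) c' j * mean P (fun t => g j (total [set: D]%SET t))| <= H * eps.

Lemma jet_ge0 h H g : jet h H g -> 0 <= H. Proof. by case. Qed.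

Lemma approx_le h Phi e e' : e <= e' -> approx h Phi e -> approx h Phi e'.
Proof.
move=> ee [c' hc]; exists c' => g H jg; apply: le_trans (hc g H jg) _.
by rewrite ler_wpM2l// (jet_ge0 jg).
Qed.

Lemma eq_approx h Phi Psi e : (forall g H, jet h H g -> Psi g = Phi g) ->
  approx h Phi e -> approx h Psi e.
Proof. by move=> E [c' hc]; exists c' => g H jg; rewrite (E _ _ jg); exact: hc. Qed.

Lemma approxD h Phi Psi e1 e2 : approx h Phi e1 -> approx h Psi e2 ->
  approx h (fun g => Phi g + Psi g) (e1 + e2).
Proof.
move=> [c1 h1] [c2 h2]; exists (fun j => c1 j + c2 j) => g H jg.
under eq_bigr do rewrite mulrDl; rewrite big_split/= opprD addrACA mulrDr.
by apply: le_trans (ler_normD _ _) _; apply: lerD; [exact: h1|exact: h2].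
Qed.

Lemma approxZ h Phi e x : approx h Phi e -> approx h (fun g => x * Phi g) (`|x| * e).
Proof.
move=> [c' hc]; exists (fun j => x * c' j) => g H jg.
under eq_bigr do rewrite -mulrA; rewrite -mulr_sumr -mulrBr normrM mulrCA.
by rewrite ler_wpM2l//; exact: hc.
Qed.

Lemma approx0 h : approx h (fun=> 0) 0.
Proof.
exists (fun=> 0) => g H jg; rewrite big1 => [|i _]; last by rewrite mul0r.
by rewrite subrr normr0 mulr0.
Qed.

Lemma approx_sum h (I : eqType) (s : seq I) (F : I -> (nat -> R -> R) -> R) (e : I -> R) :
  (forall i, i \in s -> approx h (F i) (e i)) ->
  approx h (fun g => \sum_(i <- s) F i g) (\sum_(i <- s) e i).
Proof.
elim: s => [|i s ih] hF.
  by rewrite big_nil; apply: eq_approx (approx0 h) => g H _; rewrite big_nil.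
rewrite big_cons; apply: (@eq_approx _ (fun g => F i g + \sum_(i <- s) F i g)).
  by move=> g H _; rewrite big_cons.
apply: approxD; first by apply: hF; rewrite mem_head.
by apply: ih => j js; apply: hF; rewrite in_cons js orbT.
Qed.

Lemma approx_shift h q Phi e : (q <= h)%N -> approx (h - q) Phi e ->
  approx h (fun g => Phi (shift q g)) e.
Proof.
move=> qh [c' hc]; exists (fun j => if (q <= j)%N then c' (j - q)%N else 0) => g H jg.
have := hc _ _ (jet_shift qh jg); congr (`|_ - _| <= _).
rewrite -(big_mkord xpredT (fun j => c' j * mean P (fun t => shift q g j (total [set: D]%SET t)))).
rewrite -(big_mkord xpredT (fun j => (if (q <= j)%N then c' (j - q)%N else 0) *
  mean P (fun t => g j (total [set: D]%SET t)))).
rewrite [in RHS](@big_cat_nat _ _ _ q)//=; last by rewrite leqW.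
rewrite [X in _ = X + _]big_nat [X in _ = X + _]big1 => [|j /andP[_ jq]]; last first.
  by rewrite leqNgt jq mul0r.
rewrite add0r [RHS](_ : _ = \sum_(0 <= j < h.+1 - q)
    (if (q <= j + q)%N then c' (j + q - q)%N else 0) *
    mean P (fun t => g (j + q)%N (total [set: D]%SET t))).
  by rewrite subSn//; apply: eq_bigr => j _; rewrite leq_addl addnK.
by rewrite -(big_addn 0 h.+1 q xpredT (fun j =>
  (if (q <= j)%N then c' (j - q)%N else 0) *
    mean P (fun t => g j (total [set: D]%SET t)))) add0n.
Qed.

(** One removal of points, for an abstract functional [Phi]. Here [b] prices the Taylor remainder
    through its degree, and [e q] prices one product of [q] removed points against the derivative of
    order [q]; the number of such products is the power [q] of the number of removed points, and the
    factors 1 / q! are bounded by 1. *)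
Lemma approx_taylor h (J1 J' : {set D}) (Phi : (Omega -> R) -> R) b (e : nat -> R) :
  J' \subset J1 -> h%:R + w <= r ->
  (forall x Z V, admissible J1 (h%:R + w) Z -> admissible J1 (h%:R + w) V ->
    Phi (fun t => x * Z t + V t) = x * Phi Z + Phi V) ->
  (forall k' Z, of_degree J1 (h%:R + w) k' Z -> `|Phi Z| <= b * k') ->
  (forall q B, (0 < q <= h)%N -> size B = q -> {subset B <= J1 :\: J'} ->
    approx (h - q) (fun g => Phi (fun t => prod_cX B t * g 0%N (total J' t))) (e q)) ->
  (forall q, 0 <= e q) ->
  approx h (fun g => Phi (fun t => g 0%N (total J1 t)) - Phi (fun t => g 0%N (total J' t)))
    (b * #|J1 :\: J'|%:R `^ (h%:R + w) +
     \sum_(1 <= q < h.+1) #|J1 :\: J'|%:R ^+ q * e q).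
Proof.
move=> JJ hr lin bnd ih e0.
have hw0 : 0 < h%:R + w by rewrite ltr_wpDl.
have hwr : 0 <= h%:R + w <= r by rewrite ltW.
set I := J1 :\: J'.
have zero : admissible J1 (h%:R + w) (fun=> 0) by exact: admissible_cst.
have Phi0 : Phi (fun=> 0) = 0.
  have := lin 1 _ _ zero zero.
  rewrite (_ : (fun t => _) = fun=> 0); last by apply/funext => t; rewrite mulr0 addr0.
  rewrite mul1r.
  by move/eqP; rewrite -subr_eq0 opprD addrA subrr sub0r oppr_eq0 => /eqP.
have PhiZ x Z : admissible J1 (h%:R + w) Z -> Phi (fun t => x * Z t) = x * Phi Z.
  move=> aZ; have := lin x _ _ aZ zero; rewrite Phi0 addr0 => <-.
  by congr Phi; apply/funext => t; rewrite addr0.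
have PhiD Z V : admissible J1 (h%:R + w) Z -> admissible J1 (h%:R + w) V ->
    Phi (fun t => Z t + V t) = Phi Z + Phi V.
  move=> aZ aV; have := lin 1 _ _ aZ aV; rewrite mul1r => <-.
  by congr Phi; apply/funext => t; rewrite mul1r.
have Phi_sum (T : eqType) (s : seq T) (F : T -> Omega -> R) :
    (forall i, i \in s -> admissible J1 (h%:R + w) (F i)) ->
    admissible J1 (h%:R + w) (fun t => \sum_(i <- s) F i t) /\
    Phi (fun t => \sum_(i <- s) F i t) = \sum_(i <- s) Phi (F i).
  elim: s => [|i s IH] aF.
    rewrite big_nil (_ : (fun t => _) = fun=> 0)//.
    by apply/funext => t; rewrite big_nil.
  have [aS E] := IH (fun j js => aF j (mem_behead (s := i :: s) js)).
  have ai := aF i (mem_head i s).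
  rewrite (_ : (fun t => _) = fun t => F i t + \sum_(i <- s) F i t); last first.
    by apply/funext => t; rewrite big_cons.
  by rewrite big_cons -E PhiD//; split => //; exact: admissibleD.
have qB q B : B \in tup (enum I) q -> size B = q /\ {subset B <= I}.
  by move=> /tupP[sB BI]; split => // i /BI; rewrite mem_enum.
have aterm g H q B : jet h H g -> q \in index_iota 1 h.+1 -> B \in tup (enum I) q ->
    admissible J1 (h%:R + w) (fun t => prod_cX B t * shift q g 0%N (total J' t)).
  move=> jg; rewrite mem_index_iota ltnS => /andP[q1 qh] /qB[sB BI].
  have E : h%:R + w = (size B)%:R + ((h - q)%:R + w).
    by rewrite addrA -natrD sB subnKC.
  rewrite E; apply: admissibleM.
  - by move=> i /BI; rewrite inE => /andP[].
  - by rewrite addr_ge0// ltW.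
  - by rewrite -E.
  - apply: admissible_sub JJ _; apply: admissible_jet (jet_shift qh jg).
    by rewrite (le_trans _ hr)// lerD2r ler_nat leq_subr.
apply: (@eq_approx _ (fun g => Phi (taylor_rest h g J1 J') +
    \sum_(q <- index_iota 1 h.+1) \sum_(B <- tup (enum I) q)
      q`!%:R^-1 * Phi (fun t => prod_cX B t * shift q g 0%N (total J' t)))).
  move=> g H jg; have aJ1 := admissible_jet J1 hr jg.
  have aJ' := admissible_sub JJ (admissible_jet J' hr jg).
  have aR : admissible J1 (h%:R + w) (taylor_rest h g J1 J').
    by eexists; exact: taylor_restP jg.
  have inner q : q \in index_iota 1 h.+1 ->
      admissible J1 (h%:R + w) (fun t => \sum_(B <- tup (enum I) q)
        q`!%:R^-1 * (prod_cX B t * shift q g 0%N (total J' t))) /\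
      Phi (fun t => \sum_(B <- tup (enum I) q)
        q`!%:R^-1 * (prod_cX B t * shift q g 0%N (total J' t))) =
      \sum_(B <- tup (enum I) q)
        q`!%:R^-1 * Phi (fun t => prod_cX B t * shift q g 0%N (total J' t)).
    move=> qi; have [a1 ->] := Phi_sum _ (tup (enum I) q) (fun B t =>
      q`!%:R^-1 * (prod_cX B t * shift q g 0%N (total J' t)))
      (fun B Bt => admissibleZ _ (aterm _ _ _ _ jg qi Bt)).
    split => //; rewrite big_seq [in RHS]big_seq; apply: eq_bigr => B Bt.
    by rewrite PhiZ//; exact: aterm jg qi Bt.
  have [a2 E2] := Phi_sum _ (index_iota 1 h.+1) _ (fun q qi => (inner q qi).1).
  rewrite [X in _ = _ + X](_ : _ = Phi (fun t => \sum_(q <- index_iota 1 h.+1)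
      \sum_(B <- tup (enum I) q)
        q`!%:R^-1 * (prod_cX B t * shift q g 0%N (total J' t)))); last first.
    rewrite E2 big_seq [in RHS]big_seq; apply: eq_bigr => q qi.
    by rewrite (inner q qi).2.
  rewrite -PhiD//; apply/eqP; rewrite subr_eq -PhiD//; last exact: admissibleD.
  apply/eqP; congr Phi; apply/funext => t; rewrite /taylor_rest.
  by rewrite subrK addrC subrKC.
apply: approxD.
  (* The Taylor remainder is pure error: it contributes no coefficient. *)
  exists (fun=> 0) => g H jg; rewrite big1 => [|j _]; last by rewrite mul0r.
  rewrite subr0; apply: le_trans (bnd _ _ (taylor_restP JJ hr jg)) _.
  by rewrite mulrCA.
apply: approx_sum => q; rewrite mem_index_iota ltnS => /andP[q1 qh].
apply: (@approx_le _ _ (\sum_(B <- tup (enum I) q) e q)).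
  by rewrite big_const_seq count_predT iter_addr_0 size_tup -cardE -natrX mulr_natl.
apply: approx_sum => B /qB[sB BI].
apply: (@approx_le _ _ (`|q`!%:R^-1| * e q)).
  rewrite ler_piMl// ger0_norm ?invr_ge0// invf_le1 ?ltr0n ?fact_gt0//.
  by rewrite ler1n fact_gt0.
apply: approxZ; apply: (@approx_shift _ _ (fun g =>
   Phi (fun t => prod_cX B t * g 0%N (total J' t)))) => //.
by apply: ih => //; rewrite q1.
Qed.

(** * Expansion over dyadic scales *)

Variables (k U : nat) (kap b : R) (rh : nat -> R).
(** The budget of degrees: the number of extracted points plus the degree of the function still
    inside stays at most [q0]. *)
Let q0 : R := k%:R + 1 + w.
Hypothesis q0r : q0 <= r.

Definition nearby v A : {set D} :=
  [set j | has (fun i => (maxdist (val i) (val j) < 2 ^ v)%N) A].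

(** Beyond the last scale [U] every point counts as near, so that the layers end with the empty set.
    The bound [card_cut] will survive there because [U] is chosen so that a cube of side comparable
    to [2 ^ U] has at least as many points as [D]. *)
Definition cut v A : {set D} := if (v <= U)%N then nearby v A else [set: D]%SET.

Hypothesis b_ge2 : 2 <= b.
Hypothesis kap_ge0 : 0 <= kap.
Hypothesis card_cut : forall v A, (v <= U)%N -> (size A <= k.+1)%N ->
  #|cut v.+1 A|%:R <= kap * b ^+ v.
Hypothesis rh01 : forall v, 0 <= rh v <= 1.
Hypothesis rh_mixing : forall v, (v <= U)%N ->
  rho (alpha_mixing X k.+1 (2 ^ v)) (1 - q0 / r) <= rh v.

Let rh0 v : 0 <= rh v. Proof. by case/andP: (rh01 v). Qed.
Let rh1 v : rh v <= 1. Proof. by case/andP: (rh01 v). Qed.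

Lemma nearby_sub v A A' : {subset A <= A'} -> nearby v A \subset nearby v A'.
Proof.
move=> AA; apply/fintype.subsetP => j; rewrite !inE => /hasP[i iA ij].
by apply/hasP; exists i => //; exact: AA.
Qed.

Lemma nearby_le v v' A : (v <= v')%N -> nearby v A \subset nearby v' A.
Proof.
move=> vv; apply/fintype.subsetP => j; rewrite !inE => /hasP[i iA ij].
by apply/hasP; exists i => //; apply: leq_trans ij _; rewrite leq_pexp2l.
Qed.

Lemma cut_sub v A A' : {subset A <= A'} -> cut v A \subset cut v A'.
Proof. by move=> AA; rewrite /cut; case: ifP => // _; exact: nearby_sub. Qed.

Lemma cut_le v v' A : (v <= v')%N -> cut v A \subset cut v' A.
Proof.
move=> vv; rewrite /cut; case: (leqP v' U) => [v'U|_]; last exact: finset.subsetT.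
by rewrite (leq_trans vv v'U); exact: nearby_le.
Qed.

Definition hat Z t : R := Z t - mean P Z.

Lemma mean_hat A Z : intg P (prod_cX A) -> intg P (fun t => prod_cX A t * Z t) ->
  mean P (fun t => prod_cX A t * hat Z t) = cov P (prod_cX A) Z.
Proof.
move=> iA iAZ; rewrite /cov mulrC -(meanZ _ iA) -meanB//; last exact: intgZ.
by apply: eq_mean => t; rewrite /hat mulrBr [_ * mean _ _]mulrC.
Qed.

Definition cov_const : R := 20 * 2 ^+ k.+1.
(** Factor by which [bd] grows at each extraction. The 21 is 1 plus the 20 of [cov_mixing], and
    covers the smaller factors 3 and 2 met in the other estimates. *)
Definition growth : R := 21 * 2 ^+ k.+1.

Lemma cov_const_ge0 : 0 <= cov_const. Proof. by rewrite mulr_ge0// exprn_ge0. Qed.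
Lemma growth_ge0 : 0 <= growth. Proof. by rewrite mulr_ge0// exprn_ge0. Qed.

Let two_k : 1 <= 2 ^+ k.+1 :> R. Proof. by rewrite exprn_ege1// ler1n. Qed.

Lemma cov_const_growth : 1 + cov_const <= growth.
Proof. by rewrite /growth /cov_const; move: two_k => h; lra. Qed.

Let deg_le a e : a%:R + e <= q0 -> 0 <= e -> 0 <= e <= r.
Proof. by move=> h e0; rewrite e0 (le_trans _ q0r)// (le_trans _ h)// lerDr. Qed.

Lemma size_le_r A e : 0 <= e -> (size A)%:R + e <= q0 -> (size A)%:R + 0 <= r.
Proof. by move=> e0 h; rewrite (le_trans _ q0r)// (le_trans _ h)// lerD2l. Qed.

Lemma intg_prod_cX A : (size A)%:R <= r -> intg P (prod_cX A).
Proof.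
move=> Ar; have := @admissibleM [set: D]%SET 0 (fun=> 1) A.
rewrite addr0 => /(_ (fun i _ => finset.in_setT i) (lexx 0) Ar).
move=> /(_ (admissible_cst _ _ _)) h.
have {}h : admissible [set: D]%SET (size A)%:R (fun t => prod_cX A t * 1).
  by apply: h; rewrite lexx ltW.
apply: eq_intg (admissible_intg _ h) => [t|]; first by rewrite mulr1.
by rewrite ler0n.
Qed.

(** Centring turns the mean into a covariance, and every point on which [Z] depends is at distance
    at least [2 ^ v] from [A]. *)
Lemma cov_far A J v e k' Z : (v <= U)%N -> (size A <= k.+1)%N -> 0 <= e ->
  (size A)%:R + e <= q0 -> of_degree (J :\: nearby v A) e k' Z ->
  `|mean P (fun t => prod_cX A t * hat Z t)| <= cov_const * k' * rh v.
Proof.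
move=> vU Ak e0 Ae dZ; have k0 := of_degree_ge0 dZ.
rewrite mean_hat; last 2 first.
- by apply: intg_prod_cX; rewrite -[leLHS]addr0; exact: size_le_r Ae.
- apply: (@admissible_intg [set: D]%SET ((size A)%:R + e)).
    by rewrite addr_ge0//= (le_trans Ae).
  apply: admissibleM => //.
  + by move=> i _; rewrite finset.in_setT.
  + by rewrite (le_trans Ae).
  + by exists k'; apply: of_degree_sub dZ; exact: finset.subsetT.
apply: le_trans (cov_prod_cX (l := 2 ^ v) Ak e0 Ae q0r _ dZ) _.
  move=> i j iA; rewrite inE => /andP[+ _]; rewrite inE => /hasPn /(_ i iA).
  by rewrite -leqNgt.
by rewrite ler_wpM2l ?rh_mixing// mulr_ge0// cov_const_ge0.
Qed.

(* The running state of the expansion: Lam stands for a signed sum of products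
   of expectations in which the points of A are already extracted, J for the
   points still in the argument of the test function, and 2 ^ u for the widest
   gap crossed so far. *)
Record state (Lam : (Omega -> R) -> R) A J (u : nat) (bd : R) : Prop := State {
  state_u : (u <= U)%N;
  state_A : (size A <= k.+1)%N;
  state_J : ~: J \subset cut u.+1 A;
  state_bd : 0 <= bd;
  state_lin : forall e x Z V, 0 <= e -> (size A)%:R + e <= q0 ->
    admissible J e Z -> admissible J e V ->
    Lam (fun t => x * Z t + V t) = x * Lam Z + Lam V;
  state_bound : forall e k' Z, 0 <= e -> (size A)%:R + e <= q0 ->
    of_degree J e k' Z -> `|Lam Z| <= bd * k' * rh u;
  state_far : forall v S e k' Z, (v <= U)%N -> 0 <= e -> {subset S <= J} ->
    (size (A ++ S))%:R + e <= q0 -> (size (A ++ S) <= k.+1)%N ->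
    of_degree (J :\: nearby v (A ++ S)) e k' Z ->
    `|Lam (fun t => prod_cX S t * hat Z t)| <= bd * k' * rh v }.

Section one_state.
Variables (Lam : (Omega -> R) -> R) (A : seq D) (J : {set D}) (u : nat) (bd : R).
Hypothesis st : state Lam A J u bd.

Let bd0 : 0 <= bd := state_bd st.

(** The telescoping starts from [J] itself, and its first difference, at scale [u], removes at once
    all points cut at scale [u.+1]; for that difference the decay [rh u] is already contained in
    [Lam]. *)
Definition layer v : {set D} := if (v <= u)%N then J else J :\: cut v A.

Lemma layer_sub v : layer v \subset J.
Proof. by rewrite /layer; case: ifP => // _; exact: finset.subsetDl. Qed.

Lemma layer_anti v : layer v.+1 \subset layer v.
Proof.
rewrite /layer; case: (ltnP v u) => [vu|uv].
  by rewrite (ltnW vu).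
case: ifP => _; first exact: finset.subsetDl.
by apply: finset.setDS; exact: cut_le.
Qed.

Let Lam1 (Ae : (size A)%:R <= q0) : `|Lam (fun=> 1)| <= bd * rh u.
Proof.
have := state_bound st (lexx 0) _ (of_degree_cst J 1).
by rewrite addr0 normr1 mulr1; exact.
Qed.

Lemma Lam_hat e Z : 0 <= e -> (size A)%:R + e <= q0 -> admissible J e Z ->
  Lam (hat Z) = Lam Z - mean P Z * Lam (fun=> 1).
Proof.
move=> e0 Ae aZ; have er := deg_le Ae e0; rewrite -mulNr addrC.
have := state_lin st (- mean P Z) e0 Ae (admissible_cst J 1 er) aZ.
move=> <-; congr Lam; apply/funext => t.
by rewrite /hat mulr1 addrC.
Qed.

Lemma Lam_hat_lin e x Z V : 0 <= e -> (size A)%:R + e <= q0 ->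
  admissible J e Z -> admissible J e V ->
  Lam (hat (fun t => x * Z t + V t)) = x * Lam (hat Z) + Lam (hat V).
Proof.
move=> e0 Ae aZ aV; have er := deg_le Ae e0.
have iZ := admissible_intg er aZ; have iV := admissible_intg er aV.
have aH W : admissible J e W -> admissible J e (hat W).
  by move=> aW; apply: admissibleB => //; exact: admissible_cst.
rewrite -(state_lin st x e0 Ae (aH _ aZ) (aH _ aV)); congr Lam; apply/funext => t.
rewrite /hat meanD ?meanZ//; last exact: intgZ.
by ring.
Qed.

(** At [v = u] the decay is already in [Lam], and centring is undone by linearity at the price 1 + 2
    = 3. For [v > u] it is [state_far] without new points that supplies [rh v]. *)
Lemma Lam_hat_bound v e k' Z : (u <= v <= U)%N -> 0 <= e -> (size A)%:R + e <= q0 ->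
  of_degree (layer v) e k' Z -> `|Lam (hat Z)| <= 3 * bd * k' * rh v.
Proof.
move=> /andP[uv vU] e0 Ae dZ; have er := deg_le Ae e0.
have k0 := of_degree_ge0 dZ.
have kr : 0 <= bd * k' * rh v by rewrite !mulr_ge0.
have A0 : (size A)%:R <= q0 by rewrite (le_trans _ Ae)// lerDl.
have [vu|vu] := leqP v u.
  have E : v = u by apply/eqP; rewrite eqn_leq vu.
  rewrite /layer vu in dZ; rewrite (Lam_hat e0 Ae); last by exists k'.
  apply: le_trans (ler_normB _ _) _; rewrite normrM.
  have h1 := state_bound st e0 Ae dZ; have [_ h2] := of_degree_mean er dZ.
  have h3 := Lam1 A0; rewrite E.
  apply: le_trans (lerD h1 (ler_pM (normr_ge0 _) (normr_ge0 _) h2 h3)) _.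
  by rewrite le_eqVlt; apply/orP; left; apply/eqP; ring.
have dZ' : of_degree (J :\: nearby v (A ++ [::])) e k' Z.
  by move: dZ; rewrite /layer leqNgt vu/= /cut vU cats0.
have := state_far st vU e0 (S := [::]) _ _ _ dZ'; rewrite cats0.
move=> /(_ (fun i => ltac:(by [])) Ae (state_A st)).
rewrite (_ : (fun t => _) = hat Z); last by apply/funext => t; rewrite prod_cX_nil mul1r.
move=> h; apply: le_trans h _; rewrite -!mulrA ler_peMl ?ler1n//.
by rewrite mulrA.
Qed.

(** The points of [B] are those removed between the scales [v] and [v.+1]. The decay [rh v] comes
    from [hat]: the product of [prod_cX B] with a function of the smaller layer is still a function
    of [layer v], so [Lam_hat_bound] applies to it. *)
Lemma state_extract v B : (u <= v <= U)%N -> (size (A ++ B) <= k.+1)%N ->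
  {subset B <= layer v :\: layer v.+1} ->
  state (fun Z => Lam (hat (fun t => prod_cX B t * Z t))) (A ++ B) (layer v.+1) v (growth * bd).
Proof.
move=> /andP[uv vU] AB BJ; have AAB : {subset A <= A ++ B}.
  by move=> i iA; rewrite mem_cat iA.
have BJv : {subset B <= layer v} by move=> i /BJ; rewrite inE => /andP[].
have BJ0 : {subset B <= J} by move=> i /BJv; exact: (fintype.subsetP (layer_sub v)).
have splitAB e : (size (A ++ B))%:R + e = (size A)%:R + ((size B)%:R + e) :> R.
  by rewrite size_cat natrD addrA.
have be (e : R) : 0 <= e -> 0 <= (size B)%:R + e by move=> e0; rewrite addr_ge0.
have ber e : 0 <= e -> (size (A ++ B))%:R + e <= q0 -> (size B)%:R + e <= r.
  move=> e0 h; rewrite (le_trans _ q0r)// (le_trans _ h)// lerD2r ler_nat size_cat.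
  exact: leq_addl.
have Jv1 := layer_sub v.+1.
split => //.
- rewrite /layer ltnNge uv/= finset.setCD finset.subUset; apply/andP; split; last exact: cut_sub.
  apply: fintype.subset_trans (state_J st) _.
  by apply: fintype.subset_trans (cut_le _ _) (cut_sub _ AAB).
- by rewrite mulr_ge0// growth_ge0.
- move=> e x Z V e0 Ae aZ aV.
  have aB W : admissible (layer v.+1) e W ->
      admissible J ((size B)%:R + e) (fun t => prod_cX B t * W t).
    by move=> aW; apply: admissibleM => //; [exact: ber|exact: admissible_sub aW].
  rewrite splitAB in Ae.
  rewrite -(@Lam_hat_lin _ x _ _ (be e e0) Ae (aB Z aZ) (aB V aV)).
  by congr Lam; congr hat; apply/funext => t; ring.
- move=> e k' Z e0 Ae dZ; have k0 := of_degree_ge0 dZ.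
  have dBZ : of_degree (layer v) ((size B)%:R + e) (2 ^+ size B * k')
      (fun t => prod_cX B t * Z t).
    apply: of_degree_prod_cX => //; first exact: ber.
    by apply: of_degree_sub dZ; exact: layer_anti.
  have vU' : (u <= v <= U)%N by rewrite uv.
  rewrite splitAB in Ae.
  apply: le_trans (Lam_hat_bound vU' (be _ e0) Ae dBZ) _.
  rewrite ler_wpM2r//.
  apply: le_trans (_ : 3 * bd * (2 ^+ k.+1 * k') <= _).
    rewrite ler_wpM2l ?mulr_ge0// ler_wpM2r// ler_weXn2l ?ler1n//.
    by apply: leq_trans AB; rewrite size_cat leq_addl.
  have E x : 3 * bd * (x * k') = 3 * (x * bd * k') by ring.
  have E' x : 21 * x * bd * k' = 21 * (x * bd * k') by ring.
  rewrite /growth E E'.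
  by rewrite ler_wpM2r ?ler_nat// !mulr_ge0// exprn_ge0.
- move=> v' S e k' Z v'U e0 SJ ABSe ABS dZ; have k0 := of_degree_ge0 dZ.
  have BSJ : {subset B ++ S <= J}.
    move=> i; rewrite mem_cat => /orP[/BJ0//|/SJ]; exact: (fintype.subsetP Jv1).
  rewrite -catA in ABSe ABS dZ.
  have dZJ : of_degree (J :\: nearby v' (A ++ (B ++ S))) e k' Z.
    by apply: of_degree_sub dZ; exact: finset.setSD.
  have h1 := state_far st v'U e0 BSJ ABSe ABS dZJ.
  have eqf : (fun t => prod_cX B t * (prod_cX S t * hat Z t)) =
             (fun t => prod_cX (B ++ S) t * hat Z t).
    by apply/funext => t; rewrite prod_cX_cat mulrA.
  have splitABS : (size (A ++ (B ++ S)))%:R + e = (size A)%:R + ((size (B ++ S))%:R + e) :> R.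
    by rewrite size_cat natrD addrA.
  have bse : 0 <= (size (B ++ S))%:R + e by rewrite addr_ge0.
  have bsle : (size (B ++ S))%:R + e <= q0.
    by rewrite (le_trans _ ABSe)// splitABS lerDr.
  have er : 0 <= e <= r by rewrite (deg_le bsle).
  have aZ : admissible J e Z.
    by exists k'; apply: of_degree_sub dZJ; exact: finset.subsetDl.
  have ahZ : admissible J e (hat Z) by apply: admissibleB => //; exact: admissible_cst.
  have aBS : admissible J ((size (B ++ S))%:R + e) (fun t => prod_cX (B ++ S) t * hat Z t).
    by apply: admissibleM => //; rewrite (le_trans bsle).
  (* The outer centring is expanded. Its first term is the old [state_far] with [B ++ S] in place of
     [S]; the second is a far covariance times the value of [Lam] at 1. Together they give the
     factor [1 + cov_const]. *)
  rewrite eqf (Lam_hat bse _ aBS); last by rewrite -splitABS.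
  apply: le_trans (ler_normB _ _) _; rewrite normrM.
  have h2 : `|mean P (fun t => prod_cX (B ++ S) t * hat Z t)| <= cov_const * k' * rh v'.
    apply: (@cov_far _ J v' e k') => //.
      by apply: leq_trans ABS; rewrite !size_cat leq_addl.
    apply: of_degree_sub dZJ; apply: finset.setDS; apply: nearby_sub => i.
    by rewrite !mem_cat => ->; rewrite orbT.
  have A0 : (size A)%:R <= q0.
    by rewrite (le_trans _ ABSe)// splitABS lerDl.
  have h3 : `|Lam (fun=> 1)| <= bd.
    by apply: le_trans (Lam1 A0) _; rewrite ler_piMr.
  apply: le_trans (lerD h1 (ler_pM (normr_ge0 _) (normr_ge0 _) h2 h3)) _.
  have E x : bd * k' * rh v' + x * k' * rh v' * bd = (1 + x) * (bd * k' * rh v') by ring.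
  have E' x : x * bd * k' * rh v' = x * (bd * k' * rh v') by ring.
  rewrite E E'.
  by rewrite ler_wpM2r ?cov_const_growth// !mulr_ge0.
Qed.

(** The case where an expectation has split off: the decay [rh u] sits in the scalar [Lam (fun=> 1)]
    and survives wherever the points of [B] lie, so [J] and the scale are kept. *)
Lemma state_restart B : (size (A ++ B) <= k.+1)%N ->
  state (fun Z => Lam (fun=> 1) * mean P (fun t => prod_cX B t * Z t)) (A ++ B) J u (growth * bd).
Proof.
move=> AB; have AAB : {subset A <= A ++ B}.
  by move=> i iA; rewrite mem_cat iA.
have BT : {subset B <= [set: D]%SET} by move=> i _; rewrite finset.in_setT.
have splitAB e : (size (A ++ B))%:R + e = (size A)%:R + ((size B)%:R + e) :> R.
  by rewrite size_cat natrD addrA.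
have be (e : R) : 0 <= e -> 0 <= (size B)%:R + e by move=> e0; rewrite addr_ge0.
have A0 e : 0 <= e -> (size (A ++ B))%:R + e <= q0 -> (size A)%:R <= q0.
  by move=> e0 h; rewrite (le_trans _ h)// splitAB lerDl be.
have ber e : 0 <= e -> (size (A ++ B))%:R + e <= q0 -> 0 <= (size B)%:R + e <= r.
  move=> e0 h; rewrite be//= (le_trans _ q0r)// (le_trans _ h)// lerD2r ler_nat size_cat.
  exact: leq_addl.
split => //.
- exact: state_u st.
- by apply: fintype.subset_trans (state_J st) (cut_sub _ AAB).
- by rewrite mulr_ge0// growth_ge0.
- move=> e x Z V e0 Ae aZ aV.
  have iB W : admissible J e W -> intg P (fun t => prod_cX B t * W t).
    move=> aW; have := ber _ e0 Ae => er; apply: (@admissible_intg [set: D]%SET _ _ er).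
    apply: admissibleM => //; first by case/andP: er.
    by apply: admissible_sub aW; exact: finset.subsetT.
  rewrite mulrCA -mulrDr; congr (_ * _); rewrite -(meanZ x (iB _ aZ)) -meanD.
  + by apply: eq_mean => t; ring.
  + by apply: intgZ; exact: iB.
  + exact: iB.
- move=> e k' Z e0 Ae dZ; have k0 := of_degree_ge0 dZ; have er := ber _ e0 Ae.
  have dBZ : of_degree [set: D]%SET ((size B)%:R + e) (2 ^+ size B * k')
      (fun t => prod_cX B t * Z t).
    apply: of_degree_prod_cX => //; first by case/andP: er.
    by apply: of_degree_sub dZ; exact: finset.subsetT.
  have [_ h2] := of_degree_mean er dBZ; have h1 := Lam1 (A0 _ e0 Ae).
  rewrite normrM; apply: le_trans (ler_pM (normr_ge0 _) (normr_ge0 _) h1 h2) _.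
  have E x : bd * rh u * (2 * (x * k')) = 2 * x * (bd * k' * rh u) by ring.
  have E' x : x * bd * k' * rh u = x * (bd * k' * rh u) by ring.
  rewrite E E'.
  rewrite ler_wpM2r ?mulr_ge0// /growth ler_pM// ?exprn_ge0 ?ler_nat//.
  rewrite ler_weXn2l ?ler1n//.
  by apply: leq_trans AB; rewrite size_cat leq_addl.
- move=> v' S e k' Z v'U e0 SJ ABSe ABS dZ; have k0 := of_degree_ge0 dZ.
  rewrite -catA in ABSe ABS dZ.
  have splitABS : (size (A ++ (B ++ S)))%:R + e = (size A)%:R + ((size (B ++ S))%:R + e) :> R.
    by rewrite size_cat natrD addrA.
  have bse : 0 <= (size (B ++ S))%:R + e by rewrite addr_ge0.
  have bsle : (size (B ++ S))%:R + e <= q0.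
    by rewrite (le_trans _ ABSe)// splitABS lerDr.
  have eqf : (fun t => prod_cX B t * (prod_cX S t * hat Z t)) =
             (fun t => prod_cX (B ++ S) t * hat Z t).
    by apply/funext => t; rewrite prod_cX_cat mulrA.
  have h2 : `|mean P (fun t => prod_cX (B ++ S) t * hat Z t)| <= cov_const * k' * rh v'.
    apply: (@cov_far _ J v' e k') => //.
      by apply: leq_trans ABS; rewrite !size_cat leq_addl.
    apply: of_degree_sub dZ; apply: finset.setDS; apply: nearby_sub => i.
    by rewrite !mem_cat => ->; rewrite orbT.
  have h3 : `|Lam (fun=> 1)| <= bd.
    apply: le_trans (Lam1 _) _; last by rewrite ler_piMr.
    by rewrite (le_trans _ ABSe)// splitABS lerDl.
  rewrite eqf normrM.
  apply: le_trans (ler_pM (normr_ge0 _) (normr_ge0 _) h3 h2) _.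
  have E x : bd * (x * k' * rh v') = x * (bd * k' * rh v') by ring.
  have E' x : x * bd * k' * rh v' = x * (bd * k' * rh v') by ring.
  rewrite E E'.
  rewrite ler_wpM2r ?mulr_ge0//; apply: le_trans cov_const_growth; rewrite lerDr; exact: ler01.
Qed.

End one_state.

(** The error per point gathered from scale [u] on with [h] derivatives left, where [b ^+ v] stands
    for the number of points at scale [v]. *)
Definition Qs (h u : nat) : R :=
  \sum_(u <= v < U.+1) (b ^+ v) `^ (h%:R + w) * rh v.

(** Closed form of the recursion [Cs_rec], which is the one produced by the induction in
    [approx_state]. *)
Definition Cs (h : nat) : R := 5 * kap `^ (h%:R + w) * (1 + 3 * growth) ^+ h.

Let b0 : 0 < b. Proof. exact: lt_le_trans b_ge2. Qed.
Let b1 : 1 <= b. Proof. by apply: le_trans b_ge2; rewrite ler1n. Qed.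
Let bv0 v : 0 < b ^+ v. Proof. exact: exprn_gt0. Qed.

Lemma Cs_ge0 h : 0 <= Cs h.
Proof. by rewrite !mulr_ge0 ?powR_ge0// exprn_ge0// addr_ge0// mulr_ge0// growth_ge0. Qed.

Lemma Qs_ge0 h u : 0 <= Qs h u.
Proof. by apply: sumr_ge0 => v _; rewrite mulr_ge0 ?powR_ge0. Qed.

Lemma powR_natD (x : R) q h : (q <= h)%N -> 0 <= x ->
  x ^+ q * x `^ ((h - q)%:R + w) = x `^ (h%:R + w).
Proof.
move=> qh x0; rewrite -powR_mulrn// -powRD.
  by rewrite addrA -natrD subnKC.
by rewrite gt_eqF// ltr_wpDl// ltr_wpDl.
Qed.

Lemma Qs_pow h q u : (q <= h)%N -> (b ^+ u) ^+ q * Qs (h - q) u <= Qs h u.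
Proof.
move=> qh; rewrite /Qs mulr_sumr; apply: ler_sum_nat => v /andP[uv _].
rewrite mulrA ler_wpM2r// -(powR_natD qh (ltW (bv0 v))) ler_wpM2r ?powR_ge0//.
by rewrite lerXn2r ?nnegrE ?(ltW (bv0 _))// ler_weXn2l.
Qed.

Lemma sum_geo (x : R) u v : 2 <= x -> \sum_(u <= i < v.+1) x ^+ i <= 2 * x ^+ v.
Proof.
move=> x2; have x0 : 0 <= x by rewrite (le_trans _ x2).
elim: v => [|v ih].
  case: u => [|u]; first by rewrite big_nat1 expr0 mulr1 ler1n.
  by rewrite big_geq ?expr0 ?mulr1.
have [uv|vu] := leqP u v.+1; last by rewrite big_geq// mulr_ge0// exprn_ge0.
rewrite big_nat_recr//=; apply: le_trans (lerD ih (lexx _)) _.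
have h : 2 * x ^+ v <= x ^+ v.+1 by rewrite exprS ler_wpM2r// exprn_ge0.
by rewrite [leRHS]mulr_natl [leRHS]mulr2n lerD2r.
Qed.

(** After exchanging the sums, the inner one is geometric of ratio [b ^+ q], at least 2, hence at
    most twice its last term; that term restores the exponent [h + w]. *)
Lemma Qs_sum h q u : (0 < q <= h)%N ->
  \sum_(u <= v < U.+1) (b ^+ v) ^+ q * Qs (h - q) v <= 2 * Qs h u.
Proof.
move=> /andP[q0' qh].
under eq_bigr do rewrite /Qs mulr_sumr.
have -> : \sum_(u <= v < U.+1) \sum_(v <= v' < U.+1)
    (b ^+ v) ^+ q * ((b ^+ v') `^ ((h - q)%:R + w) * rh v') =
  \sum_(u <= v < U.+1) \sum_(u <= v' < U.+1 | (v <= v')%N)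
    (b ^+ v) ^+ q * ((b ^+ v') `^ ((h - q)%:R + w) * rh v').
  by rewrite big_nat [RHS]big_nat; apply: eq_bigr => v /andP[uv _];
    rewrite (big_nat_widenl v u)//; apply: eq_bigl => v'; rewrite andTb.
rewrite (exchange_big_dep xpredT)//= /Qs mulr_sumr; apply: ler_sum_nat => v' /andP[uv' v'U].
rewrite -mulr_suml !mulrA ler_wpM2r// -(powR_natD qh (ltW (bv0 v'))) mulrA.
rewrite ler_wpM2r ?powR_ge0//.
have bq2 : 2 <= b ^+ q.
  by apply: le_trans b_ge2 _; rewrite -[leLHS]expr1 ler_weXn2l.
rewrite -exprM mulnC exprM; apply: le_trans (sum_geo u v' bq2).
rewrite (@big_cat_nat _ _ _ v'.+1)//= ?leqW//.
rewrite [X in _ + X]big_nat_cond [X in _ + X]big1 ?addr0 => [|v]; last first.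
  by move=> /andP[/andP[v'v _] vv']; rewrite leqNgt v'v in vv'.
rewrite big_nat_cond [leRHS]big_nat_cond le_eqVlt; apply/orP; left; apply/eqP.
apply: eq_big => [v|v _]; last by rewrite -!exprM mulnC.
by rewrite andbT; case: (u <= v)%N => //=; rewrite ltnS andbb.
Qed.

(** With L = 1 + 3 * growth the summands are one constant times powers of L, and the factor 3 *
    growth = L - 1 closes the geometric series. *)
Lemma Cs_rec h :
  5 * kap `^ (h%:R + w) + 3 * growth * (\sum_(1 <= q < h.+1) kap ^+ q * Cs (h - q)) = Cs h.
Proof.
set L := 1 + 3 * growth.
have -> : \sum_(1 <= q < h.+1) kap ^+ q * Cs (h - q) =
    5 * kap `^ (h%:R + w) * \sum_(i < h) L ^+ i.
  rewrite big_add1/= big_mkord (reindex_inj rev_ord_inj)/= mulr_sumr.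
  apply: eq_bigr => i _; rewrite subnSK// subKn; last exact: ltnW.
  rewrite /Cs -/L mulrA mulrCA; congr (_ * _ * _).
  have hi : (h - i <= h)%N by exact: leq_subr.
  by rewrite -(powR_natD hi kap_ge0) subKn// ltnW.
have := subrX1 L h; rewrite (_ : L - 1 = 3 * growth) /L; last by rewrite addrC addKr.
rewrite -/L /Cs -/L => E.
by rewrite mulrCA -E; ring.
Qed.

Lemma card_layer Lam A J u bd v : state Lam A J u bd -> (u <= v <= U)%N ->
  #|layer A J u v :\: layer A J u v.+1|%:R <= kap * b ^+ v.
Proof.
move=> st /andP[uv vU]; apply: le_trans (card_cut vU (state_A st)).
rewrite ler_nat subset_leq_card//; apply/fintype.subsetP => i.
rewrite !inE /layer (ltnNge v u) uv/= inE => /andP[].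
have iJ : i \in (if (v <= u)%N then J else J :\: cut v A) -> i \in J.
  by case: ifP => // _; rewrite inE => /andP[].
by move=> + /iJ iJ'; rewrite iJ' andbT negbK.
Qed.

(** A value of [Lam] is its value on the centred function plus [lam1] times the mean. The centred
    part is telescoped over the layers ([a2]); in the mean, [J] is compared with the whole field
    ([a1]). The induction is on [h], since each extracted point uses up one derivative and one unit
    of the budget. *)
Lemma approx_state h Lam A J u bd : (size A + h <= k.+1)%N ->
  state Lam A J u bd ->
  approx h (fun g => Lam (fun t => g 0%N (total J t))) (bd * Cs h * Qs h u).
Proof.
elim/ltn_ind: h Lam A J u bd => h IH Lam A J u bd Ah st.
have bd0 := state_bd st; have uU := state_u st.
set e := h%:R + w.
have e0 : 0 < e by rewrite ltr_wpDl.
have Ae : (size A)%:R + e <= q0.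
  rewrite /e addrA -natrD /q0 natr1; apply: lerD => //.
  by rewrite ler_nat.
have /andP[_ er] := deg_le Ae (ltW e0).
have e0r : 0 <= e <= r by rewrite ltW.
have IHq q B Lam' A' J' u' : (0 < q <= h)%N -> size B = q -> A' = A ++ B ->
    state Lam' A' J' u' (growth * bd) ->
    approx (h - q) (fun g => Lam' (fun t => g 0%N (total J' t)))
      (growth * bd * Cs (h - q) * Qs (h - q) u').
  move=> /andP[q1 qh] sB AE st'; apply: IH st'.
    by rewrite ltn_subrL q1 (leq_trans q1 qh).
  by rewrite AE size_cat sB -addnA subnKC.
have KbdQ q v : 0 <= growth * bd * Cs (h - q) * Qs (h - q) v.
  by apply: mulr_ge0 (Qs_ge0 _ _); apply: mulr_ge0 (Cs_ge0 _); exact: mulr_ge0 growth_ge0 bd0.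
have sAB q B : (0 < q <= h)%N -> size B = q -> (size (A ++ B) <= k.+1)%N.
  move=> /andP[_ qh] sB; apply: leq_trans Ah.
  by rewrite size_cat sB leq_add2l.
pose lam1 := Lam (fun=> 1).
have lam1_le : `|lam1| <= bd * rh u.
  have := state_bound st (lexx 0) _ (of_degree_cst J 1).
  rewrite addr0 normr1 mulr1; apply.
  by rewrite (le_trans _ Ae)// lerDl ltW.
pose Psi Z := lam1 * mean P Z.
have a1 : approx h (fun g => Psi (fun t => g 0%N (total [set: D]%SET t)) -
    Psi (fun t => g 0%N (total J t)))
    (2 * bd * rh u * #|[set: D]%SET :\: J|%:R `^ e + \sum_(1 <= q < h.+1)
       #|[set: D]%SET :\: J|%:R ^+ q * (growth * bd * Cs (h - q) * Qs (h - q) u)).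
  apply: approx_taylor => //.
  - move=> x Z V aZ aV; rewrite /Psi mulrCA -mulrDr; congr (_ * _).
    have iZ := admissible_intg e0r aZ; have iV := admissible_intg e0r aV.
    by rewrite -(meanZ x iZ) -meanD//; exact: intgZ.
  - move=> k' Z dZ; have [_ h2] := of_degree_mean e0r dZ.
    rewrite normrM; apply: le_trans (ler_pM (normr_ge0 _) (normr_ge0 _) lam1_le h2) _.
    by rewrite le_eqVlt; apply/orP; left; apply/eqP; ring.
  - move=> q B qh sB BJ; apply: (IHq q B (fun Z => lam1 *
      mean P (fun t => prod_cX B t * Z t)) _ J u qh sB erefl).
    by apply: state_restart => //; exact: sAB qh sB.
have a2 v : (u <= v <= U)%N ->
    approx h (fun g => Lam (hat (fun t => g 0%N (total (layer A J u v) t))) -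
      Lam (hat (fun t => g 0%N (total (layer A J u v.+1) t))))
    (3 * bd * rh v * #|layer A J u v :\: layer A J u v.+1|%:R `^ e +
     \sum_(1 <= q < h.+1) #|layer A J u v :\: layer A J u v.+1|%:R ^+ q *
       (growth * bd * Cs (h - q) * Qs (h - q) v)).
  move=> uvU; apply: (@approx_taylor _ _ _ (fun Z => Lam (hat Z))) => //.
  - exact: layer_anti.
  - move=> x Z V aZ aV; apply: (Lam_hat_lin st x (ltW e0) Ae).
      by apply: admissible_sub aZ; exact: layer_sub.
    by apply: admissible_sub aV; exact: layer_sub.
  - move=> k' Z dZ; apply: le_trans (Lam_hat_bound st uvU (ltW e0) Ae dZ) _.
    by rewrite mulrAC.
  - move=> q B qh sB BJ.
    apply: (IHq q B (fun Z => Lam (hat (fun t => prod_cX B t * Z t))) _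
      (layer A J u v.+1) v qh sB erefl).
    by apply: state_extract => //; exact: sAB qh sB.
(* The one coefficient created at this level: [lam1], in front of the mean of the undifferentiated
   function of the full sum. *)
have a0 : approx h (fun g => Psi (fun t => g 0%N (total [set: D]%SET t))) 0.
  exists (fun j => if j == 0%N then lam1 else 0) => g H jg.
  rewrite big_ord_recl/= big1 => [|i _]; last by rewrite mul0r.
  by rewrite addr0 subrr normr0 mulr0.
have iotaP v : v \in index_iota u U.+1 -> (u <= v <= U)%N.
  by rewrite mem_index_iota ltnS.
have a3 := approx_sum (fun v vs => a2 v (iotaP v vs)).
have aN := approxZ (-1) a1.
have := approxD (approxD a0 aN) a3.
apply: (fun Hle Heq Happ => approx_le Hle (eq_approx Heq Happ)); last first.
  move=> g H jg; have aJ := admissible_jet J er jg.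
  have tel (F : nat -> R) : \sum_(v <- index_iota u U.+1) (F v - F v.+1) = F u - F U.+1.
    rewrite -[RHS]opprB -(telescope_sumr F (leqW uU)) -sumrN.
    by apply: eq_bigr => v _; rewrite opprB.
  rewrite (tel (fun v => Lam (hat (fun t => g 0%N (total (layer A J u v) t))))).
  (* The telescoping ends with a function of the empty sum; this is a constant, and centring
     annihilates it. *)
  have -> : layer A J u U.+1 = finset.set0.
    by rewrite /layer ltnNge uU/= /cut ltnn finset.setDT.
  have -> : layer A J u u = J by rewrite /layer leqnn.
  have -> : hat (fun t => g 0%N (total finset.set0 t)) = fun=> 0.
    apply/funext => t; rewrite /hat (eq_mean P (Z := fun=> g 0%N 0)).
      by rewrite mean_cst /total big_set0 subrr.
    by move=> s; rewrite /total big_set0.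
  have -> : Lam (fun=> 0) = 0.
    have := state_bound st (ltW e0) Ae (of_degree_raise (lexx 0) (ltW e0) er (of_degree_cst J 0)).
    by rewrite normr0 !mulr0 mul0r normr_le0 => /eqP.
  rewrite (Lam_hat st (ltW e0) Ae aJ) /Psi mulN1r -/lam1.
  ring.
rewrite add0r normrN1 mul1r.
have powB (n : R) v : 0 <= n -> n <= kap * b ^+ v ->
    rh v * n `^ e <= kap `^ e * ((b ^+ v) `^ e * rh v).
  move=> n0 nv; rewrite mulrA mulrC ler_wpM2r// -powRM ?(ltW (bv0 v))//.
  by apply: ge0_ler_powR; rewrite ?nnegrE ?(ltW e0)// (le_trans n0).
have powN (n : R) q v : 0 <= n -> n <= kap * b ^+ v ->
    n ^+ q <= kap ^+ q * (b ^+ v) ^+ q.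
  by move=> n0 nv; rewrite -exprMn lerXn2r ?nnegrE// (le_trans n0).
have nu : #|[set: D]%SET :\: J|%:R <= kap * b ^+ u.
  apply: le_trans (card_cut uU (state_A st)); rewrite ler_nat subset_leq_card//.
  by rewrite finset.setTD; exact: state_J st.
have nv v : (u <= v <= U)%N -> _ := fun h' => card_layer st h'.
have Tu : (b ^+ u) `^ e * rh u <= Qs h u.
  rewrite /Qs big_ltn ?ltnS// lerDl; apply: sumr_ge0 => v _.
  by rewrite mulr_ge0 ?powR_ge0.
have ke0 : 0 <= kap `^ e by exact: powR_ge0.
set S := \sum_(1 <= q < h.+1) kap ^+ q * Cs (h - q).
have KQ0 : 0 <= growth * bd by exact: mulr_ge0 growth_ge0 bd0.
have E1 : 2 * bd * rh u * #|[set: D]%SET :\: J|%:R `^ e <=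
    2 * bd * (kap `^ e * Qs h u).
  rewrite -mulrA ler_wpM2l ?mulr_ge0//; apply: le_trans (powB _ u _ nu) _ => //.
  by rewrite ler_wpM2l.
have E2 : \sum_(1 <= q < h.+1) #|[set: D]%SET :\: J|%:R ^+ q *
    (growth * bd * Cs (h - q) * Qs (h - q) u) <= growth * bd * (S * Qs h u).
  rewrite /S mulr_suml mulr_sumr; apply: ler_sum_nat => q /andP[q1 qh].
  have E x y z t : x * (y * z * t) = y * (z * (x * t)) :> R by ring.
  rewrite E [kap ^+ q * _]mulrC -(mulrA (Cs _)); apply: ler_wpM2l KQ0 _ _ _.
  apply: ler_wpM2l (Cs_ge0 _) _ _ _.
  apply: le_trans (_ : kap ^+ q * ((b ^+ u) ^+ q * Qs (h - q) u) <= _).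
    by rewrite mulrA; apply: ler_wpM2r (Qs_ge0 _ _) _ _ _; exact: powN.
  by apply: ler_wpM2l (Qs_pow _ _); rewrite ?exprn_ge0.
have E3 : \sum_(u <= v < U.+1) 3 * bd * rh v *
    #|layer A J u v :\: layer A J u v.+1|%:R `^ e <= 3 * bd * (kap `^ e * Qs h u).
  rewrite /Qs !mulr_sumr; apply: ler_sum_nat => v uvU; rewrite -mulrA.
  by apply: ler_wpM2l; [rewrite mulr_ge0|apply: powB => //; exact: nv].
have E4 : \sum_(u <= v < U.+1) \sum_(1 <= q < h.+1)
    #|layer A J u v :\: layer A J u v.+1|%:R ^+ q *
       (growth * bd * Cs (h - q) * Qs (h - q) v) <= growth * bd * (S * (2 * Qs h u)).
  rewrite exchange_big/= /S mulr_suml mulr_sumr; apply: ler_sum_nat => q qh.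
  have E x y z t : x * (y * z * t) = y * (z * (x * t)) :> R by ring.
  rewrite [kap ^+ q * _]mulrC -(mulrA (Cs _)).
  apply: le_trans (_ : growth * bd * (Cs (h - q) * (kap ^+ q *
    (\sum_(u <= v < U.+1) (b ^+ v) ^+ q * Qs (h - q) v))) <= _); last first.
    apply: ler_wpM2l KQ0 _ _ _; apply: ler_wpM2l (Cs_ge0 _) _ _ _.
    by apply: ler_wpM2l; [rewrite exprn_ge0|exact: Qs_sum].
  rewrite !mulr_sumr; apply: ler_sum_nat => v uvU; rewrite E.
  apply: ler_wpM2l KQ0 _ _ _; apply: ler_wpM2l (Cs_ge0 _) _ _ _.
  by rewrite mulrA; apply: ler_wpM2r (Qs_ge0 _ _) _ _ _; apply: powN => //; exact: nv.
(* The remainders of [a1] and [a2] contribute 2 + 3 = 5, the recursive terms 1 + 2 = 3 with the 2 of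
   [Qs_sum]: these are the constants of [Cs_rec]. *)
rewrite big_split/=; apply: le_trans (lerD (lerD E1 E2) (lerD E3 E4)) _.
have E x y s t z : 2 * x * (y * t) + z * x * (s * t) + (3 * x * (y * t) + z * x * (s * (2 * t)))
  = x * (5 * y + 3 * z * s) * t :> R by ring.
by rewrite E Cs_rec.
Qed.

Hypothesis rh_0 : rh 0%N = 1.

Let K4 : 4 <= growth.
Proof.
apply: (@le_trans _ _ (21 * 1)); first by rewrite mulr1 ler_nat.
by rewrite /growth ler_pM2l.
Qed.

(** No gap has been crossed yet, so no decay can be claimed at scale 0: this is the purpose of
    [rh_0]. *)
Lemma state_init i : state (fun Z => mean P (fun t => cX i t * Z t)) [:: i]
  [set: D]%SET 0 growth.
Proof.
have splitA e : (size [:: i])%:R + e = 1 + e :> R by [].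
have er e : 0 <= e -> 1 + e <= q0 -> 0 <= 1 + e <= r.
  by move=> e0 h; rewrite addr_ge0//= (le_trans h).
have aY e Z : 0 <= e -> 1 + e <= q0 -> admissible [set: D]%SET e Z ->
    intg P (fun t => cX i t * Z t).
  move=> e0 h aZ; have /andP[h0 hr] := er _ e0 h.
  have aP : admissible [set: D]%SET ((size [:: i])%:R + e) (fun t => prod_cX [:: i] t * Z t).
    by apply: admissibleM => // j _; rewrite finset.in_setT.
  apply: eq_intg (admissible_intg (er _ e0 h) aP) => t.
  by rewrite prod_cX_cons prod_cX_nil mulr1.
split => //.
- by rewrite finset.setCT finset.sub0set.
- exact: growth_ge0.
- move=> e x Z V e0; rewrite splitA => h aZ aV.
  have iZ := aY _ _ e0 h aZ; have iV := aY _ _ e0 h aV.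
  rewrite -(meanZ x iZ) -meanD//; last exact: intgZ.
  by apply: eq_mean => t; ring.
- move=> e k' Z e0; rewrite splitA => h dZ; have k0 := of_degree_ge0 dZ.
  have /andP[h0 hr] := er _ e0 h.
  have dYZ := of_degreeM (finset.in_setT i) e0 hr dZ.
  have [_ h2] := of_degree_mean (er _ e0 h) dYZ.
  apply: le_trans h2 _; rewrite rh_0 mulr1 mulrA ler_wpM2r//.
  by apply: le_trans K4; rewrite -natrM.
- move=> v S e k' Z vU e0 SJ ASe AS dZ; have k0 := of_degree_ge0 dZ.
  rewrite (_ : (fun t => _) = fun t => prod_cX ([:: i] ++ S) t * hat Z t); last first.
    by apply/funext => t; rewrite prod_cX_cat prod_cX_cons prod_cX_nil mulr1 mulrA.
  apply: le_trans (cov_far vU AS e0 ASe dZ) _.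
  have h : cov_const <= growth by apply: le_trans cov_const_growth; rewrite lerDr.
  by rewrite ler_wpM2r// ler_wpM2r.
Qed.

Local Notation S := (total [set: D]%SET).

Let kw_r : 1 + (k%:R + w) <= r.
Proof. by rewrite addrA [1 + _]addrC; exact: q0r. Qed.

Let kw_ge0 : 0 <= k%:R + w. Proof. by rewrite addr_ge0// ltW. Qed.

Lemma intg_cX_jet i H g : jet k H g -> intg P (fun t => cX i t * g 0%N (S t)).
Proof.
move=> jg; have aP : admissible [set: D]%SET (1 + (k%:R + w))
    (fun t => prod_cX [:: i] t * g 0%N (S t)).
  apply: (@admissibleM _ _ _ [:: i]) => //; first by move=> j _; rewrite finset.in_setT.
  by apply: admissible_jet jg; rewrite (le_trans _ kw_r)// lerDr.
apply: eq_intg (admissible_intg _ aP) => [t|].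
  by rewrite prod_cX_cons prod_cX_nil mulr1.
by rewrite addr_ge0.
Qed.

Lemma intg_total_jet H g : jet k H g -> intg P (fun t => S t * g 0%N (S t)).
Proof.
move=> jg; have := @intg_sum _ _ _ P _ (enum [set: D]%SET) xpredT
  (fun i t => cX i t * g 0%N (S t)) (fun i _ => intg_cX_jet i jg).
by apply: eq_intg => t; rewrite /total big_distrl/= big_enum.
Qed.

Lemma intg_jet j H g : (j <= k)%N -> jet k H g -> intg P (fun t => g j (S t)).
Proof.
move=> jk jg.
have h : (k - j)%:R + w <= r.
  rewrite (le_trans _ kw_r)// (le_trans _ (_ : k%:R + w <= _))//.
    by rewrite lerD2r ler_nat leq_subr.
  by rewrite lerDr.
have := admissible_jet [set: D]%SET h (jet_shift jk jg).
by apply: admissible_intg; rewrite h addr_ge0// ltW.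
Qed.

Lemma intg_total_exp j : (j <= k.+1)%N -> intg P (fun t => S t ^+ j).
Proof.
move=> jk; have jr : j%:R <= r.
  apply: le_trans kw_r; rewrite addrA; apply: le_trans (_ : k.+1%:R <= _).
    by rewrite ler_nat.
  by rewrite -natr1 [_ + 1]addrC lerDl ltW.
by have := admissible_total_exp [set: D]%SET jr; apply: admissible_intg; rewrite jr ler0n.
Qed.

Lemma approx_total :
  approx k (fun g => mean P (fun t => total [set: D]%SET t * g 0%N (total [set: D]%SET t)))
    ((#|` D|%fset)%:R * (growth * Cs k * Qs k 0)).
Proof.
apply: (@approx_le _ _ (\sum_(i <- enum [set: D]%SET) growth * Cs k * Qs k 0)).
  by rewrite big_const_seq count_predT iter_addr_0 -cardE finset.cardsT cardfE mulr_natl.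
apply: (@eq_approx _ (fun g => \sum_(i <- enum [set: D]%SET)
    mean P (fun t => cX i t * g 0%N (total [set: D]%SET t)))).
  move=> g H jg; rewrite -mean_sum => [|i _]; last exact: intg_cX_jet jg.
  by apply: eq_mean => t; rewrite /total big_distrl/= big_enum.
apply: approx_sum => i _.
exact: (approx_state _ (state_init i)).
Qed.

End field.

(** * Identification of the cumulants *)

Section formal_log.
Context {R : realType}.
Implicit Types p s : {poly R}.

Lemma coef_exp_eq p s n q : (forall i, (i <= n)%N -> p`_i = s`_i) ->
  forall i, (i <= n)%N -> (p ^+ q)`_i = (s ^+ q)`_i.
Proof.
move=> ps; elim: q => [|q ih] i ii; first by rewrite !expr0.
rewrite !exprS !coefM; apply: eq_bigr => j _; rewrite ps ?ih//.
  by rewrite (leq_trans _ ii)// leq_subr.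
by rewrite (leq_trans _ ii)// -ltnS.
Qed.

Lemma coef_exp_lt p q i : p`_0 = 0 -> (i < q)%N -> (p ^+ q)`_i = 0.
Proof.
move=> p0; elim: q i => // q ih i iq; rewrite exprS coefM big1// => -[j ji] _ /=.
case: j ji => [|j] ji; first by rewrite p0 mul0r.
rewrite ih ?mulr0// subnS; case: i iq ji => // i iq ji.
by rewrite subSn// (leq_ltn_trans (leq_subr _ _)).
Qed.

(* (log p)' p = p', up to the truncation order. *)
Lemma coef_log_deriv p n l : p`_0 = 1 -> (l < n)%N ->
  \sum_(j < l.+1) j.+1%:R *
    (\sum_(1 <= q < n.+1) ((-1) ^+ q.+1 / q%:R) *: (p - 1) ^+ q)`_j.+1 * p`_(l - j) =
  l.+1%:R * p`_l.+1.
Proof.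
move=> p0 ln; set u := p - 1; set L := \sum_(_ <= _ < _) _.
have u0 : u`_0 = 0 by rewrite coefB coefC p0 subrr.
have pE : p = 1 - (- u) by rewrite opprK addrC subrK.
(* Differentiating the truncated logarithm gives a truncated geometric series in [- u]. *)
have L' : L^`() = (\sum_(i < n) (- u) ^+ i) * u^`().
  rewrite /L big_add1/= big_mkord linear_sum/= mulr_suml; apply: eq_bigr => i _.
  rewrite derivZ deriv_exp/= -scalerMnr scalerMnl -[(_ / _) *+ _]mulr_natr divfK ?pnatr_eq0//.
  by rewrite -[in RHS]scaleN1r exprZn -scalerAl mulrC !exprS mulrA mulrNN !mul1r.
have pu : u^`() = p^`() by rewrite /u derivB derivC subr0.
(* Multiplication by p = 1 - (-u) telescopes the series; the leftover has order at least n > l, as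
   [u] has no constant term. *)
have E : p * L^`() = p^`() - (- u) ^+ n * p^`().
  rewrite L' pu mulrA [X in X * \sum_(_ < _) _]pE -[X in X * \sum_(_ < _) _]opprB mulNr.
  by rewrite -subrX1 mulNr mulrBl mul1r opprB.
transitivity ((p * L^`())`_l).
  rewrite mulrC coefM; apply: eq_bigr => j _; rewrite coef_deriv.
  by rewrite -[L`_j.+1 *+ _]mulr_natl.
rewrite E coefB coefM big1 ?subr0 => [|j _]; first by rewrite coef_deriv mulr_natl.
rewrite coef_exp_lt ?mul0r//; first by rewrite coefN u0 oppr0.
by rewrite (leq_trans _ ln).
Qed.

End formal_log.

Section cumulant_identification.
Context {disp : measure_display} {Omega : measurableType disp} {R : realType}.
Variables (P : probability Omega R) (W : Omega -> R) (k : nat) (w : R).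
Hypothesis W_intg : forall j, (j <= k.+1)%N -> intg P (fun t => W t ^+ j).
Hypothesis W_mean : mean P W = 0.

Let nmoment j : R := moment P W j / j`!%:R.

Let momentE j : moment P W j = mean P (fun t => W t ^+ j). Proof. by []. Qed.

Let nmoment0 : nmoment 0 = 1.
Proof.
rewrite /nmoment momentE (eq_mean P (Z := fun=> 1)) => [|t]; last by rewrite expr0.
by rewrite mean_cst fact0 divr1.
Qed.

Let nmoment1 : nmoment 1 = 0.
Proof.
rewrite /nmoment momentE (eq_mean P (Z := W)) => [|t]; last by rewrite expr1.
by rewrite W_mean mul0r.
Qed.

Let coef_moment J i : (i <= J)%N -> (moment_poly P W J)`_i = nmoment i.
Proof. by move=> iJ; rewrite /moment_poly coef_poly ltnS iJ. Qed.

Let coef_m1 J i : (i <= J)%N -> (moment_poly P W J - 1)`_i = nmoment i - (i == 0%N)%:R.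
Proof. by move=> iJ; rewrite coefB coef_moment// coef1. Qed.

(** The truncation order may be raised: neither powers nor moments of order beyond [j] reach the
    coefficient of order [j]. Several cumulants can thus be read in one polynomial. *)
Lemma cumulant_coef J j : (0 < j <= J)%N -> cumulant P W j = j`!%:R *
  (\sum_(1 <= q < J.+1) ((-1) ^+ q.+1 / q%:R) *: (moment_poly P W J - 1) ^+ q)`_j.
Proof.
move=> /andP[j0 jJ]; rewrite /cumulant; congr (_ * _).
rewrite !coef_sum [in RHS](@big_cat_nat _ _ _ j.+1)//= ?ltnS//.
rewrite [X in _ = _ + X]big_nat_cond [X in _ = _ + X]big1 ?addr0 => [|q]; last first.
  rewrite andbT => /andP[jq _]; rewrite coefZ coef_exp_lt ?mulr0//.
  by rewrite coef_m1// nmoment0 subrr.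
apply: eq_bigr => q _; rewrite !coefZ; congr (_ * _).
apply: (@coef_exp_eq _ _ _ j) => // i ij.
by rewrite !coef_m1// (leq_trans ij).
Qed.

(** The classical recursion of the moment of order l + 1 as a binomial convolution of cumulants with
    lower moments, divided by l!. *)
Lemma cumulant_rec l : (l <= k)%N ->
  \sum_(j < l.+1) cumulant P W j.+1 / j`!%:R * nmoment (l - j) =
  l.+1%:R * nmoment l.+1.
Proof.
move=> lk; rewrite -(@coef_moment l.+1)// -(@coef_log_deriv _ (moment_poly P W l.+1) l.+1)//; last first.
  by rewrite coef_moment.
apply: eq_bigr => j _; rewrite (@cumulant_coef l.+1); last exact: ltn_ord.
rewrite coef_moment; last by rewrite (leq_trans (leq_subr _ _)).
congr (_ * _); rewrite factS natrM mulrAC; congr (_ * _).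
by rewrite mulfK// pnatr_eq0 -lt0n fact_gt0.
Qed.

(** The successive derivatives of x^l / l!. With this normalization the means in the expansion are
    the [nmoment (l - j)] of [cumulant_rec]. *)
Definition monomial_jet (l j : nat) (x : R) : R :=
  if (j <= l)%N then x ^+ (l - j) / (l - j)`!%:R else 0.

Lemma monomial_jetP l : 0 < w -> (l <= k)%N -> jet w k 0 (monomial_jet l).
Proof.
move=> w0 lk; split => // [j jk|j x y jk].
  rewrite /monomial_jet; case: leqP => // _.
  by apply: measurable_funM => //; exact: measurable_funX.
rewrite mul0r normr_le0 subr_eq0; apply/eqP; rewrite /monomial_jet.
have [jl|lj] := leqP j l; last first.
  rewrite big1// => q _; rewrite leqNgt (leq_trans lj (leq_addr _ _)).
  by rewrite mulr0.
set n := (l - j)%N; have nk : (n <= k - j)%N by rewrite leq_sub2r.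
rewrite -(big_mkord xpredT (fun q => (y - x) ^+ q / q`!%:R *
  (if (j + q <= l)%N then x ^+ (l - (j + q)) / (l - (j + q))`!%:R else 0))).
rewrite (@big_cat_nat _ _ _ n.+1)//=.
rewrite [X in _ = _ + X]big_nat_cond [X in _ = _ + X]big1 ?addr0 => [|q]; last first.
  rewrite andbT => /andP[nq _]; rewrite ifF ?mulr0//.
  by rewrite leqNgt -ltn_subLR// -/n nq.
(* For a monomial the Taylor formula is the binomial theorem, without remainder. *)
rewrite -[in LHS](subrK x y) [y - x + x]addrC exprDn big_mkord mulr_suml.
apply: eq_bigr => -[q qn] _ /=; rewrite ltnS in qn.
have jq : (j + q <= l)%N by rewrite -leq_subRL.
rewrite jq subnDA -/n.
have f0 m : m`!%:R != 0 :> R by rewrite pnatr_eq0 -lt0n fact_gt0.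
have : ('C(n, q) * (q`! * (n - q)`!))%:R = n`!%:R :> R by rewrite bin_fact.
rewrite !natrM -mulr_natr => <-.
have b0 : 'C(n, q)%:R != 0 :> R by rewrite pnatr_eq0 -lt0n bin_gt0.
by field; rewrite b0 !f0.
Qed.

(* Monomials are jets with H = 0: on them the expansion is exact, which
   determines the coefficients recursively. *)
Lemma approx_cumulant eps : 0 < w ->
  (exists c : nat -> R, forall g H, jet w k H g ->
    `|mean P (fun t => W t * g 0%N (W t)) -
      \sum_(j < k.+1) c j * mean P (fun t => g j (W t))| <= H * eps) ->
  forall g H, jet w k H g ->
    `|mean P (fun t => W t * g 0%N (W t)) -
      \sum_(1 <= j < k.+1) cumulant P W j.+1 / j`!%:R * mean P (fun t => g j (W t))|
      <= H * eps.
Proof.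
move=> w0 [c hc] g H jg.
have rec l : (l <= k)%N -> \sum_(j < l.+1) c j * nmoment (l - j) = l.+1%:R * nmoment l.+1.
  move=> lk; have := hc _ _ (monomial_jetP w0 lk); rewrite mul0r normr_le0 subr_eq0.
  have f0 m : m`!%:R != 0 :> R by rewrite pnatr_eq0 -lt0n fact_gt0.
  have mZ i m : (i <= k.+1)%N -> mean P (fun t => m * W t ^+ i) = m * moment P W i.
    by move=> ik; rewrite meanZ//; exact: W_intg.
  move=> /eqP; rewrite (eq_mean P (Z := fun t => l`!%:R^-1 * W t ^+ l.+1)); last first.
    by move=> t; rewrite /monomial_jet leq0n subn0 exprS mulrA mulrC.
  rewrite mZ ?ltnS// => E.
  have -> : l.+1%:R * nmoment l.+1 = l`!%:R^-1 * moment P W l.+1.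
    rewrite /nmoment factS natrM; set x : R := l.+1%:R; set y : R := _`!%:R.
    have x0 : x != 0 by rewrite pnatr_eq0.
    have y0 : y != 0 by exact: f0.
    by clearbody x y; field; rewrite x0 y0.
  rewrite E -(big_mkord xpredT (fun j => c j * nmoment (l - j))).
  rewrite -(big_mkord xpredT (fun j => c j * mean P (fun t => monomial_jet l j (W t)))).
  rewrite [in RHS](@big_cat_nat _ _ _ l.+1)//= ?ltnS//.
  rewrite [X in _ = _ + X]big_nat_cond [X in _ = _ + X]big1 ?addr0 => [|j]; last first.
    rewrite andbT => /andP[lj _]; rewrite (eq_mean P (Z := fun=> 0)) => [|t].
      by rewrite mean_cst mulr0.
    by rewrite /monomial_jet leqNgt lj.
  apply: eq_big_nat => j /andP[_ jl]; congr (_ * _).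
  rewrite (eq_mean P (Z := fun t => (l - j)`!%:R^-1 * W t ^+ (l - j))); last first.
    by move=> t; rewrite /monomial_jet -ltnS jl mulrC.
  rewrite mZ; first exact: mulrC.
  by apply: leq_trans (leq_subr _ _) _; exact: leqW.
(* Two solutions of one triangular recursion whose diagonal entries are [nmoment 0 = 1] coincide. *)
have cE j : (j <= k)%N -> c j = cumulant P W j.+1 / j`!%:R.
  elim/ltn_ind: j => j IH jk.
  have := rec j jk; rewrite -(cumulant_rec jk) !big_ord_recr/= subnn nmoment0 !mulr1.
  rewrite (eq_bigr (fun i : 'I_j => cumulant P W i.+1 / i`!%:R * nmoment (j - i))).
    by move/addrI.
  by move=> i _; rewrite IH// (leq_trans (ltnW (ltn_ord i))).
(* This is where [W] being centred enters, and it lets the sum start at 1. *)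
have c0 : c 0%N = 0.
  have := rec 0%N (leq0n k); rewrite big_ord1 subn0 nmoment0 nmoment1 mulr1 mulr0.
  by [].
have := hc g H jg; rewrite -(big_mkord xpredT (fun j => c j * mean P (fun t => g j (W t)))).
rewrite big_ltn// c0 mul0r add0r.
rewrite (eq_big_nat _ _ (F2 := fun j => cumulant P W j.+1 / j`!%:R * mean P (fun t => g j (W t))))//.
by move=> j /andP[_ jk]; rewrite cE.
Qed.

End cumulant_identification.

(** * Hoelder functions *)

Section holder_jets.
Context {R : realType}.
Implicit Types (f : R -> R) (F : nat -> R -> R) (w x y z : R).

Lemma is_derive_taylor_term (c x z : R) q :
  is_derive z 1 (fun s => (s - x) ^+ q.+1 / q.+1`!%:R * c) ((z - x) ^+ q / q`!%:R * c).
Proof.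
have f0 m : m`!%:R != 0 :> R by rewrite pnatr_eq0 -lt0n fact_gt0.
have q0 : q.+1%:R != 0 :> R by rewrite pnatr_eq0.
have h : is_derive z 1 (fun s : R => (s - x) ^+ q.+1) (q.+1%:R * (z - x) ^+ q).
  have h1 : is_derive z 1 (fun s : R => s - x) 1 by apply: is_derive_eq; rewrite subr0.
  have h2 := is_deriveX q.+1 h1.
  rewrite (_ : (fun s => _) = (fun s => s - x) ^+ q.+1); last first.
    by apply/funext => s; rewrite exprfctE.
  by apply: is_derive_eq h2 _; rewrite /GRing.scale/= mulr1.
have := is_deriveZ (c / q.+1`!%:R) h.
set G := (X in is_derive _ _ X _ -> _).
rewrite (_ : G = fun s => (s - x) ^+ q.+1 / q.+1`!%:R * c); last first.
  by apply/funext => s; rewrite /G /= /GRing.scale/= mulrC mulrAC mulrA.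
move=> h2; apply: is_derive_eq h2 _; rewrite /GRing.scale/= factS natrM.
have := f0 q; have := q0; set a : R := q.+1%:R; set b : R := q`!%:R.
by clearbody a b => a0 b0; field; rewrite a0 b0.
Qed.

(** The remainder vanishes at [x] and its derivative is the remainder of the next function with one
    order less, so the mean value theorem gains a factor |y - x|. No factorial is gained in the
    constant, which keeps the same [H] at all orders. *)
Lemma taylor_holder F k H w : 0 < w -> 0 <= H ->
  (forall j x, (j < k)%N -> is_derive x 1 (F j) (F j.+1 x)) ->
  (forall x y, `|F k y - F k x| <= H * `|y - x| `^ w) ->
  forall i j x y, (j + i = k)%N ->
    `|F j y - \sum_(q < i.+1) (y - x) ^+ q / q`!%:R * F (j + q)%N x| <=
    H * `|y - x| `^ (i%:R + w).
Proof.
move=> w0 H0 dF hF; elim=> [|i IH] j x y jik.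
  rewrite big_ord1 addn0 expr0 fact0 divr1 mul1r add0r.
  by move: jik; rewrite addn0 => ->; exact: hF.
have jk : (j < k)%N by rewrite -jik -addSnnS leq_addr.
have {}jik : (j.+1 + i = k)%N by rewrite addSnnS.
pose phi s := F j s - \sum_(q < i.+2) (s - x) ^+ q / q`!%:R * F (j + q)%N x.
pose dphi s := F j.+1 s - \sum_(q < i.+1) (s - x) ^+ q / q`!%:R * F (j.+1 + q)%N x.
have dphiP (s : R) : is_derive s (1 : R) (phi : R -> R) (dphi s).
  pose Tq (q : 'I_i.+1) s := (s - x) ^+ q.+1 / q.+1`!%:R * F (j + q.+1)%N x.
  have -> : phi = (F j - cst (F j x)) - \sum_q Tq q.
    apply/funext => t; rewrite /phi big_ord_recl expr0 fact0 divr1 mul1r addn0.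
    rewrite opprD addrA !fctE fct_sumE.
    by congr (_ - _); apply: eq_bigr => q _.
  rewrite /dphi -[F j.+1 s]subr0; apply: is_deriveB.
    by apply: is_deriveB; exact: dF.
  apply: is_derive_sum => q; rewrite /Tq addSnnS.
  exact: is_derive_taylor_term.
have phix : phi x = 0.
  rewrite /phi big_ord_recl expr0 fact0 divr1 mul1r addn0 big1 => [|q _].
    by rewrite addr0 subrr.
  by rewrite subrr expr0n/= mul0r mul0r.
have cphi a b : {within `[a, b], continuous phi}.
  apply: continuous_subspaceT => s; apply: differentiable_continuous.
  by apply/derivable1_diffP; case: (dphiP s).
have bnd c : `|c - x| <= `|y - x| -> `|dphi c| <= H * `|y - x| `^ (i%:R + w).
  move=> cx; apply: le_trans (IH j.+1 x c jik) _; rewrite ler_wpM2l//.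
  by apply: ge0_ler_powR; rewrite ?nnegrE// addr_ge0// ltW.
have pw : `|y - x| `^ (i.+1%:R + w) = `|y - x| `^ (i%:R + w) * `|y - x|.
  rewrite -natr1 addrAC powRD ?powRr1//.
  have h : 0 < i%:R + w + 1 by rewrite addr_gt0// ltr_wpDl.
  by rewrite (gt_eqF h).
rewrite pw mulrA -/(phi y).
have [xy|yx|<-] := ltgtP x y; last first.
- by rewrite phix normr0 subrr normr0 mulr0.
- have [c cyx] := MVT yx (fun s _ => dphiP s) (cphi _ _).
  rewrite phix sub0r => /eqP; rewrite eqr_oppLR => /eqP ->.
  rewrite normrN normrM (distrC x y) ler_wpM2r// bnd//.
  move: cyx; rewrite in_itv/= => /andP[yc cx].
  by rewrite !ltr0_norm ?subr_lt0// lerN2 lerB// ltW.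
- have [c cxy] := MVT xy (fun s _ => dphiP s) (cphi _ _).
  rewrite phix subr0 => ->; rewrite normrM ler_wpM2r// bnd//.
  move: cxy; rewrite in_itv/= => /andP[xc cy].
  by rewrite !gtr0_norm ?subr_gt0// lerB// ltW.
Qed.

Lemma holder_seminormP k w f : (holder_seminorm k w f < +oo)%E ->
  0 < w -> 0 <= fine (holder_seminorm k w f) /\
  forall x y, `|derive1n k f y - derive1n k f x| <=
    fine (holder_seminorm k w f) * `|y - x| `^ w.
Proof.
move=> fin w0.
have ub x y : x != y -> ((`|derive1n k f x - derive1n k f y| / `|x - y| `^ w)%:E <=
    holder_seminorm k w f)%E.
  by move=> xy; apply: ereal_sup_ubound; exists (x, y).
have h0 : (0 <= holder_seminorm k w f)%E.
  apply: le_trans (ub 0 1 _); first by rewrite lee_fin divr_ge0// powR_ge0.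
  by rewrite eq_sym oner_eq0.
have fn : holder_seminorm k w f \is a fin_num by rewrite ge0_fin_numE.
split; first exact: fine_ge0.
move=> x y; have [->|xy] := eqVneq y x.
  by rewrite !subrr !normr0 powR0 ?gt_eqF// mulr0.
have := ub _ _ xy; rewrite -[X in (_ <= X)%E]fineK// lee_fin ler_pdivrMr//.
by rewrite powR_gt0// normr_gt0 subr_eq0.
Qed.

Lemma holder_jet k w f : 0 < w -> f \in holder_space k w ->
  jet w k (fine (holder_seminorm k w f)) (fun j => derive1n j f).
Proof.
move=> w0; rewrite inE => -[[df cf] fin].
have [H0 hH] := holder_seminormP fin w0.
have dF j x : (j < k)%N -> is_derive x 1 (derive1n j f) (derive1n j.+1 f x).
  move=> jk; split; first exact: df.
  by rewrite derive1nS derive1E.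
split => // [j jk|j x y jk].
  apply: continuous_measurable_fun.
  move: jk; rewrite leq_eqVlt => /orP[/eqP -> //|jk x].
  by apply: differentiable_continuous; apply/derivable1_diffP; exact: df.
by apply: taylor_holder dF hH _ _ _ _ _ => //; rewrite subnKC.
Qed.

End holder_jets.

(** * Counting, and summation over the scales *)

Section geometry.
Context {R : realType} {d : nat} {D : {fset 'rV[int]_d}}.
Implicit Types (A : seq D) (v : nat).

Lemma absz_lt_shift (x y : int) n : (`|x - y| < n)%N ->
  exists2 z : nat, (z < 2 * n)%N & y - x + n%:Z = z%:Z.
Proof.
move=> xy; have h : `|x - y| < n%:Z by rewrite -abszE ltz_nat.
move: h; rewrite ltr_norml => /andP[h1 h2].
have z0 : 0 <= y - x + n%:Z by lia.
exists `|(y - x + n%:Z)%R|%N; last by rewrite gez0_abs.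
by rewrite -ltz_nat gez0_abs//; lia.
Qed.

(** Coordinates relative to [i], shifted by [n], are natural numbers below [2 * n], which embeds the
    ball into a cube. *)
Lemma card_ball (i : D) n : (0 < n)%N ->
  (#|[set j : D | (maxdist (val i) (val j) < n)%N]%SET| <= (2 * n) ^ d)%N.
Proof.
move=> n0; set B := [set j | _]%SET.
pose phi (j : D) : {ffun 'I_d -> 'I_(2 * n).-1.+1} :=
  [ffun c => inord `|(val j ord0 c - val i ord0 c + n%:Z)%R|%N].
have inj : {in B &, injective phi}.
  move=> j j'; rewrite !inE => jB j'B /ffunP E.
  apply/val_inj/rowP => c; move: (E c); rewrite !ffunE => /(congr1 val)/=.
  have coord (s : D) : (maxdist (val i) (val s) < n)%N ->
      exists2 z : nat, (z < 2 * n)%N &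
        val s ord0 c - val i ord0 c + n%:Z = z%:Z.
    move=> sB; apply: absz_lt_shift; apply: leq_ltn_trans sB.
    exact: (leq_bigmax (F := fun c : 'I_d => `|(val i ord0 c - val s ord0 c)%R|%N) c).
  have [z zn zE] := coord _ jB; have [z' zn' zE'] := coord _ j'B.
  rewrite zE zE' !absz_nat !inordK ?prednK ?muln_gt0// => zz.
  move: zE; rewrite zz -zE' => /(addIr n%:Z)/(addIr _).
  by [].
rewrite -(card_in_imset inj); apply: leq_trans (max_card _) _.
by rewrite card_ffun !card_ord prednK ?muln_gt0.
Qed.

Lemma card_nearby v A : (#|nearby v A| <= size A * (2 ^ v.+1) ^ d)%N.
Proof.
elim: A => [|i A ih].
  by rewrite mul0n leqn0 cards_eq0; apply/eqP/setP => j; rewrite !inE.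
have -> : nearby v (i :: A) = ([set j : D | (maxdist (val i) (val j) < 2 ^ v)%N] :|: nearby v A)%SET.
  by apply/setP => j; rewrite !inE.
apply: leq_trans (leq_card_setU _ _) _; rewrite /= mulSn leq_add//.
by apply: leq_trans (card_ball _ _) _; rewrite ?expn_gt0// expnS.
Qed.

(* The scale at which a cube has about as many points as D. *)
Lemma exists_scale : (0 < d)%N -> exists U : nat,
  (#|` D|%fset <= (8 * 2 ^ U) ^ d)%N /\
  (2 ^ U <= (Num.truncn ((#|` D|%fset)%:R `^ (d%:R^-1) / 2 : R)).+1)%N.
Proof.
move=> d0; set N := #|` D|%fset.
have ex : exists U, (N <= (8 * 2 ^ U) ^ d)%N.
  exists N; apply: leq_trans (ltnW (ltn_expl N (ltnSn 1))) _.
  apply: leq_trans (leq_pmull _ (ltn0Sn 7)) _.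
  by rewrite -{1}(expn1 (8 * 2 ^ N)) leq_pexp2l// muln_gt0 expn_gt0.
(* Minimality yields the upper bound on [2 ^ U]; for [U = 0] that bound holds thanks to the
   successor in the statement. *)
have [U NU minU] := ex_minnP ex; exists U; split => //.
case: U NU minU => [|U] NU minU; first by rewrite expn0.
have NU' : ((8 * 2 ^ U) ^ d < N)%N.
  by rewrite ltnNge; apply/negP => /minU; rewrite ltnn.
apply: leqW; rewrite truncn_ge_nat; last by rewrite divr_ge0// powR_ge0.
rewrite ler_pdivlMr// natrX.
apply: (@le_trans _ _ ((((8 * 2 ^ U) ^ d)%:R : R) `^ d%:R^-1)); last first.
  apply: ge0_ler_powR; rewrite ?nnegrE ?ler0n ?invr_ge0//.
  by rewrite ler_nat ltnW.
rewrite natrX -powR_mulrn ?ler0n// -powRrM mulfV ?pnatr_eq0 -?lt0n//.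
rewrite powRr1 ?ler0n// natrM natrX exprS.
have : 0 <= 2 ^+ U :> R by rewrite exprn_ge0.
move=> h; lra.
Qed.

End geometry.

Section scaling.
Context {R : realType}.

Lemma jet_scale (w a H : R) h g : 0 < w -> 0 < a -> jet w h H g ->
  jet w h (a `^ (h%:R + w) * H) (fun j x => a ^+ j * g j (a * x)).
Proof.
move=> w0 a0 [H0 mg gT]; split => [|j jh|j x y jh].
- by rewrite mulr_ge0// powR_ge0.
- apply: measurable_funM => //; apply: measurableT_comp; first exact: mg.
  exact: measurable_funM.
have := gT j (a * x) (a * y) jh; rewrite -mulrBr normrM (gtr0_norm a0).
rewrite powRM ?(ltW a0)// => h1.
have ha : 0 < a ^+ j by rewrite exprn_gt0.
rewrite (_ : _ - _ = a ^+ j * (g j (a * y) -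
    \sum_(q < (h - j).+1) (a * (y - x)) ^+ q / q`!%:R * g (j + q)%N (a * x))); last first.
  rewrite mulrBr mulr_sumr; congr (_ - _); apply: eq_bigr => q _.
  by rewrite exprD exprMn; ring.
rewrite normrM (gtr0_norm ha) -(powR_natD w0 jh (ltW a0)).
rewrite (_ : _ * H * _ = a ^+ j *
  (H * (a `^ ((h - j)%:R + w) * `|y - x| `^ ((h - j)%:R + w)))); last by ring.
by rewrite ler_pM2l.
Qed.

End scaling.

Section scale_sums.
Context {R : realType}.

(** Scales with [2 ^ v <= 2 * m] form a geometric sum of order m^be. Beyond them, the term of scale
    V + 1 is charged to the integers from 2^V + 1 to 2^(V+1): there are 2^V of them, at least 2^(Vw)
    because [w <= 1], and this makes up for the exponent be - w in place of be. *)
Lemma Qs_le (d k U m L : nat) (w : R) (rh gam : nat -> R) :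
  let be := d%:R * (k%:R + w) in
  (0 < d)%N -> (0 < k)%N -> 0 < w -> w <= 1 -> (0 < m)%N ->
  (forall v, 0 <= rh v <= 1) ->
  (forall l, 0 <= gam l) ->
  (forall l l', (l <= l')%N -> gam l' <= gam l) ->
  (forall v, (0 < v <= U)%N -> rh v <= 2 * gam (2 ^ v)%N) ->
  (2 ^ U <= L)%N ->
  Qs w U (2 ^+ d) rh k 0 <= 2 * 2 `^ be *
    (m%:R `^ be + \sum_(m.+1 <= l < L.+1) l%:R `^ (be - w) * gam l).
Proof.
move=> be d0 k0 w0 w1 m0 rh01 gam0 gam_anti rh_gam UL.
have kw : 1 <= k%:R + w by rewrite (le_trans (_ : 1 <= k%:R)) ?ler1n// lerDl ltW.
have kwbe : k%:R + w <= be by rewrite ler_peMl ?ler1n// (le_trans _ kw).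
have be1 : 1 <= be by exact: le_trans kwbe.
have be0 : 0 <= be by exact: le_trans be1.
have bew : 0 <= be - w by rewrite subr_ge0 (le_trans _ kwbe)// lerDr.
pose x v : R := (2 ^+ v) `^ be.
have x0 v : 0 <= x v by exact: powR_ge0.
have xE v : x v = (2 `^ be) ^+ v.
  have e2 : 2 ^+ v = 2 `^ v%:R :> R by rewrite powR_mulrn.
  by rewrite /x e2 powRAC powR_mulrn// powR_ge0.
have two_be : 2 <= 2 `^ be :> R by rewrite -[leLHS]powRr1// ler_powR// ler1n.
have QE V : \sum_(0 <= v < V.+1) ((2 ^+ d) ^+ v) `^ (k%:R + w) * rh v =
    \sum_(0 <= v < V.+1) x v * rh v.
  apply: eq_bigr => v _; congr (_ * _); rewrite /x /be powRrM; congr (_ `^ _).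
  by rewrite powR_mulrn ?exprn_ge0// -!exprM mulnC.
rewrite /Qs QE.
have C0 : 0 <= 2 * 2 `^ be :> R by rewrite mulr_ge0// powR_ge0.
pose G V := \sum_(m.+1 <= l < (2 ^ V).+1) l%:R `^ (be - w) * gam l.
have G0 V : 0 <= G V by apply: sumr_ge0 => l _; rewrite mulr_ge0// powR_ge0.
suff H : forall V, (V <= U)%N -> \sum_(0 <= v < V.+1) x v * rh v <=
    2 * 2 `^ be * (m%:R `^ be + G V).
  apply: le_trans (H U (leqnn U)) _; rewrite ler_wpM2l// lerD2l /G.
  have [Um|mU] := leqP (2 ^ U) m.
    rewrite [leLHS]big_geq//; apply: sumr_ge0 => l _; rewrite mulr_ge0// powR_ge0.
  rewrite [leRHS](@big_cat_nat _ _ _ (2 ^ U).+1)//= ?ltnS// ?(ltnW mU)//.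
  by rewrite lerDl; apply: sumr_ge0 => l _; rewrite mulr_ge0// powR_ge0.
have rh_le1 v : rh v <= 1 by case/andP: (rh01 v).
have small V : (2 ^ V <= 2 * m)%N -> \sum_(0 <= v < V.+1) x v * rh v <=
    2 * 2 `^ be * m%:R `^ be.
  move=> Vm; apply: le_trans (_ : \sum_(0 <= v < V.+1) (2 `^ be) ^+ v <= _).
    by apply: ler_sum => v _; rewrite -xE ler_piMr.
  apply: le_trans (sum_geo 0 V two_be) _; rewrite -mulrA ler_wpM2l// -xE /x -powRM//.
  apply: ge0_ler_powR => //; rewrite ?nnegrE ?exprn_ge0 ?mulr_ge0//.
  by rewrite -natrX -natrM ler_nat.
elim=> [|V ih] VU.
  apply: le_trans (small 0%N _) _; first by rewrite expn0 muln_gt0.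
  by rewrite ler_wpM2l// lerDl.
have [Vm|mV] := leqP (2 ^ V) m.
  apply: le_trans (small V.+1 _) _; first by rewrite expnS leq_mul2l Vm orbT.
  by rewrite ler_wpM2l// lerDl.
rewrite big_nat_recr//=; apply: le_trans (lerD (ih (ltnW VU)) (lexx _)) _.
have -> : G V.+1 = G V + \sum_((2 ^ V).+1 <= l < (2 ^ V.+1).+1) l%:R `^ (be - w) * gam l.
  rewrite /G [LHS](@big_cat_nat _ _ _ (2 ^ V).+1)//= ?ltnS ?leq_pexp2l//.
  exact: ltnW.
rewrite addrA [leRHS]mulrDr lerD2l.
apply: le_trans (_ : x V.+1 * (2 * gam (2 ^ V.+1)%N) <= _).
  by rewrite ler_wpM2l// rh_gam.
have -> : x V.+1 = 2 `^ be * x V by rewrite !xE exprS.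
rewrite (_ : _ * (2 * _) = 2 * 2 `^ be * (x V * gam (2 ^ V.+1)%N)); last by ring.
rewrite ler_wpM2l//.
apply: le_trans (_ : \sum_((2 ^ V).+1 <= l < (2 ^ V.+1).+1)
    (2 ^+ V) `^ (be - w) * gam (2 ^ V.+1)%N <= _); last first.
  apply: ler_sum_nat => l /andP[l1 l2]; apply: ler_pM => //.
    apply: ge0_ler_powR; rewrite ?nnegrE ?exprn_ge0//.
    by rewrite -natrX ler_nat ltnW.
  by apply: gam_anti; rewrite -ltnS.
rewrite sumr_const_nat subSS expnS mul2n -addnn addnK -[leRHS]mulr_natl natrX mulrA.
rewrite ler_wpM2r//.
have p1 : 1 <= 2 ^+ V :> R by rewrite exprn_ege1// ler1n.
have p0 : 0 < 2 ^+ V :> R by exact: lt_le_trans p1.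
have -> : x V = (2 ^+ V) `^ w * (2 ^+ V) `^ (be - w).
  by rewrite /x -powRD ?subrKC// (gt_eqF p0) implybT.
by rewrite ler_wpM2r ?powR_ge0// -[leRHS]powRr1 ?ler_powR// ltW.
Qed.

End scale_sums.

(** * From the rescaled sum to the normalized sum of one field *)

Section field_expansion.
Context {disp : measure_display} {Omega : measurableType disp} {R : realType}.
Variable P : probability Omega R.
Context {d : nat} {D : {fset 'rV[int]_d}}.
Variable X : D -> {RV P >-> R}.

(** Below the last scale each extracted point has a neighbourhood of side at most 4 * 2^v; at
    [v = U] the cut is all of [D], and the choice of [U] takes over. *)
Lemma card_cut_le (k U v : nat) (A : seq D) :
  (0 < d)%N -> (#|` D|%fset <= (8 * 2 ^ U) ^ d)%N -> (v <= U)%N -> (size A <= k.+1)%N ->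
  #|cut U v.+1 A|%:R <= k.+1%:R * 8 ^+ d * (2 ^+ d) ^+ v :> R.
Proof.
move=> d0 DU vU Ak.
have -> : k.+1%:R * 8 ^+ d * (2 ^+ d) ^+ v = (k.+1 * (8 * 2 ^ v) ^ d)%:R :> R.
  by rewrite natrM !natrX natrM natrX exprMn -!exprM mulrA (mulnC d).
rewrite ler_nat /cut; case: ifP => [vU'|/negbT]; last first.
  rewrite -leqNgt => Uv; have -> : v = U by apply/eqP; rewrite eqn_leq vU.
  rewrite finset.cardsT -cardfE; apply: leq_trans DU _.
  exact: leq_pmull.
apply: leq_trans (card_nearby _ _) _; apply: leq_mul => //.
by rewrite leq_exp2r// !expnS; lia.
Qed.

Variables (M r w : R) (k U : nat) (rh : nat -> R).
Hypotheses (M0 : 0 < M) (r1 : 1 <= r) (w0 : 0 < w) (d0 : (0 < d)%N).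
Hypothesis q0r : k%:R + 1 + w <= r.
Hypothesis X_intg : forall i, intg P (fun t => `|cX X M^-1 i t| `^ r).
Hypothesis X_norm : forall i, mean P (fun t => `|cX X M^-1 i t| `^ r) <= 1.
Hypothesis X_mean0 : forall i, mean P (X i) = 0.
Hypothesis DU : (#|` D|%fset <= (8 * 2 ^ U) ^ d)%N.
Hypothesis rh01 : forall v, 0 <= rh v <= 1.
Hypothesis rh_mixing : forall v, (v <= U)%N ->
  rho (alpha_mixing X k.+1 (2 ^ v)) (1 - (k%:R + 1 + w) / r) <= rh v.
Hypothesis rh_0 : rh 0%N = 1.
Hypothesis sigma0 : 0 < sigma2 X.

Let s := Num.sqrt (sigma2 X).
Let a := M / s.
Let W := normalized_sum X.
Let S := total X M^-1 [set: D]%SET.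
Let s0 : 0 < s. Proof. by rewrite sqrtr_gt0. Qed.
Let a0 : 0 < a. Proof. by rewrite divr_gt0. Qed.
Let kap : R := k.+1%:R * 8 ^+ d.

Let WE t : W t = a * S t.
Proof.
rewrite /W /normalized_sum /field_sum /S /total mulr_sumr mulr_sumr.
rewrite [RHS](eq_bigl xpredT) => [|i]; last by rewrite finset.in_setT.
apply: eq_bigr => i _; rewrite /cX /a -/s [M / s]mulrC -mulrA [M * _]mulrA.
by rewrite mulfV ?gt_eqF// mul1r.
Qed.

Let error : R := (#|` D|%fset)%:R * (growth k * Cs w k kap k * Qs w U (2 ^+ d) rh k 0).

Let b_ge2 : 2 <= 2 ^+ d :> R.
Proof. by rewrite -[leLHS]expr1 ler_weXn2l// ler1n. Qed.

Let kap0 : 0 <= kap. Proof. by rewrite mulr_ge0// exprn_ge0. Qed.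

Let approx_S := approx_total r1 X_intg X_norm w0 q0r b_ge2 kap0
  (fun v A => @card_cut_le k U v A d0 DU) rh01 rh_mixing rh_0.

Let W_intg j : (j <= k.+1)%N -> intg P (fun t => W t ^+ j).
Proof.
move=> jk; have := intg_total_exp r1 X_intg X_norm w0 q0r jk.
move=> h; apply: eq_intg (intgZ (a ^+ j) h) => t.
by rewrite WE exprMn.
Qed.

Let W_mean : mean P W = 0.
Proof.
have iX i : intg P (X i).
  have h : intg P (fun t => M * (1 + `|cX X M^-1 i t| `^ r)).
    by apply: intgZ; apply: intgD => //; exact: intg_cst.
  apply: intg_le h => // t.
  have -> : X i t = M * cX X M^-1 i t by rewrite /cX mulrA mulfV ?gt_eqF// mul1r.
  rewrite normrM (gtr0_norm M0) ler_pM2l//.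
  have r0 : 0 < r by exact: lt_le_trans r1.
  have := @powR_le1D _ (`|cX X M^-1 i t| `^ r) r^-1 (powR_ge0 _ _).
  rewrite -powRrM mulfV ?gt_eqF// powRr1//; apply.
  by rewrite invr_ge0 ltW//= invf_le1.
rewrite (eq_mean P (Z := fun t => s^-1 * \sum_i X i t))//.
rewrite meanZ; last exact: intg_sum.
by rewrite mean_sum// big1 ?mulr0// => i _; exact: X_mean0.
Qed.

(** The expansion for [S] is applied to the jet of x -> g(ax). The coefficients absorb the powers of
    [a] and stay independent of [g]. *)
Let approx_W : exists c : nat -> R, forall g H, jet w k H g ->
  `|mean P (fun t => W t * g 0%N (W t)) -
    \sum_(j < k.+1) c j * mean P (fun t => g j (W t))| <= H * (a * a `^ (k%:R + w) * error).
Proof.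
have [c hc] := approx_S; exists (fun j => a * c j * a ^+ j) => g H jg.
have jG := jet_scale w0 a0 jg; have H0 := jet_ge0 jg.
have := hc _ _ jG; rewrite -(@ler_pM2l _ a)//.
rewrite -[X in X * `|_|](gtr0_norm a0) -normrM mulrBr mulr_sumr.
rewrite (_ : H * _ = a * (a `^ (k%:R + w) * H * error)); last by ring.
congr (`|_ - _| <= _).
  rewrite -meanZ; last exact: (intg_total_jet r1 X_intg X_norm w0 q0r jG).
  by apply: eq_mean => t; rewrite expr0 mul1r mulrA -WE.
apply: eq_bigr => -[j /= jk] _; rewrite -2!mulrA; congr (_ * (_ * _)).
rewrite -meanZ; first by apply: eq_mean => t; rewrite -WE.
have := intg_jet r1 X_intg X_norm w0 q0r _ jG; rewrite ltnS in jk => /(_ j jk) h.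
apply: eq_intg (intgZ (a ^- j) h) => t.
by rewrite mulrA mulVf ?expf_neq0 ?gt_eqF// mul1r WE.
Qed.

Lemma field_expansion f : f \in holder_space k w ->
  (`| expansion_error P W k f | <=
   (fine (holder_seminorm k w f) * (a * a `^ (k%:R + w) * error))%:E)%E.
Proof.
move=> hf; have jf := holder_jet w0 hf.
have jG := jet_scale w0 a0 jf.
have i1 : intg P (fun t => W t * f (W t)).
  have := intg_total_jet r1 X_intg X_norm w0 q0r jG => h.
  by apply: eq_intg (intgZ a h) => t; rewrite WE expr0 mul1r mulrA.
have i2 j : (j <= k)%N -> intg P (fun t => derive1n j f (W t)).
  move=> jk; have h := intg_jet r1 X_intg X_norm w0 q0r jk jG.
  apply: eq_intg (intgZ (a ^- j) h) => t.
  by rewrite mulrA mulVf ?expf_neq0 ?gt_eqF// mul1r WE.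
have -> : expansion_error P W k f = (mean P (fun t => W t * f (W t)) -
    \sum_(1 <= j < k.+1) cumulant P W j.+1 / j`!%:R * mean P (fun t => derive1n j f (W t)))%:E.
  rewrite /expansion_error (EFin_mean i1) EFinB; congr (_ - _)%E.
  rewrite -sumEFin; apply: eq_big_nat => j /andP[_ jk].
  by rewrite (EFin_mean (i2 _ _))// EFinM.
rewrite lee_fin; exact: (approx_cumulant W_intg W_mean w0 approx_W jf).
Qed.

End field_expansion.

(** * Moments, variance and the choice of the exponent *)

Section moments.
Context {disp : measure_display} {Omega : measurableType disp} {R : realType}.
Variable P : probability Omega R.

(** The case [p = +oo] lets an essentially bounded field be treated with any finite exponent
    [s >= 1] and the same [M]. *)
Lemma Lnorm_moment (Z : {RV P >-> R}) (p : \bar R) (s M : R) :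
  1 <= s -> 0 < M -> p = s%:E \/ p = +oo%E ->
  ('N[P]_p[EFin \o (Z : Omega -> R)] <= M%:E)%E ->
  intg P (fun t => `|M^-1 * Z t| `^ s) /\ mean P (fun t => `|M^-1 * Z t| `^ s) <= 1.
Proof.
move=> s1 M0 ps NM; have s0 : 0 < s by exact: lt_le_trans s1.
have mZ : measurable_fun setT (fun t => `|Z t| `^ s).
  apply: (@measurableT_comp _ _ _ _ _ _ (fun x => x `^ s)).
    exact: measurable_powR.
  exact: measurableT_comp.
have bound : (\int[P]_t (`|Z t| `^ s)%:E <= (M `^ s)%:E)%E.
  case: ps NM => ->.
    move=> NM; have := poweR_Lnorm P (EFin \o (Z : Omega -> R)) (lt0r_neq0 s0).
    rewrite [RHS](_ : _ = \int[P]_t (`|Z t| `^ s)%:E)%E => [<-|]; last first.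
      by apply: eq_integral.
    rewrite -poweR_EFin; apply: gt0_ler_poweR => //; rewrite ?ltW//.
    + by rewrite in_itv/= Lnorm_ge0 leey.
    + by rewrite in_itv/= lee_fin ltW//= leey.
  rewrite unlock /Lnorm ifT; last first.
    by rewrite [X in (_ < X)%E](_ : _ = 1%E) ?lte01//; exact: probability_setT.
  move=> /ess_supP h.
  have -> : (M `^ s)%:E = (\int[P]_t (cst (M `^ s)%:E t))%E.
    by rewrite integral_cst// [X in (_ * X)%E](_ : _ = 1%E) ?mule1//; exact: probability_setT.
  apply: ae_ge0_le_integral => //.
  - exact/measurable_EFinP.
  - by move=> t _; rewrite lee_fin powR_ge0.
  - apply: filterS h => t /= h _; rewrite lee_fin.
    by apply: ge0_ler_powR; rewrite ?nnegrE ?(ltW s0) ?(ltW M0)// -lee_fin.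
have intZ : intg P (fun t => `|Z t| `^ s).
  apply/integrableP; split; first exact/measurable_EFinP.
  apply: le_lt_trans (_ : (M `^ s)%:E < +oo)%E; last exact: ltry.
  apply: le_trans bound; rewrite le_eqVlt; apply/orP; left; apply/eqP.
  by apply: eq_integral => t _ /=; rewrite ger0_norm// powR_ge0.
have E t : `|M^-1 * Z t| `^ s = (M `^ s)^-1 * `|Z t| `^ s.
  rewrite normrM (gtr0_norm (_ : 0 < M^-1)) ?invr_gt0// powRM ?invr_ge0 ?(ltW M0)//.
  by rewrite -powR_inv1 ?(ltW M0)// -powRrM mulN1r powRN.
have Ms : 0 < M `^ s by exact: powR_gt0.
split; first exact: eq_intg E (intgZ _ intZ).
rewrite (eq_mean P E) meanZ// ler_pdivrMl// mulr1 -lee_fin -EFin_mean//.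
by rewrite unlock.
Qed.

End moments.

Section asymptotics.
Context {R : realType}.

Lemma limn_einf_gt0 (u : nat -> R) :
  (0 < limn_einf (fun n => (u n)%:E))%E ->
  exists2 c, 0 < c & \forall n \near \oo, c <= u n.
Proof.
set U := fun n => (u n)%:E; have -> : limn_einf U = ereal_sup (range (einfs U)).
  by rewrite limn_einf_lim; apply/cvg_lim => //; exact: cvg_einfs_sup.
move=> /ereal_sup_gt[_ [n _ <-]] h.
have [c /andP[c0 cn]] : exists c : R, (0 < c%:E <= einfs U n)%E.
  case E : (einfs U n) h => [x| |]//= h.
    by exists x; rewrite h lexx.
  by exists 1; rewrite lte01 leey.
exists c; first by rewrite -lte_fin.
exists n => // j /= nj; rewrite -lee_fin; apply: le_trans cn _.
by apply: ereal_inf_lbound; exists j.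
Qed.

(* Bounded fields have moments of every order s; for s large enough the
   exponent 1 - q0 / s costs at most a factor 2 compared with 1. *)
Lemma rho_limit (al q0 : R) : 0 <= al <= 1 -> 0 <= q0 ->
  exists t : R, forall s, t <= s -> 0 < s -> rho al (1 - q0 / s) <= 2 * al.
Proof.
move=> /andP[al0 al1] q00; rewrite /rho; have [->|aln0] := eqVneq al 0.
  by exists 0 => s _ _; rewrite mulr0.
have alp : 0 < al by rewrite lt0r aln0.
(* The excess factor is x^(1/s); Bernoulli's inequality gives s (x^(1/s) - 1) <= x - 1, so x <= s
   keeps it below 2. *)
pose x := al `^ (- q0); exists (Num.max 1 x) => s; rewrite ge_max => /andP[s1 xs] s0.
have sn0 : s != 0 by rewrite gt_eqF.
rewrite powRD ?aln0 ?implybT// powRr1// mulrC ler_wpM2r//.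
have -> : al `^ (- (q0 / s)) = x `^ s^-1 by rewrite /x -powRrM mulNr.
have x0 : 0 < x by exact: powR_gt0.
have := powR_bernoulli (powR_ge0 x s^-1) s1.
rewrite -powRrM mulVf// powRr1 ?(ltW x0)// => h.
rewrite -(@ler_pM2l _ s)//; move: h; rewrite mulrBr mulr1 => h.
by rewrite mulr_natr mulr2n; lra.
Qed.

(** Finitely many scales share one exponent [s]. It depends on the coefficients, hence on [n], which
    is harmless since the constants of the expansion do not involve [s]. *)
Lemma rho_limit_seq (al : nat -> R) (q0 : R) U :
  (forall v, 0 <= al v <= 1) -> 0 <= q0 ->
  exists2 s, q0 + 1 <= s & forall v, (v <= U)%N -> rho (al v) (1 - q0 / s) <= 2 * al v.
Proof.
move=> al01 q00; have [t ht] : exists t, forall s, t <= s -> 0 < s ->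
    forall v, (v <= U)%N -> rho (al v) (1 - q0 / s) <= 2 * al v.
  elim: U => [|U [t ih]].
    have [t ht] := rho_limit (al01 0%N) q00; exists t => s ts s0 v.
    by rewrite leqn0 => /eqP ->; exact: ht.
  have [t' ht'] := rho_limit (al01 U.+1) q00; exists (Num.max t t') => s.
  rewrite ge_max => /andP[ts t's] s0 v; rewrite leq_eqVlt => /orP[/eqP ->|vU].
    exact: ht'.
  exact: ih.
exists (Num.max t (q0 + 1)); first by rewrite le_max lexx orbT.
apply: ht; first by rewrite le_max lexx.
by rewrite lt_max; apply/orP; right; rewrite ltr_wpDl.
Qed.

(** The variance bound makes M / sqrt(sg) at most M / sqrt(c0) times N^(-1/2); the power 1 + e of
    this, times N, leaves N^(1 - (1 + e) / 2). *)
Lemma variance_scaling (M c0 sg N e : R) : 0 < M -> 0 < c0 -> 0 < N -> c0 * N <= sg ->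
  0 <= e ->
  (M / Num.sqrt sg) * (M / Num.sqrt sg) `^ e * N <=
  (M / Num.sqrt c0) * (M / Num.sqrt c0) `^ e * N `^ (- (e - 1) / 2).
Proof.
move=> M0 c00 N0 cN e0; set a := M / Num.sqrt sg; set b := M / Num.sqrt c0.
have sc : 0 < Num.sqrt c0 by rewrite sqrtr_gt0.
have sN : 0 < Num.sqrt N by rewrite sqrtr_gt0.
have cN0 : 0 < c0 * N by exact: mulr_gt0.
have sg0 : 0 < sg by exact: lt_le_trans cN.
have a0 : 0 <= a by rewrite divr_ge0 ?ltW// sqrtr_gt0.
have b0 : 0 <= b by rewrite divr_ge0 ?ltW.
have ab : a <= b / Num.sqrt N.
  rewrite /a /b -mulrA ler_pM2l// -invfM lef_pV2 ?posrE ?mulr_gt0 ?sqrtr_gt0//.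
  by rewrite -sqrtrM ?(ltW c00)// ler_wsqrtr.
have bN : 0 <= b / Num.sqrt N by exact: le_trans ab.
apply: le_trans (_ : (b / Num.sqrt N) * (b / Num.sqrt N) `^ e * N <= _).
  rewrite ler_pM2r//; apply: ler_pM => //; first exact: powR_ge0.
  by apply: ge0_ler_powR.
have sNE : (Num.sqrt N)^-1 = N `^ (- 2^-1).
  by rewrite powRN powR12_sqrt// ltW.
rewrite sNE powRM ?powR_ge0// -powRrM.
rewrite (_ : _ * _ * N = b * b `^ e * (N `^ (- 2^-1) * N `^ (- 2^-1 * e) * N `^ 1)).
  2: by rewrite (powRr1 (ltW N0)); ring.
have Nn0 (y : R) : (y == 0) ==> (N != 0) by rewrite (gt_eqF N0) implybT.
rewrite -!powRD// le_eqVlt; apply/orP; left; apply/eqP; congr (_ * _ `^ _).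
by field.
Qed.

Lemma ceil_exponent (p w : R) k : 0 < p -> k%:Z = Num.ceil p -> w = p + 1 - k%:R ->
  [/\ (0 < k)%N, 0 < w & w <= 1].
Proof.
move=> p0 kp ->; have /andP[] := ceil_itv p; rewrite -kp intrD mulrN1z.
have -> : (k%:Z)%:~R = k%:R :> R by [].
move=> h1 h2; split; [|lra|lra].
by rewrite -(ltr_nat R); exact: lt_le_trans h2.
Qed.

End asymptotics.

Section field_bound.
Context {R : realType}.

Definition expansion_const (d k : nat) (w M c0 : R) : R :=
  (M / Num.sqrt c0) * (M / Num.sqrt c0) `^ (k%:R + w) *
  (growth k * Cs w k (k.+1%:R * 8 ^+ d) k * (2 * 2 `^ (d%:R * (k%:R + w)))).

(** Common form of both parts of the theorem: [rh] is the decay fed to the dyadic expansion, [gam]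
    its monotone majorant in the final sum, with a factor 2 of slack for the one lost in
    [rho_limit]. *)
Lemma field_bound (disp : measure_display) (Omega : measurableType disp)
  (P : probability Omega R) (d : nat) (D : {fset 'rV[int]_d})
  (X : D -> {RV P >-> R}) (M c0 s w : R) (k U m L : nat) (rh gam : nat -> R) :
  0 < M -> 0 < c0 -> 1 <= s -> 0 < w -> w <= 1 -> (0 < d)%N -> (0 < k)%N ->
  k%:R + 1 + w <= s -> D != fset0 ->
  (forall i, intg P (fun t => `|M^-1 * X i t| `^ s) /\
    mean P (fun t => `|M^-1 * X i t| `^ s) <= 1) ->
  (forall i, mean P (X i) = 0) ->
  c0 * (#|` D|%fset)%:R <= sigma2 X ->
  (#|` D|%fset <= (8 * 2 ^ U) ^ d)%N -> (2 ^ U <= L)%N -> (0 < m)%N ->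
  (forall v, 0 <= rh v <= 1) -> rh 0%N = 1 ->
  (forall v, (v <= U)%N ->
    rho (alpha_mixing X k.+1 (2 ^ v)) (1 - (k%:R + 1 + w) / s) <= rh v) ->
  (forall l, 0 <= gam l) -> (forall l l', (l <= l')%N -> gam l' <= gam l) ->
  (forall v, (0 < v <= U)%N -> rh v <= 2 * gam (2 ^ v)%N) ->
  forall f, f \in holder_space k w ->
  (`| expansion_error P (normalized_sum X) k f | <=
   (expansion_const d k w M c0 *
    (fine (holder_seminorm k w f) *
     (#|` D|%fset)%:R `^ (- (k%:R + w - 1) / 2) *
     (m%:R `^ (d%:R * (k%:R + w)) +
      \sum_(m.+1 <= l < L.+1)
        l%:R `^ (d%:R * (k%:R + w) - w) * gam l)))%:E)%E.
Proof.
move=> M0 c00 s1 w0 w1 d0 k0 q0s D0 Xm X0 cD DU UL m0 rh01 rh_0 rh_mix gam0 gam_anti rh_gam f hf.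
set N : R := (#|` D|%fset)%:R in cD *.
have N0 : 0 < N by rewrite ltr0n cardfs_gt0.
have sg0 : 0 < sigma2 X by apply: lt_le_trans cD; exact: mulr_gt0.
have [H0 _ _] : jet w k (fine (holder_seminorm k w f)) (fun j => derive1n j f) by exact: holder_jet.
set H := fine _ in H0 *.
have kw0 : 0 <= k%:R + w by rewrite addr_ge0// ltW.
have h1 := field_expansion M0 s1 w0 d0 q0s (fun i => (Xm i).1) (fun i => (Xm i).2)
  X0 DU rh01 rh_mix rh_0 sg0 hf.
apply: le_trans h1 _; rewrite lee_fin -/H -/N.
have h2 := Qs_le d0 k0 w0 w1 m0 rh01 gam0 gam_anti rh_gam UL.
have h3 := variance_scaling M0 c00 N0 cD kw0.
move: h2 h3; rewrite /expansion_const.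
set Q := Qs _ _ _ _ _ _; set B := _ + \sum_(_ <= _ < _) _.
set x := _ * _ `^ (k%:R + w); set y := _ * _ `^ (k%:R + w).
set kc := growth k * _; set z := N `^ _; set t := 2 * 2 `^ _ => h2 h3.
have kc0 : 0 <= kc.
  have kap0 : 0 <= k.+1%:R * 8 ^+ d :> R by rewrite mulr_ge0// exprn_ge0.
  by apply: mulr_ge0; [exact: growth_ge0|exact: Cs_ge0].
have Q0 : 0 <= Q.
  by apply: Qs_ge0 => //; rewrite -[leLHS]expr1 ler_weXn2l// ler1n.
have x0 : 0 <= x by rewrite mulr_ge0 ?powR_ge0// divr_ge0 ?sqrtr_ge0// ltW.
have E1 : H * (x * (N * (kc * Q))) = (H * kc) * (x * N * Q) by ring.
have E2 : y * (kc * t) * (H * z * B) = (H * kc) * ((y * z) * (t * B)) by ring.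
rewrite E1 E2; apply: ler_wpM2l; first exact: mulr_ge0.
apply: ler_pM => //; first by rewrite mulr_ge0// ltW.
Qed.

End field_bound.

Theorem propositionE5 (R : realType) (d : nat) (d_gt0 : (0 < d)%N)
  (T : nat -> {fset 'rV[int]_d})
  (T_neq0 : forall n, T n != fset0)
  (T_sub : forall n, (T n `<=` T n.+1)%fset)
  (T_infty : (fun n => #|` T n|%fset) @ \oo --> \oo)
  (disp : nat -> measure_display)
  (Omega : forall n, measurableType (disp n))
  (P : forall n, probability (Omega n) R)
  (X : forall n, T n -> {RV (P n) >-> R})
  (X_L2 : forall n (i : T n), (X n i : Omega n -> R) \in Lfun (P n) 2%:E)
  (X_mean0 : forall n (i : T n), ('E_(P n)[X n i] = 0)%E)
  (p : R) (p_gt0 : 0 < p)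
  (k : nat) (k_def : k%:Z = Num.ceil p)
  (w : R) (w_def : w = p + 1 - k%:R)
  (var_liminf :
    (0 < limn_einf (fun n => (sigma2 (X n) / (#|` T n|%fset)%:R)%:E))%E) :
  let W n := normalized_sum (X n) in
  let a l n := alpha_mixing (X n) k.+1 l in
  let N n : R := (#|` T n|%fset)%:R in
  (forall r : \bar R,
     ((k%:R + 1 + w)%:E < r)%E ->
     (sup_Lnorm X r < +oo)%E ->
     exists C : R, \forall n \near \oo, forall (f : R -> R) (m : nat),
       f \in holder_space k w -> (0 < m)%N ->
       (`| expansion_error (P n) (W n) k f | <=
        (C * (fine (holder_seminorm k w f) *
              N n `^ (- (k%:R + w - 1) / 2) *
              (m%:R `^ (d%:R * (k%:R + w)) +
               \sum_(m.+1 <= l <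
                       (m.+1 + Num.truncn (N n `^ (d%:R^-1) / 2)).+1)
                  l%:R `^ (d%:R * (k%:R + w) - w) *
                  a l n `^ exponent_ratio r (k%:R + 1 + w))))%:E)%E) /\
  ((sup_Lnorm X (k%:R + 1 + w)%:E < +oo)%E ->
     exists C : R, \forall n \near \oo, forall (f : R -> R) (m : nat),
       f \in holder_space k w -> (0 < m)%N -> a m.+1 n = 0 ->
       (`| expansion_error (P n) (W n) k f | <=
        (C * (fine (holder_seminorm k w f) *
              N n `^ (- (k%:R + w - 1) / 2) *
              m%:R `^ (d%:R * (k%:R + w))))%:E)%E).
Proof.
move=> W a N.
have [k0 w0 w1] := ceil_exponent p_gt0 k_def w_def.
have [c0 c00 c0_var] := limn_einf_gt0 var_liminf.
have {}c0_var : \forall n \near \oo, c0 * N n <= sigma2 (X n).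
  apply: filterS c0_var => n; rewrite ler_pdivlMr// ltr0n cardfs_gt0; exact: T_neq0.
set q0 := k%:R + 1 + w.
have q01 : 1 <= q0 by rewrite /q0 -addrA addrCA lerDl addr_ge0// ltW.
have q00 : 0 < q0 by exact: lt_le_trans q01.
have mean0 n i : mean (P n) (X n i) = 0 by rewrite /mean X_mean0.
have normM r : (sup_Lnorm X r < +oo)%E -> exists2 M : R, 0 < M &
    forall n i, ('N[P n]_r[EFin \o (X n i : Omega n -> R)] <= M%:E)%E.
  move=> fin; exists (`|fine (sup_Lnorm X r)| + 1); first by rewrite ltr_wpDl.
  move=> n i; have h : ('N[P n]_r[EFin \o (X n i : Omega n -> R)] <= sup_Lnorm X r)%E.
    by apply: ereal_sup_ubound; exists n, i.
  have fn : sup_Lnorm X r \is a fin_num.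
    by rewrite ge0_fin_numE// (le_trans _ h)// Lnorm_ge0.
  apply: le_trans h _; rewrite -[leLHS]fineK// lee_fin.
  by rewrite (le_trans (ler_norm _))// lerDl.
have al01 n l : 0 <= a l n <= 1 by rewrite /a alpha_mixing_ge0 alpha_mixing_le1.
split.
  move=> r q0r fin; have [M M0 XM] := normM r fin.
  exists (expansion_const d k w M c0); apply: filterS c0_var => n cn f m hf m0.
  have [U [NU UL]] := @exists_scale R d (T n) d_gt0.
  have UL' : (2 ^ U <= m.+1 + Num.truncn (N n `^ (d%:R^-1) / 2))%N.
    by apply: leq_trans UL _; rewrite addSn ltnS leq_addl.
  set th := exponent_ratio r q0.
  (* The working exponent is [r] itself if finite; otherwise it is so large that the mixing term is
     within a factor 2 of the limiting power 1. *)
  have [s [s1 q0s ps th0 rhos]] : exists s : R, [/\ 1 <= s, q0 <= s,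
      r = s%:E \/ r = +oo%E, 0 <= th & forall v, (v <= U)%N ->
      rho (a (2 ^ v)%N n) (1 - q0 / s) <= 2 * a (2 ^ v)%N n `^ th].
    case: r q0r fin XM @th => [s| |]//.
      rewrite lte_fin => /ltW q0s _ _; have s0 : 0 < s by exact: lt_le_trans q0s.
      have thE : exponent_ratio s%:E q0 = 1 - q0 / s.
        by rewrite /= mulrBl mulfV ?gt_eqF.
      exists s; rewrite thE; split => //; [exact: le_trans q0s|by left| |].
        by rewrite subr_ge0 ler_pdivrMr// mul1r.
      move=> v _; apply: (@le_trans _ _ (a (2 ^ v)%N n `^ (1 - q0 / s))).
        by rewrite /rho; case: ifP => // _; exact: powR_ge0.
      by rewrite ler_peMl ?powR_ge0// ler1n.
    move=> _ _ _; have [s qs hs] := rho_limit_seq U (fun v => al01 n (2 ^ v)%N) (ltW q00).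
    exists s; split => //.
    - by rewrite (le_trans _ qs)// lerDr ltW.
    - by rewrite (le_trans _ qs)// lerDl.
    - by right.
    - by move=> v vU /=; rewrite powRr1 ?hs//; case/andP: (al01 n (2 ^ v)%N).
  have sq : 0 <= 1 - q0 / s.
    by rewrite subr_ge0 ler_pdivrMr ?mul1r// (lt_le_trans q00).
  pose rh v := if v == 0%N then 1 else rho (a (2 ^ v)%N n) (1 - q0 / s).
  apply: (@field_bound R _ _ (P n) d (T n) (X n) M c0 s w k U m _ rh
    (fun l => a l n `^ th) M0 c00 s1 w0 w1 d_gt0 k0 q0s (T_neq0 n) _ (mean0 n) cn NU UL' m0 _ erefl
    _ _ _ _ f hf).
  - by move=> i; exact: Lnorm_moment s1 M0 ps (XM n i).
  - by move=> v; rewrite /rh; case: eqP => _; rewrite ?ler01 ?lexx// rho_ge0 rho_le1.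
  - move=> v _; rewrite /rh; case: eqP => // ->.
    by apply: rho_le1 sq; exact: al01.
  - by move=> l; exact: powR_ge0.
  - move=> l l' ll'; apply: ge0_ler_powR; rewrite ?nnegrE ?alpha_mixing_ge0//.
    exact: alpha_mixing_anti.
  - by move=> v /andP[v0 vU]; rewrite /rh gtn_eqF// rhos.
move=> fin; have [M M0 XM] := normM _ fin.
exists (expansion_const d k w M c0); apply: filterS c0_var => n cn f m hf m0 am0.
have [U [NU _]] := @exists_scale R d (T n) d_gt0.
(* No decay up to distance [m] and complete decay beyond. With [gam] the indicator of [l <= m], the
   sum beyond [m] disappears from the bound. *)
pose rh v : R := if (v == 0%N) || (2 ^ v <= m)%N then 1 else 0.
pose gam l : R := if (l <= m)%N then 1 else 0.
have -> : m%:R `^ (d%:R * (k%:R + w)) = m%:R `^ (d%:R * (k%:R + w)) +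
    \sum_(m.+1 <= l < (2 ^ U).+1) l%:R `^ (d%:R * (k%:R + w) - w) * gam l.
  rewrite big_nat big1 ?addr0// => l /andP[ml _].
  by rewrite /gam leqNgt ml mulr0.
apply: (@field_bound R _ _ (P n) d (T n) (X n) M c0 q0 w k U m (2 ^ U)%N rh gam M0
  c00 q01 w0 w1 d_gt0 k0 (lexx q0) (T_neq0 n) _ (mean0 n) cn NU (leqnn _) m0 _ erefl _ _ _ _ f hf).
- by move=> i; apply: Lnorm_moment (XM n i) => //; left.
- by move=> v; rewrite /rh; case: ifP; rewrite ?ler01 ?lexx.
(* At the critical moment the exponent [1 - q0 / q0] is 0, so for [2 ^ v > m] it is the convention
   that [rho] vanishes at 0 that gives the decay. *)
- move=> v _; rewrite mulfV ?gt_eqF// subrr /rh; case: ifPn => [_|].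
    by apply: rho_le1 (lexx 0); exact: (al01 n).
  rewrite negb_or -ltnNge => /andP[_ mv].
  have : alpha_mixing (X n) k.+1 (2 ^ v) <= a m.+1 n by exact: alpha_mixing_anti.
  rewrite am0 => h; rewrite /rho ifT//.
  by rewrite eq_le h alpha_mixing_ge0.
- by move=> l; rewrite /gam; case: ifP.
- move=> l l' ll'; rewrite /gam; case: ifP => [l'm|_].
    by rewrite (leq_trans ll' l'm).
  by case: ifP.
- move=> v /andP[v0 _]; rewrite /rh /gam (gtn_eqF v0)/=; case: ifP => _.
    by rewrite mulr1 ler1n.
  by rewrite mulr0.
Qed.
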